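(* For every fixed integer $k\ge 2$, \[ \frac{3(k-1)}{\log 12}\le \liminf_{x\to\infty}\frac{1}{x\log x}\sum_{n\le x}g_k(n)\le \limsup_{x\to\infty}\frac{1}{x\log x}\sum_{n\le x}g_k(n)\le \frac{k-1}{\log 2}. \]
   Context: $\mathbb N=\{1,2,3,\ldots\}$ and $\log$ is the natural logarithm. For a fixed integer $k\ge 2$ and $n\in\mathbb N$, \[ g_k(n)=\max\{a_1+\cdots+a_k-n:\ a_1!\cdots a_k!\mid n!,\ a_i\in\mathbb N\}. \] The sums run over positive integers $n\le x$. *)

(* Defs.v *)
From HB Require Import structures.
From mathcomp Require Import all_boot all_order all_algebra.
From mathcomp Require Import all_classical all_reals all_analysis.

Set Implicit Arguments.
Unset Strict Implicit.
Unset Printing Implicit Defensive.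

Import Order.TTheory GRing.Theory Num.Theory.
Import numFieldNormedType.Exports.

Local Open Scope ring_scope.

Definition admissible (k n : nat) (a : 'I_k -> nat) : bool :=
  [forall i, (0 < a i)%N] && ((\prod_(i < k) (a i)`!) %| n`!)%N.

(* Only a_i <= n is searched; by g_attained and g_upper_bound below this is
   the maximum over all k-tuples of positive integers. *)
Definition g (k n : nat) : int :=
  (\max_(a : {ffun 'I_k -> 'I_n.+1} | admissible n (fun i => a i : nat))
     \sum_(i < k) (a i : nat))%N%:Z - n%:Z.

Lemma admissible_le (k n : nat) (a : 'I_k -> nat) :
  (0 < n)%N -> admissible n a -> forall i, (a i <= n)%N.
Proof.
move=> n0 /andP[_ adv] i; rewrite leqNgt; apply/negP => nai.
have : ((a i)`! %| n`!)%N.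
  by apply: dvdn_trans adv; rewrite (bigD1 i)//= dvdn_mulr.
move=> /(dvdn_leq (fact_gt0 n)); rewrite leqNgt => /negP; apply.
exact: ltn_fact.
Qed.

Lemma g_upper_bound (k n : nat) (a : 'I_k -> nat) :
  (0 < n)%N -> admissible n a ->
  (\sum_(i < k) a i)%N%:Z - n%:Z <= g k n.
Proof.
move=> n0 aa; rewrite /g lerD2r lez_nat.
pose b : {ffun 'I_k -> 'I_n.+1} := [ffun i => inord (a i)].
have bE i : b i = a i :> nat by rewrite ffunE inordK// ltnS (admissible_le n0 aa).
rewrite -(eq_bigr _ (fun i _ => bE i)).
pose F (c : {ffun 'I_k -> 'I_n.+1}) := (\sum_(i < k) c i)%N.
apply: (leq_bigmax_cond (F := F)).
by rewrite (_ : (fun i => _) = a)//; apply/funext.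
Qed.

Lemma g_attained (k n : nat) :
  (0 < n)%N ->
  exists a : 'I_k -> nat,
    admissible n a /\ g k n = (\sum_(i < k) a i)%N%:Z - n%:Z.
Proof.
move=> n0; pose P (c : {ffun 'I_k -> 'I_n.+1}) := admissible n (fun i => c i : nat).
have P0 : (0 < #|P|)%N.
  apply/card_gt0P; exists [ffun=> inord 1]; rewrite unfold_in /P /admissible.
  have E (i : 'I_k) : ([ffun=> inord 1] : {ffun 'I_k -> 'I_n.+1}) i = 1%N :> nat.
    by rewrite ffunE inordK.
  apply/andP; split; first by apply/forallP => i; rewrite E.
  by rewrite big1 ?dvd1n// => i _; rewrite E.
have [c Pc cE] := eq_bigmax_cond (fun c : {ffun 'I_k -> 'I_n.+1} => (\sum_(i < k) c i)%N) P0.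
exists (fun i => c i : nat); split; first exact: Pc.
by rewrite /g -cE.
Qed.

(* For x >= 0, Num.truncn x is the floor of x, so 1 <= n <= x. *)
Definition normalized_sum (R : realType) (k : nat) (x : R) : R :=
  (x * ln x)^-1 * \sum_(1 <= n < (Num.truncn x).+1) (g k n)%:~R.

(* Main.v *)
Require Import Defs.
From mathcomp Require Import all_boot all_order all_algebra.
From mathcomp Require Import all_classical all_reals all_analysis.
From mathcomp Require Import zify ring lra.
Set Implicit Arguments.
Unset Strict Implicit.
Unset Printing Implicit Defensive.
Import Order.TTheory GRing.Theory Num.Theory.
Import numFieldNormedType.Exports.

(** By Legendre's formula [(p - 1) v_p (n!) = n - s_p (n)], where [s_p] is the digit
sum in base [p]. So positive integers [a_i] of sum [n + D] satisfy the divisibility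
condition if and only if the sum of the [s_p (a_i)] is at least [s_p (n) + D] for
every prime [p], and the question is how large [D] can be.

Upper bound. Only [p = 2] matters. The addition of [k] numbers has at most
[(k - 1) log_2 (n + D)] carries, up to a bounded number per addition, each of which
lowers the binary digit sum by one; and [s_2 (n + D) <= s_2 (n) + s_2 (D)] with
[s_2 (D) = O(log D)]. Hence [D <= (1 + o(1)) (k - 1) log_2 n] for every [n]
([excess_carries], [g_upper]).

Lower bound. Since [g] is nonnegative, it suffices to find, for every [eps > 0] and all
but [eps X] of the [n <= X], numbers [a_i] with [D >= (k - 1) (t - eps) ln X], where
[t = 3 / ln 12] ([g_ge_most]). A random number [m] has [s_p (m)] close to [h_p ln m]
with [h_p = (p - 1) / (2 ln p)]; if all the [a_i] were random, the gain would be
[(k - 1) h_p ln X]. This is enough for [p >= 5], since then [h_p >= t], but not for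
[p = 2] and [p = 3]. The remedy is to set nearly all of the lower digits of [a_i] to
[1] in base [2], or to [2] in base [3]: these digits then count twice in that base. Of
the available length, [k - 1] times [ln X], a share [al] is given to the base [2] and
[be = 1 - al] to the base [3], such that [h_2 (1 + al) = h_3 (1 + be)]; the common value
is [t] ([log_shares], [digit_budget]).

Of the numbers [a_i], [k - 2] are fixed and two vary, [b = r2 + 2 ^ u c] and
[a = r3 + 3 ^ w d]. Every [n] that is not too small is represented by some [(c, d)], as
[2 ^ u] and [3 ^ w] are coprime, and there are only [O(X)] pairs, so it suffices that
most pairs succeed at all primes ([count_transfer], [prod_fact_dvdn], [main_count]).
- For [p <= P0], a constant, digit sums must be typical. For [n] this is Chebyshev's
  inequality. For a number saturated in base [q] it is the main difficulty
  ([structured_number]): a small part of its digits is left free, in each of the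
  blocks of base [W = q ^ K], and the digit sum in base [p] is [p - 1] times the sum of
  the fractional parts of [b / p ^ j]. Changing the free digits moves [b / p ^ j]
  by multiples of some [W ^ i / p ^ j] between [1] and [W]. It equidistributes unless
  this step is near a rational of small denominator, which is rare because
  multiplication by some [W ^ a / p ^ g] close to [1] moves the step away
  ([count_near_rational]). Different blocks are nearly uncorrelated ([second_moment]).
- For [P0 < p <= y], of the order of [(ln X) ^ 4], the low digits of [a] and [b] are
  uniform, and their addition has enough carries, but for a proportion of pairs that
  is exponentially small in the number of carries ([count_few_carries]).
- For [p > y] one of [n + 1], .., [n + D] at most is a multiple of [p], and it is enough
  that [b %% p >= D]. Given [b], few primes violate this ([count_large_primes]). *)

(** * Digit sums and carries *)

(** Summing over [n] positions is enough: the higher digits of [n] vanish. *)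
Definition digit_sum (p n : nat) : nat := (\sum_(i < n) (n %/ p ^ i) %% p)%N.

Lemma digit_sum_wide p n m : (1 < p)%N -> (n <= m)%N ->
  digit_sum p n = (\sum_(i < m) (n %/ p ^ i) %% p)%N.
Proof.
move=> p1 nm; rewrite /digit_sum -!(big_mkord xpredT (fun i => (n %/ p ^ i) %% p)).
rewrite [RHS](@big_cat_nat _ _ _ n) //= [X in (_ + X)%N]big_nat_cond [X in (_ + X)%N]big1 ?addn0 //.
move=> i /andP[/andP[ni _] _]; rewrite divn_small ?mod0n //.
by apply: leq_trans (ltn_expl n p1) _; rewrite leq_exp2l.
Qed.

Lemma digit_sum0 p : digit_sum p 0 = 0%N.
Proof. by rewrite /digit_sum big_ord0. Qed.

Lemma digit_sum_rec p n : (1 < p)%N ->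
  digit_sum p n = (n %% p + digit_sum p (n %/ p))%N.
Proof.
move=> p1; case: n => [|n]; first by rewrite div0n mod0n digit_sum0.
rewrite /digit_sum big_ord_recl /= expn0 divn1; congr (_ + _)%N.
rewrite -/(digit_sum p (n.+1 %/ p)) (digit_sum_wide (m := n) p1); last first.
  by rewrite -ltnS ltn_Pdiv.
by apply: eq_bigr => i _; rewrite /bump /= add1n expnS divnMA.
Qed.

Lemma digit_sum_small p n : (n < p)%N -> digit_sum p n = n.
Proof.
case: p => // p; rewrite ltnS => np.
case: p np => [|p] np; first by move: np; rewrite leqn0 => /eqP ->; rewrite digit_sum0.
by rewrite digit_sum_rec // modn_small // divn_small // digit_sum0 addn0.
Qed.

Lemma digit_sum_cat p u r c : (1 < p)%N -> (r < p ^ u)%N ->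
  digit_sum p (r + p ^ u * c) = (digit_sum p r + digit_sum p c)%N.
Proof.
move=> p1; elim: u r => [|u IH] r.
  by rewrite expn0 ltnS leqn0 => /eqP ->; rewrite mul1n digit_sum0.
move=> ru; rewrite (digit_sum_rec (r + _)) // (digit_sum_rec r) //.
have p0 : (0 < p)%N by lia.
have -> : (p ^ u.+1 * c = p ^ u * c * p)%N by rewrite expnS; lia.
rewrite divnDMl // (addnC r) modnMDl -addnA; congr (_ + _)%N.
by rewrite IH // ltn_divLR // -expnSr.
Qed.

Lemma logn_fact_wide p n m : prime p -> (n <= m)%N ->
  logn p n`! = (\sum_(1 <= k < m.+1) n %/ p ^ k)%N.
Proof.
move=> pp nm; have p1 := prime_gt1 pp; rewrite logn_fact //.
rewrite [RHS](@big_cat_nat _ _ _ n.+1) //= [X in (_ + X)%N]big_nat_cond.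
rewrite [X in (_ + X)%N]big1 ?addn0 //.
move=> i /andP[/andP[ni _] _]; rewrite divn_small //.
by apply: leq_trans (ltn_expl n p1) _; rewrite leq_exp2l // ltnW.
Qed.

Lemma logn_fact_rec p n : prime p ->
  logn p n`! = (n %/ p + logn p (n %/ p)`!)%N.
Proof.
move=> pp; have p1 := prime_gt1 pp.
case: n => [|n]; first by rewrite div0n fact0 logn1.
rewrite (logn_fact_wide (m := n.+1) pp) // big_nat_recl // expn1; congr (_ + _)%N.
rewrite (logn_fact_wide (m := n) pp); last by rewrite -ltnS ltn_Pdiv.
apply: eq_bigr => i _.
by rewrite expnS divnMA.
Qed.

(** Legendre's formula, written without subtraction or division. *)
Lemma logn_fact_legendre p n : prime p ->
  (p.-1 * logn p n`! + digit_sum p n = n)%N.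
Proof.
move=> pp; have p1 := prime_gt1 pp.
elim/ltn_ind: n => -[|n] IH; first by rewrite fact0 logn1 muln0 digit_sum0.
have e := IH (n.+1 %/ p) (ltn_Pdiv p1 (ltn0Sn n)).
rewrite logn_fact_rec // digit_sum_rec // mulnDr.
have E := divn_eq n.+1 p.
have -> : (p.-1 * (n.+1 %/ p) = n.+1 %/ p * p - n.+1 %/ p)%N by rewrite -subn1 mulnBl mul1n mulnC.
have : (n.+1 %/ p <= n.+1 %/ p * p)%N by rewrite leq_pmulr // ltnW.
lia.
Qed.

(** One half of Kummer's theorem: every carry in the addition of [a] and [b]
contributes one to the exponent of [p] in the binomial coefficient. Only the
[J] lowest positions are observed, hence an inequality. *)
Lemma logn_fact_carry p a b J : prime p ->
  (logn p a`! + logn p b`! + \sum_(1 <= k < J.+1) (p ^ k <= a %% p ^ k + b %% p ^ k)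
    <= logn p (a + b)`!)%N.
Proof.
move=> pp; have p0 := prime_gt0 pp; pose m := (a + b + J)%N.
rewrite (logn_fact_wide (n := a) (m := m) pp) ?(logn_fact_wide (n := b) (m := m) pp)
  ?(logn_fact_wide (n := a + b) (m := m) pp); try by rewrite /m; lia.
have -> : (\sum_(1 <= k < m.+1) (a + b) %/ p ^ k = \sum_(1 <= k < m.+1)
  (a %/ p ^ k + b %/ p ^ k + (p ^ k <= a %% p ^ k + b %% p ^ k)))%N.
  by apply: eq_bigr => k _; rewrite divnD // expn_gt0 p0.
rewrite !big_split /= leq_add2l [leqRHS](@big_cat_nat _ _ _ J.+1) //=; last by rewrite /m; lia.
by rewrite leq_addr.
Qed.

Lemma logn_factD p a b : prime p -> (logn p a`! + logn p b`! <= logn p (a + b)`!)%N.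
Proof.
move=> pp; apply: leq_trans (logn_fact_carry a b 0 pp).
by rewrite big_geq ?addn0.
Qed.

(** Each carry replaces [p] units of the digit sum by a single one. *)
Lemma digit_sumD p a b : prime p ->
  (digit_sum p (a + b) <= digit_sum p a + digit_sum p b)%N.
Proof.
move=> pp.
have := logn_fact_legendre a pp; have := logn_fact_legendre b pp.
have := logn_fact_legendre (a + b) pp.
have := leq_mul (leqnn p.-1) (logn_factD a b pp); rewrite mulnDr; lia.
Qed.

Lemma logn_fact_sum p (I : Type) (s : seq I) (a : I -> nat) : prime p ->
  (\sum_(i <- s) logn p (a i)`! <= logn p (\sum_(i <- s) a i)`!)%N.
Proof.
move=> pp; elim: s => [|i s IH]; first by rewrite !big_nil.
rewrite !big_cons; apply: leq_trans (logn_factD _ _ pp).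
by rewrite leq_add2l.
Qed.

Lemma dvdn_logn m n : (0 < m)%N -> (0 < n)%N ->
  (forall p, prime p -> (logn p m <= logn p n)%N) -> (m %| n)%N.
Proof.
move=> m0 n0 H; apply/dvdn_partP => // p; rewrite mem_primes => /and3P[pp _ _].
by rewrite p_part pfactor_dvdn // H.
Qed.

Lemma prod_fact_gt0 (I : Type) (s : seq I) (a : I -> nat) :
  (0 < \prod_(i <- s) (a i)`!)%N.
Proof. by elim/big_ind: _ => // [x y ? ?|i _]; rewrite ?muln_gt0 ?fact_gt0 //; apply/andP. Qed.

Lemma logn_prod_fact p (I : Type) (s : seq I) (a : I -> nat) :
  logn p (\prod_(i <- s) (a i)`!)%N = (\sum_(i <- s) logn p (a i)`!)%N.
Proof.
elim: s => [|i s IH]; first by rewrite !big_nil logn1.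
by rewrite !big_cons lognM ?fact_gt0 ?prod_fact_gt0 // IH.
Qed.

(** In base [2] each carry lowers the digit sum by one, and there is at most one
carry at each of the [l] positions; [c] is the incoming carry, which makes the
induction on [l] possible. *)
Lemma digit_sum2_carries l a b (c : bool) : (a + b + c < 2 ^ l)%N ->
  (digit_sum 2 a + digit_sum 2 b + c <= digit_sum 2 (a + b + c) + l)%N.
Proof.
elim: l a b c => [|l IH] a b c.
  rewrite expn0 ltnS leqn0 => /eqP; case: a => //; case: b => //; case: c => // _.
  by rewrite digit_sum0.
move=> H; rewrite (digit_sum_rec a) // (digit_sum_rec b) // (digit_sum_rec (a + b + c)) //.
have Ea := divn_eq a 2; have Eb := divn_eq b 2.
have : (a %% 2 < 2)%N by rewrite ltn_mod. have : (b %% 2 < 2)%N by rewrite ltn_mod.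
set a' := (a %/ 2)%N in Ea *; set b' := (b %/ 2)%N in Eb *.
set i := (a %% 2)%N in Ea *; set j := (b %% 2)%N in Eb *.
move=> hj hi; pose c' := (2 <= i + j + c)%N.
have Em : ((a + b + c) %% 2 = i + j + c - 2 * c')%N.
  by rewrite Ea Eb /c' ; case: c {H c'} => /=; lia.
have Ed : ((a + b + c) %/ 2 = a' + b' + c')%N.
  by rewrite Ea Eb /c' ; case: c {H c' Em} => /=; lia.
have : (a' + b' + c' < 2 ^ l)%N.
  move: H; rewrite expnS; have := divn_eq (a + b + c) 2; rewrite Ed; lia.
move/IH; rewrite Em Ed /c'; case: (c) => /=; case: leqP => /=; lia.
Qed.

(** * Exponents in factorials at middle and large primes *)

Section Reindex.
Variables (R : Type) (idx : R) (op : Monoid.com_law idx).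

Lemma big_nat_divn A B (F : nat -> R) :
  \big[op/idx]_(0 <= c < A * B) F c =
  \big[op/idx]_(0 <= e < B) \big[op/idx]_(0 <= c < A) F (c + A * e)%N.
Proof.
elim: B => [|B IH]; first by rewrite muln0 !big_geq.
rewrite big_nat_recr //= -IH mulnS addnC (@big_cat_nat _ _ _ (A * B)) ?leq_addr //=.
congr (op _ _); rewrite -{1}[(A * B)%N]add0n big_addn addKn.
by apply: eq_bigr.
Qed.

Lemma big_modn_perm A P r (F : nat -> R) : (0 < P)%N -> coprime A P ->
  \big[op/idx]_(0 <= c < P) F ((r + A * c) %% P)%N = \big[op/idx]_(0 <= c < P) F c.
Proof.
case: P => // P _ AP; rewrite !big_mkord.
pose h (c : 'I_P.+1) : 'I_P.+1 := Ordinal (ltn_pmod (r + A * c) (ltn0Sn P)).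
have hi : injective h.
  move=> c c' /(congr1 val) /= /eqP; rewrite eqn_modDl => /eqP.
  move=> E; apply: val_inj => /=.
  have : (A * c == A * c' %[mod P.+1])%N by apply/eqP.
  wlog le : c c' {E} / (c <= c')%N.
    move=> W; case: (leqP c c') => [|/ltnW] l; first exact: W.
    by rewrite eq_sym => /(W _ _ l).
  rewrite eq_sym eqn_mod_dvd ?leq_mul2l ?le ?orbT // -mulnBr Gauss_dvdr 1?coprime_sym //.
  move=> dv; apply/eqP; rewrite eqn_leq le /= -subn_eq0; apply/negPn/negP => n0.
  have := dvdn_leq _ dv; rewrite lt0n n0 => /(_ isT).
  by rewrite leqNgt; move/negP; apply; have := ltn_ord c'; lia.
rewrite [RHS](reindex h) //=.
exact/onW_bij/injF_bij.
Qed.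

End Reindex.

(** A progression with difference prime to [P] runs through each residue once per
period, and an incomplete period is rounded up. *)
Lemma sum_modn_le C A P r (F : nat -> nat) : (0 < P)%N -> coprime A P ->
  (\sum_(0 <= c < C) F ((r + A * c) %% P) <= (C %/ P).+1 * \sum_(0 <= c < P) F c)%N.
Proof.
move=> P0 AP; apply: (@leq_trans (\sum_(0 <= c < P * (C %/ P).+1) F ((r + A * c) %% P))%N).
  rewrite [leqRHS](@big_cat_nat _ _ _ C) ?leq_addr //=.
  by rewrite mulnC; apply/ltnW/ltn_ceil.
rewrite big_nat_divn -[((_ %/ _).+1)%N in leqRHS]subn0 -sum_nat_const_nat big_mkord /=.
rewrite [leqRHS]big_mkord; apply: leq_sum => e _.
rewrite -(@big_modn_perm _ _ _ A P r F) //; apply/eq_leq/eq_bigr => c _; congr F.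
by rewrite mulnDr addnA mulnCA (mulnC P) addnC modnMDl.
Qed.

(** The Chinese remainder theorem provides the residue [A * c], which is at most [M]. *)
Lemma bezout_nat A B M : coprime A B -> (0 < A)%N -> (0 < B)%N -> (A * B <= M)%N ->
  exists c d, (c < B)%N /\ (A * c + B * d = M)%N.
Proof.
move=> AB A0 B0 le; pose x := (chinese A B 0 M %% (A * B))%N.
have AB0 : (0 < A * B)%N by rewrite muln_gt0 A0.
have /dvdnP[c xE] : (A %| x)%N.
  by rewrite /dvdn modn_dvdm ?dvdn_mulr // chinese_modl ?mod0n.
have xB : (x %% B = M %% B)%N by rewrite modn_dvdm ?dvdn_mull // chinese_modr.
have xlt : (x < A * B)%N by rewrite ltn_mod.
have /dvdnP[d dE] : (B %| M - x)%N.
  by rewrite -eqn_mod_dvd ?xB //; lia.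
exists c, d; split; first by move: xlt; rewrite xE mulnC ltn_pmul2l.
by rewrite [(B * d)%N]mulnC -dE mulnC -xE subnKC //; lia.
Qed.

Lemma logn_fact_range p n D :
  (logn p (n + D)`! = logn p n`! + \sum_(i < D) logn p (n + i.+1))%N.
Proof.
elim: D => [|D IH]; first by rewrite big_ord0 !addn0.
by rewrite big_ord_recr /= addnA -IH addnS factS lognM ?fact_gt0 // addnC.
Qed.

(** At most one of [n + 1], .., [n + D] is a multiple of [p], as [D <= p]. If it is
[n + i + 1], divisible by [p ^ e] exactly, then [b + c] ends in base [p] with the
[e] digits of [D - i - 1 < D]; with [D <= b %% p] this is only possible if the
addition carries at each of the [e] lowest positions. *)
Lemma logn_fact_large p n D b c : prime p -> (D <= p)%N -> (b + c = n + D)%N ->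
  (forall i, (i < D)%N -> (p %| n + i.+1)%N -> (D <= b %% p)%N) ->
  (logn p b`! + logn p c`! <= logn p n`!)%N.
Proof.
move=> pp Dp bc H; have p1 := prime_gt1 pp; have p0 := prime_gt0 pp.
have [/existsP[i di]|/existsPn nd] := boolP [exists i : 'I_D, p %| n + i.+1]; last first.
  apply: leq_trans (logn_factD _ _ pp) _; rewrite bc logn_fact_range big1 ?addn0 // => i _.
  by apply/eqP; rewrite -leqn0 leqNgt logn_gt0 mem_primes pp /= addnS ltn0Sn /= -addnS.
have Db := H i (ltn_ord i) di.
set e := logn p (n + i.+1).
have vE : (logn p (n + D)`! = logn p n`! + e)%N.
  rewrite logn_fact_range (bigD1 i) //= big1 ?addn0 // => j ji.
  apply/eqP; rewrite -leqn0 leqNgt logn_gt0 mem_primes pp /= addnS ltn0Sn /= -addnS.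
  apply/negP => dj; have lj := ltn_ord j; have li := ltn_ord i.
  wlog lt : i j di dj ji Db lj li @e / (i < j)%N.
    move=> W; case: (ltngtP i j) => [l|l|/val_inj E]; first exact: (W i j).
      by apply: (W j i) => //; rewrite eq_sym.
    by rewrite E eqxx in ji.
  have : (p %| (n + j.+1) - (n + i.+1))%N by rewrite dvdn_sub.
  by move/dvdn_leq => /(_ ltac:(lia)); lia.
rewrite -(leq_add2r e) -vE -bc; apply: leq_trans (logn_fact_carry b c e pp).
rewrite leq_add2l; apply: (@leq_trans (\sum_(1 <= k < e.+1) 1)%N).
  by rewrite sum_nat_const_nat subSS subn0 muln1.
rewrite [leqRHS]big_nat_cond [leqLHS]big_nat_cond; apply: leq_sum => k /andP[/andP[k1 ke] _].
set q := (p ^ k)%N; have q0 : (0 < q)%N by rewrite expn_gt0 p0.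
have dq : (q %| n + i.+1)%N by rewrite pfactor_dvdn // addnS.
have pq : (p %| q)%N by rewrite /q -(prednK k1) expnS dvdn_mulr.
have li := ltn_ord i.
have s0 : ((b + c) %% q = D - i.+1)%N.
  rewrite bc (_ : n + D = (n + i.+1) + (D - i.+1))%N; last by lia.
  rewrite -modnDml (eqP dq) add0n modn_small //.
  by apply: leq_trans (dvdn_leq q0 pq); lia.
rewrite lt0b leqNgt; apply/negP => lt.
have : ((b + c) %% q = b %% q + c %% q)%N by rewrite -modnDm modn_small.
have : (b %% p <= b %% q)%N by rewrite -(modn_dvdm b pq) leq_mod.
by rewrite s0; move: (b %% p)%N (b %% q)%N (c %% q)%N Db li => x z t; clear; lia.
Qed.

(** Among [D] consecutive integers there is at most one more multiple of [p ^ k] than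
among [1], .., [D], and none when [k > e]. *)
Lemma logn_fact_middle p n D e : prime p ->
  (forall i, (i < D)%N -> ~~ (p ^ e.+1 %| n + i.+1)%N) ->
  (logn p (n + D)`! <= logn p n`! + logn p D`! + e)%N.
Proof.
move=> pp H; have p0 := prime_gt0 pp; pose m := (n + D + e)%N.
rewrite (logn_fact_wide (n := n) (m := m) pp) ?(logn_fact_wide (n := D) (m := m) pp)
  ?(logn_fact_wide (n := n + D) (m := m) pp); try by rewrite /m; lia.
have H' k : (e < k)%N -> ((n + D) %/ p ^ k = n %/ p ^ k)%N.
  move=> ek; set q := (p ^ k)%N; have q0 : (0 < q)%N by rewrite expn_gt0 p0.
  apply/eqP; rewrite eqn_leq [X in _ && X]leq_div2r ?leq_addr // andbT leqNgt; apply/negP => lt.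
  have h1 : (n < (n + D) %/ q * q)%N by rewrite -ltn_divLR.
  have h2 : ((n + D) %/ q * q <= n + D)%N by rewrite leq_trunc_div.
  have := H ((n + D) %/ q * q - n.+1)%N ltac:(lia); move/negP; apply.
  rewrite (_ : n + _.+1 = (n + D) %/ q * q)%N; last by lia.
  by rewrite dvdn_mull // /q dvdn_exp2l.
apply: (@leq_trans (\sum_(1 <= k < m.+1) (n %/ p ^ k + D %/ p ^ k + (k <= e)))%N).
  apply: leq_sum => k _; case: (leqP k e) => ke; last by rewrite H' // -addnA leq_addr.
  by rewrite divnD ?expn_gt0 ?p0 // leq_add2l leq_b1.
rewrite !big_split /= leq_add2l (@big_cat_nat _ _ _ e.+1) //=; last by rewrite /m; lia.
rewrite [X in (_ + X <= _)%N]big_nat_cond [X in (_ + X <= _)%N]big1; last first.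
  by move=> k /andP[/andP[k1 _] _]; rewrite leqNgt k1.
rewrite addn0; apply: (@leq_trans (\sum_(1 <= k < e.+1) 1)%N).
  by apply: leq_sum => k _; rewrite leq_b1.
by rewrite sum_nat_const_nat subSS subn0 muln1.
Qed.

(** Carries that happen without the help of an incoming carry. For random digits
these events are independent at different positions. *)
Definition low_carries (p J a b : nat) : nat :=
  (\sum_(j < J) (p <= (a %/ p ^ j) %% p + (b %/ p ^ j) %% p))%N.

Lemma modn_expS p j a : (a %% p ^ j.+1 = (a %/ p ^ j) %% p * p ^ j + a %% p ^ j)%N.
Proof.
have [->|p0] := posnP p.
  by rewrite exp0n // modn0 modn0; case: j => [|j]; rewrite ?expn0 ?divn1 ?modn1 ?muln1 ?addn0 // exp0n // muln0 modn0.
have q0 : (0 < p ^ j)%N by rewrite expn_gt0 p0.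
rewrite {1}(divn_eq a (p ^ j)) {1}(divn_eq (a %/ p ^ j) p) mulnDl -mulnA -expnS -addnA modnMDl.
rewrite modn_small // expnS.
have h1 : ((a %/ p ^ j) %% p < p)%N by rewrite ltn_mod.
have h2 : (a %% p ^ j < p ^ j)%N by rewrite ltn_mod.
have := leq_mul h1 (leqnn (p ^ j)%N); lia.
Qed.

Lemma low_carries_le p J a b :
  (low_carries p J a b <= \sum_(1 <= k < J.+1) (p ^ k <= a %% p ^ k + b %% p ^ k))%N.
Proof.
rewrite big_add1 big_mkord; apply: leq_sum => j _.
case: (leqP p) => // h; rewrite lt0b !modn_expS expnS.
by apply: leq_trans (leq_mul h (leqnn (p ^ j)%N)) _; rewrite mulnDl leq_add // leq_addr.
Qed.

Lemma low_carries_rec p J a b d d' : (d < p)%N -> (d' < p)%N ->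
  low_carries p J.+1 (d + p * a) (d' + p * b) = ((p <= d + d') + low_carries p J a b)%N.
Proof.
move=> dp d'p; rewrite /low_carries big_ord_recl /= expn0 !divn1.
have p0 : (0 < p)%N by lia.
have E x y : (x < p)%N -> ((x + p * y) %% p = x)%N.
  by move=> xp; rewrite addnC mulnC modnMDl modn_small.
have E' x y : (x < p)%N -> ((x + p * y) %/ p = y)%N.
  by move=> xp; rewrite addnC mulnC divnMDl // divn_small // addn0.
rewrite !E //; congr (_ + _)%N; apply: eq_bigr => j _.
by rewrite /bump /= add1n expnS !divnMA !E'.
Qed.

(** * Counting exceptional pairs and exceptional integers *)

Lemma exists_leq_sum (T : finType) (P : pred T) :
  ([exists x, P x] <= \sum_x P x)%N.
Proof.
case: existsP => // -[x Px]; rewrite (bigD1 x) //= Px; exact: leq_addr.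
Qed.

Lemma has_leq_sum (T : Type) (P : pred T) (s : seq T) : (has P s <= \sum_(x <- s) P x)%N.
Proof. by elim: s => [|x s IH] //=; rewrite big_cons; case: (P x). Qed.

Lemma low_carries_leJ p J a b : (low_carries p J a b <= J)%N.
Proof.
rewrite /low_carries -[leqRHS]muln1 -[J in leqRHS]card_ord -sum_nat_const.
by apply: leq_sum => j _; exact: leq_b1.
Qed.

Lemma low_carries_mod p J a b : (0 < p)%N ->
  low_carries p J (a %% p ^ J) (b %% p ^ J) = low_carries p J a b.
Proof.
move=> p0; apply: eq_bigr => j _.
have E x : ((x %% p ^ J %/ p ^ j) %% p = (x %/ p ^ j) %% p)%N.
  by rewrite !modn_divl modn_dvdm // -expnS dvdn_exp2l.
by rewrite !E.
Qed.

(** Two random digits add up to [p] or more with probability [(p - 1) / (2 p)], which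
is at least [2 / 5]; so [2 ^ - carry] has mean at most [4 / 5]. *)
Lemma sum_digit_pairs p : (5 <= p)%N ->
  (5 * \sum_(0 <= d < p) \sum_(0 <= d' < p) 2 ^ (1 - (p <= d + d')) <= 8 * p ^ 2)%N.
Proof.
move=> p5.
have E d : (d <= p)%N -> (\sum_(0 <= d' < p) 2 ^ (1 - (p <= d + d')) = 2 * p - d)%N.
  move=> dp; rewrite (@big_cat_nat _ _ _ (p - d)) ?leq_subr //=.
  rewrite [X in (X + _)%N]big_nat_cond (eq_bigr (fun=> 2%N)); last first.
    by move=> i /andP[/andP[_ h] _]; have -> : (p <= d + i) = false by lia.
  rewrite -big_nat_cond sum_nat_const_nat subn0.
  rewrite [X in (_ + X)%N]big_nat_cond (eq_bigr (fun=> 1%N)); last first.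
    by move=> i /andP[/andP[h _] _]; have -> : (p <= d + i) by lia.
  by rewrite -big_nat_cond sum_nat_const_nat; lia.
rewrite (@eq_big_nat _ _ _ _ _ _ (fun d => 2 * p - d)%N); last by move=> d /andP[_ /ltnW]; exact: E.
have S m : (m <= p)%N -> (2 * (\sum_(0 <= d < m) (2 * p - d)) + m * m = 4 * p * m + m)%N.
  elim: m => [|m IH] mp; first by rewrite big_geq //; lia.
  rewrite big_nat_recr //=; have := IH (ltnW mp); move: (\sum_(0 <= i < m) _)%N => T.
  nia.
have := S p (leqnn p); rewrite expnS expn1; nia.
Qed.

(** The product of the means of the previous lemma over [J] independent positions. *)
Lemma sum_low_carries p J : (5 <= p)%N ->
  (5 ^ J * \sum_(0 <= a < p ^ J) \sum_(0 <= b < p ^ J) 2 ^ (J - low_carries p J a b)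
    <= 8 ^ J * p ^ (2 * J))%N.
Proof.
move=> p5; elim: J => [|J IH].
  by rewrite !expn0 !big_nat1 /low_carries big_ord0.
set G := (\sum_(0 <= a < p ^ J) \sum_(0 <= b < p ^ J) 2 ^ (J - low_carries p J a b))%N in IH.
rewrite (_ : (\sum_(0 <= a < p ^ J.+1) _)%N =
   (\sum_(0 <= d < p) \sum_(0 <= d' < p) 2 ^ (1 - (p <= d + d'))) * G)%N; last first.
  rewrite expnS big_nat_divn exchange_big /= big_distrl /=.
  apply: eq_big_nat => d /andP[_ dp].
  under eq_bigr => a _ do rewrite big_nat_divn exchange_big /=.
  rewrite exchange_big /= big_distrl /=; apply: eq_big_nat => d' /andP[_ d'p].
  rewrite /G big_distrr /=; apply: eq_bigr => a _.
  rewrite big_distrr /=; apply: eq_bigr => b _.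
  rewrite low_carries_rec // -expnD; congr (_ ^ _)%N.
  by have := low_carries_leJ p J a b; case: (p <= d + d')%N => /=; lia.
have := leq_mul (sum_digit_pairs p5) IH.
set S := (\sum_(0 <= d < p) _)%N.
have -> : (2 * J.+1 = 2 + 2 * J)%N by lia.
rewrite !expnS expn0 muln1.
by move: (5 ^ J)%N (8 ^ J)%N (p ^ (2 * J))%N => x y z; lia.
Qed.

(** Markov's inequality for [2 ^ - carries]. The factor [12] is large enough for the
probability [2 ^ J * (4 / 5) ^ (12 J)] to be at most [4 ^ - J]. *)
Lemma count_few_carries p J : (5 <= p)%N ->
  (4 ^ J * \sum_(0 <= a < p ^ (12 * J)) \sum_(0 <= b < p ^ (12 * J))
      (low_carries p (12 * J) a b < J) <= (p ^ (12 * J)) ^ 2)%N.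
Proof.
move=> p5; have := sum_low_carries (12 * J) p5.
set B := (\sum_(0 <= a < _) \sum_(0 <= b < _) (_ < J : nat))%N.
set G := (\sum_(0 <= a < _) _)%N => HG.
have BG : (2 ^ (11 * J) * B <= G)%N.
  rewrite /B /G big_distrr /=; apply: leq_sum => a _; rewrite big_distrr /=; apply: leq_sum => b _.
  case: ltnP => h; rewrite ?muln0 // muln1 leq_exp2l //; lia.
rewrite -(@leq_pmul2l (8 ^ (12 * J))%N) ?expn_gt0 // mulnA.
rewrite -expnM (_ : 12 * J * 2 = 2 * (12 * J))%N; last by lia.
apply: leq_trans HG.
apply: (@leq_trans (5 ^ (12 * J) * (2 ^ (11 * J) * B))%N); last by rewrite leq_mul.
rewrite mulnA leq_mul2r; apply/orP; right.
have -> : (8 ^ (12 * J) * 4 ^ J = (2 ^ 9) ^ (3 * J) * 2 ^ (11 * J))%N.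
  rewrite (_ : 8 = 2 ^ 3)%N // (_ : 4 = 2 ^ 2)%N // -!expnM -!expnD.
  by congr (_ ^ _)%N; lia.
rewrite mulnC [leqRHS]mulnC leq_mul2l; apply/orP; right.
rewrite (_ : 12 * J = 4 * (3 * J))%N; last by lia.
rewrite (expnM 5); case: (3 * J)%N => // e.
by rewrite leq_exp2r.
Qed.

(** A progression of length at least [p ^ (12 J)] is uniform modulo [p ^ (12 J)] up to
a factor [2], one for each of the two coordinates. *)
Lemma count_few_carries_progression p J A A' r r' C C' : (5 <= p)%N ->
  coprime A p -> coprime A' p -> (p ^ (12 * J) <= C)%N -> (p ^ (12 * J) <= C')%N ->
  (4 ^ J * \sum_(0 <= c < C) \sum_(0 <= d < C')
      (low_carries p (12 * J) (r + A * c) (r' + A' * d) < J) <= 4 * (C * C'))%N.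
Proof.
move=> p5 cA cA'; set P := (p ^ (12 * J))%N => PC PC'.
have p0 : (0 < p)%N by lia.
have P0 : (0 < P)%N by rewrite expn_gt0 p0.
pose F a b : nat := (low_carries p (12 * J) a b < J)%N.
have Fm a b : F a b = F (a %% P)%N (b %% P)%N by rewrite /F low_carries_mod.
have H1 : (\sum_(0 <= c < C) \sum_(0 <= d < C') F (r + A * c) (r' + A' * d)
   <= (C %/ P).+1 * ((C' %/ P).+1 * \sum_(0 <= a < P) \sum_(0 <= b < P) F a b))%N.
  apply: (@leq_trans (\sum_(0 <= c < C) (C' %/ P).+1 * \sum_(0 <= b < P) F ((r + A * c) %% P) b)%N).
    apply: leq_sum => c _; under eq_bigr => d _ do rewrite Fm.
    by apply: sum_modn_le; rewrite ?coprimeXr.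
  rewrite -big_distrr /= mulnCA leq_mul2l; apply/orP; right.
  by apply: (@sum_modn_le C A P r (fun a => \sum_(0 <= b < P) F a b)%N); rewrite ?coprimeXr.
have H2 := count_few_carries J p5; rewrite -/P in H2.
have D X : (P <= X)%N -> ((X %/ P).+1 * P <= 2 * X)%N.
  by move=> PX; have := leq_trunc_div X P; rewrite mulSn; lia.
have H3 := leq_mul (D _ PC) (D _ PC').
apply: leq_trans (leq_mul (leqnn _) H1) _.
set B := (\sum_(0 <= a < P) _)%N in H1 H2 *.
apply: (@leq_trans ((C %/ P).+1 * (C' %/ P).+1 * (P ^ 2))%N).
  apply: leq_trans (leq_mul (leqnn _) H2); rewrite -/B; nia.
rewrite expnS expn1; nia.
Qed.

Lemma size_primes_lt m l : (0 < m)%N -> (m < 2 ^ l)%N -> (size (primes m) <= l)%N.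
Proof.
move=> m0 ml; rewrite -(leq_exp2l _ _ (isT : 1 < 2)%N).
apply: leq_trans (ltnW ml); rewrite {2}(prod_prime_decomp m0) /primes size_map.
have H f : f \in prime_decomp m -> (2 <= f.1 ^ f.2)%N.
  case: f => q e /mem_prime_decomp[qp e0 _] /=.
  apply: leq_trans (prime_gt1 qp) _; rewrite -(prednK e0) expnS leq_pmulr //.
  by rewrite expn_gt0 prime_gt0.
elim: (prime_decomp m) H => [|f s IH] H; first by rewrite big_nil.
rewrite big_cons /= expnS leq_mul ?H ?mem_head // IH // => g gs.
by rewrite H // inE gs orbT.
Qed.

(** For a given [c], a prime [p] with [b c %% p = r < D] divides [b c - r], which
leaves at most [l] primes for each of the [D] values of [r]; and each prime
[p > y] divides one of the [D] shifts of [A' * d] for few [d] only. *)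
Lemma count_large_primes y D l C C' A' (b s : nat -> nat) : (0 < y)%N ->
  (forall p, prime p -> (y < p)%N -> coprime A' p) ->
  (forall c, (c < C)%N -> (D <= b c < 2 ^ l)%N) ->
  (\sum_(0 <= c < C) \sum_(0 <= d < C')
     [exists r : 'I_D, has (fun p => (y < p) && [exists i : 'I_D, p %| s c + i + A' * d]) (primes (b c - r))]
   <= C * (D * (l * (D * (C' %/ y).+1))))%N.
Proof.
move=> y0 cop hb; rewrite -[X in (X * _)%N]subn0 -sum_nat_const_nat.
rewrite big_nat_cond [leqRHS]big_nat_cond; apply: leq_sum => c /andP[/andP[_ /hb/andP[hD h2]] _].
apply: (@leq_trans (\sum_(r < D) \sum_(p <- primes (b c - r)) (D * (C' %/ y).+1))%N); last first.
  rewrite -[D in leqRHS]card_ord -[leqRHS]sum_nat_const; apply: leq_sum => r _.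
  rewrite card_ord big_const_seq count_predT iter_addn_0 mulnC leq_mul2r size_primes_lt ?orbT //; last by lia.
  by rewrite subn_gt0; apply: leq_trans hD.
apply: (@leq_trans (\sum_(0 <= d < C') \sum_(r < D) \sum_(p <- primes (b c - r))
   ((y < p) && [exists i : 'I_D, p %| s c + i + A' * d]))%N).
  apply: leq_sum => d _; apply: leq_trans (exists_leq_sum _) _; apply: leq_sum => r _.
  exact: has_leq_sum.
rewrite exchange_big /=; apply: leq_sum => r _; rewrite exchange_big /=.
rewrite big_seq [leqRHS]big_seq; apply: leq_sum => p.
rewrite mem_primes => /and3P[pp _ _]; case: (ltnP y p) => yp /=; last first.
  by rewrite big1.
apply: (@leq_trans (\sum_(0 <= d < C') \sum_(i < D) (p %| s c + i + A' * d))%N).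
  by apply: leq_sum => d _; exact: exists_leq_sum.
rewrite exchange_big /= -[D in leqRHS]card_ord -sum_nat_const; apply: leq_sum => i _.
apply: leq_trans (@sum_modn_le C' A' p (s c + i) (fun x => x == 0)%N _ _) _.
- exact: prime_gt0.
- exact: cop.
have -> : (\sum_(0 <= x < p) (x == 0) = 1)%N.
  by rewrite big_ltn ?prime_gt0 //= big_nat_cond big1 // => x /andP[/andP[x0 _] _]; case: x x0.
by rewrite muln1 ltnS leq_div2l // ltnW.
Qed.

(** The powers that occur exceed [y ^ 2], while there are only [y.+1] primes and [D]
shifts to consider. *)
Lemma count_prime_powers y D X : (0 < y)%N ->
  (\sum_(0 <= n < X) [exists p : 'I_y.+1, (1 < p) &&
      [exists i : 'I_D, p ^ (trunc_log p (y ^ 2)).+1 %| n + i.+1]]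
   <= y.+1 * (D * (X %/ y ^ 2).+1))%N.
Proof.
move=> y0; apply: (@leq_trans (\sum_(0 <= n < X) \sum_(p < y.+1) \sum_(i < D)
   ((1 < p) && (p ^ (trunc_log p (y ^ 2)).+1 %| n + i.+1)))%N).
  apply: leq_sum => n _; apply: leq_trans (exists_leq_sum _) _; apply: leq_sum => p _.
  by case: (1 < p)%N => //=; exact: exists_leq_sum.
rewrite exchange_big /= -[y.+1 in leqRHS]card_ord -sum_nat_const; apply: leq_sum => p _.
rewrite exchange_big /= -[D in leqRHS]card_ord -sum_nat_const; apply: leq_sum => i _.
case: (ltnP 1 p) => [p1|_] /=; last by rewrite big1.
set q := (p ^ _)%N; have qy : (y ^ 2 < q)%N by exact: trunc_log_ltn.
have q0 : (0 < q)%N by lia.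
under eq_bigr => n _ do rewrite addnC -[n in (_ + n)%N]mul1n /dvdn.
apply: leq_trans (@sum_modn_le X 1 q i.+1 (fun x => x == 0)%N q0 (coprime1n _)) _.
have -> : (\sum_(0 <= x < q) (x == 0) = 1)%N.
  by rewrite big_ltn //= big_nat_cond big1 // => x /andP[/andP[x0 _] _]; case: x x0.
by rewrite muln1 ltnS leq_div2l ?expn_gt0 ?y0 // ltnW.
Qed.

(** * A divisibility criterion, and its transfer to pairs *)

(** The three ways of bounding the exponent of [p] in the product of the factorials,
for [s = b :: a :: ys] of sum [n + D]. For [p <= P0] this is Legendre's formula.
For [P0 < p <= y] the carries of [a + b] outweigh [(n + D)! / n!]. For [p > y] the
number [b] alone makes up for it, by [logn_fact_large]. *)
Lemma prod_fact_dvdn (P0 y D n a b : nat) (ys : seq nat) (J : nat -> nat) :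
  (D <= y)%N -> (sumn ys + (a + b) = n + D)%N ->
  (forall p, prime p -> (p <= P0)%N ->
     (D + digit_sum p n <= \sum_(x <- ys) digit_sum p x + (digit_sum p a + digit_sum p b))%N) ->
  (forall p, prime p -> (P0 < p)%N -> (p <= y)%N ->
     (J p <= low_carries p (12 * J p) a b)%N /\
     (logn p D`! + trunc_log p (y ^ 2) <= J p)%N /\
     forall i, (i < D)%N -> ~~ (p ^ (trunc_log p (y ^ 2)).+1 %| n + i.+1)%N) ->
  (forall p, prime p -> (y < p)%N -> forall i, (i < D)%N -> (p %| n + i.+1)%N -> (D <= b %% p)%N) ->
  (\prod_(x <- [:: b, a & ys]) x`! %| n`!)%N.
Proof.
move=> Dy E H1 H2 H3; apply: dvdn_logn => [||p pp]; [exact: prod_fact_gt0|exact: fact_gt0|].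
rewrite logn_prod_fact !big_cons.
have p0 : (0 < p.-1)%N by rewrite -ltnS prednK ?prime_gt1 ?prime_gt0.
have sE : sumn ys = (\sum_(x <- ys) x)%N by rewrite sumnE.
have hys := logn_fact_sum ys id pp; rewrite -sE in hys.
have [small|large] := leqP p P0.
  rewrite -(leq_pmul2l p0).
  have L x := logn_fact_legendre x pp.
  have Ly : (p.-1 * (\sum_(x <- ys) logn p x`!) + \sum_(x <- ys) digit_sum p x = sumn ys)%N.
    by rewrite sE big_distrr /= -big_split /=; apply: eq_bigr => x _; exact: L.
  have := H1 p pp small; have := L n; have := L a; have := L b.
  by rewrite !mulnDr; lia.
have [mid|big] := leqP p y.
  have [c1 [c2 c3]] := H2 p pp large mid.
  have c4 := logn_fact_carry a b (12 * J p) pp.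
  have c5 := low_carries_le p (12 * J p) a b.
  have c6 := logn_factD (sumn ys) (a + b) pp; rewrite E in c6.
  have c7 := logn_fact_middle pp c3.
  by lia.
have := logn_factD (sumn ys) a pp.
have E' : (b + (sumn ys + a) = n + D)%N by rewrite -E; lia.
have := logn_fact_large pp (leq_trans Dy (ltnW big)) E' (H3 p pp big).
by lia.
Qed.

(** Every [n] in the middle range is represented by some pair [(c, d)], and each pair
represents a single [n]; so the bad pairs bound the bad [n]. *)
Lemma count_transfer A B C C' N0 D X1 X (good : nat -> bool) (badn : nat -> bool)
    (badp : nat -> nat -> bool) :
  coprime A B -> (0 < A)%N -> (0 < B)%N -> (B <= C)%N ->
  (forall n, (X1 <= n)%N -> (N0 + A * B <= n + D)%N) -> (X + D < B * C')%N ->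
  (forall n c d, (X1 <= n <= X)%N -> (c < C)%N -> (d < C')%N -> (N0 + (A * c + B * d) = n + D)%N ->
     ~~ badp c d -> ~~ badn n -> good n) ->
  (\sum_(0 <= n < X.+1) (~~ good n) <=
    X1 + \sum_(0 <= n < X.+1) badn n + \sum_(0 <= c < C) \sum_(0 <= d < C') badp c d)%N.
Proof.
move=> cop A0 B0 BC hlo hhi H.
apply: (@leq_trans (\sum_(0 <= n < X.+1) ((n < X1) + badn n +
   \sum_(0 <= c < C) \sum_(0 <= d < C') ((N0 + (A * c + B * d) == n + D) && badp c d)))%N).
  rewrite big_nat_cond [leqRHS]big_nat_cond; apply: leq_sum => n /andP[/andP[_ nX] _].
  have [lt|ge] := ltnP n X1; first by apply: leq_trans (leq_b1 _) _; rewrite -addnA leq_addr.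
  case gn: (good n) => //=; case bn: (badn n) => //=.
  have le : (A * B <= n + D - N0)%N by have := hlo n ge; lia.
  have [c [d [cB cd]]] := bezout_nat cop A0 B0 le.
  have cC : (c < C)%N by apply: leq_trans BC.
  have e : (N0 + (A * c + B * d) = n + D)%N by rewrite cd subnKC //; have := hlo n ge; lia.
  have dC : (d < C')%N.
    rewrite -(ltn_pmul2l B0); apply: leq_ltn_trans hhi; rewrite -ltnS in nX; lia.
  have bp : badp c d.
    apply/negPn/negP => nb; move: gn; rewrite (H n c d) ?ge ?bn //.
  by rewrite add0n big_mkord (bigD1 (Ordinal cC)) //= big_mkord (bigD1 (Ordinal dC)) //= e eqxx bp.
rewrite !big_split /=; apply: leq_add; first apply: leq_add.
- apply: (@leq_trans (\sum_(0 <= n < X.+1 + X1) (n < X1))%N).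
    by rewrite [leqRHS](@big_cat_nat _ _ _ X.+1) ?leq_addr //=.
  rewrite (@big_cat_nat _ _ _ X1) ?leq_addl //= [X in (_ + X)%N]big_nat_cond [X in (_ + X)%N]big1.
    rewrite addn0; apply: (@leq_trans (\sum_(0 <= n < X1) 1)%N).
      by apply: leq_sum => n _; exact: leq_b1.
    by rewrite sum_nat_const_nat subn0 muln1.
  by move=> n /andP[/andP[h _] _]; rewrite ltnNge h.
- by [].
rewrite exchange_big /=; apply: leq_sum => c _; rewrite exchange_big /=; apply: leq_sum => d _.
case: (badp c d); last by rewrite big1 // => n _; rewrite andbF.
under eq_bigr do rewrite andbT.
have [lt|ge] := ltnP (N0 + (A * c + B * d)) D.
  by rewrite big1 // => n _; apply/eqP; rewrite eqb0; apply/eqP; lia.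
apply: (@leq_trans (\sum_(0 <= n < X.+1) (n == N0 + (A * c + B * d) - D))%N).
  by apply: leq_sum => n _; case: eqP => // e; rewrite e addnK eqxx.
have P m : (\sum_(0 <= n < m) (n == N0 + (A * c + B * d) - D) <=
  ((N0 + (A * c + B * d) - D) < m))%N.
  elim: m => [|m IH]; first by rewrite big_geq.
  rewrite big_nat_recr //=; move: IH; case: ltngtP => //= h; case: ltngtP => //= h'; try lia.
by apply: leq_trans (P _) (leq_b1 _).
Qed.

Local Open Scope ring_scope.

(** * The digit sum of a random integer *)

Lemma sum_centered_digits (R : realFieldType) (p : nat) :
  \sum_(0 <= d < p) ((2 * d)%:R - p.-1%:R : R) = 0.
Proof.
have E m : \sum_(0 <= d < m) ((2 * d)%:R - p.-1%:R : R) = m%:R * (m%:R - 1 - p.-1%:R).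
  elim: m => [|m IH]; first by rewrite big_geq // mul0r.
  by rewrite big_nat_recr //= IH natrM -natr1; ring.
case: p E => [|p] E; first by rewrite big_geq.
by rewrite E -natr1 /=; ring.
Qed.

(** The digits of a uniform number below [p ^ J] are independent, so only the
    diagonal contributes to the variance of the digit sum. *)
Lemma digit_sum_variance (R : realFieldType) (p J : nat) : (1 < p)%N ->
  \sum_(0 <= n < p ^ J) ((2 * digit_sum p n)%:R - (p.-1 * J)%:R : R) ^+ 2
   <= (J * p ^ 2 * p ^ J)%:R.
Proof.
move=> p1; elim: J => [|J IH].
  by rewrite expn0 big_nat1 digit_sum0 !muln0 subr0 expr0n.
pose X n : R := (2 * digit_sum p n)%:R - (p.-1 * J)%:R.
pose e d : R := (2 * d)%:R - p.-1%:R.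
have es : \sum_(0 <= d < p) e d = 0 := sum_centered_digits R p.
have -> : \sum_(0 <= n < p ^ J.+1) ((2 * digit_sum p n)%:R - (p.-1 * J.+1)%:R : R) ^+ 2
  = \sum_(0 <= n < p ^ J) \sum_(0 <= d < p) (X n + e d) ^+ 2.
  rewrite expnS big_nat_divn; apply: eq_bigr => n _; apply: eq_big_nat => d /andP[_ dp].
  rewrite -[in (d + p * n)%N](expn1 p) digit_sum_cat ?expn1 // digit_sum_small //.
  by rewrite /X /e mulnDr natrD mulnS natrD; ring.
have -> : \sum_(0 <= n < p ^ J) \sum_(0 <= d < p) (X n + e d) ^+ 2
  = p%:R * (\sum_(0 <= n < p ^ J) X n ^+ 2) + (p ^ J)%:R * \sum_(0 <= d < p) e d ^+ 2.
  rewrite (eq_bigr (fun n => p%:R * X n ^+ 2 + \sum_(0 <= d < p) e d ^+ 2)); last first.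
    move=> n _; rewrite (eq_bigr (fun d => (X n ^+ 2 + (2 * X n) * e d) + e d ^+ 2)); last first.
      by move=> d _; ring.
    rewrite !big_split /= -[X in _ + X + _]mulr_sumr es mulr0 addr0; congr (_ + _).
    by rewrite sumr_const_nat subn0 mulr_natl.
  by rewrite big_split /= -mulr_sumr sumr_const_nat subn0; congr (_ + _); rewrite mulr_natl.
have V : \sum_(0 <= d < p) e d ^+ 2 <= (p * p ^ 2)%:R.
  apply: (@le_trans _ _ (\sum_(0 <= d < p) (p ^ 2)%:R)); last first.
    by rewrite sumr_const_nat subn0 natrM mulr_natl.
  apply: ler_sum_nat => d /andP[_ dp].
  have h1 : (d%:R : R) <= p.-1%:R by rewrite ler_nat; lia.
  have h2 : (p%:R : R) = p.-1%:R + 1 by rewrite natr1 prednK //; lia.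
  have h0 : 0 <= (d%:R : R) by [].
  rewrite /e natrX natrM h2; move: (d%:R) (p.-1%:R) h0 h1 => x y; nra.
have pR : 0 <= (p%:R : R) by [].
have PR : 0 <= ((p ^ J)%:R : R) by [].
apply: le_trans (lerD (ler_wpM2l pR IH) (ler_wpM2l PR V)) _.
rewrite -!natrM -natrD ler_nat (expnS p J); apply: eq_leq; ring.
Qed.

(** Chebyshev's inequality; the digit sum has mean [(p - 1) * J / 2]. *)
Lemma count_atypical_digit_sum (R : realFieldType) (p J : nat) (eps : R) :
  (1 < p)%N -> 0 < eps -> (0 < J)%N ->
  eps ^+ 2 * J%:R * (\sum_(0 <= n < p ^ J)
      (2 * eps * (p.-1 * J)%:R < `|(2 * digit_sum p n)%:R - (p.-1 * J)%:R : R|)%R)%:R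
  <= (p ^ J)%:R.
Proof.
move=> p1 e0 J0; have V := @digit_sum_variance R p J p1.
set X := fun n => (2 * digit_sum p n)%:R - (p.-1 * J)%:R : R in V *.
set t := 2 * eps * (p.-1 * J)%:R.
have t0 : 0 < t by rewrite /t !mulr_gt0 // ltr0n muln_gt0 J0 andbT; lia.
have H : t ^+ 2 * (\sum_(0 <= n < p ^ J) (t < `|X n|)%R)%:R <= (J * p ^ 2 * p ^ J)%:R.
  apply: le_trans V; rewrite natr_sum big_distrr /=; apply: ler_sum => n _.
  case: ltP => h; rewrite ?mulr0 ?sqr_ge0 // mulr1 -[X in _ <= X]real_normK ?num_real //.
  by rewrite lerXn2r ?nnegrE // ltW.
have J0R : 0 < (J%:R : R) by rewrite ltr0n.
have pp : (p%:R : R) ^+ 2 <= 4 * p.-1%:R ^+ 2.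
  have h2 : (p%:R : R) = p.-1%:R + 1 by rewrite natr1 prednK //; lia.
  have : 1 <= (p.-1%:R : R) by rewrite ler1n; lia.
  rewrite h2; move: (p.-1%:R) => y; nra.
have p2 : 0 < (p%:R : R) ^+ 2 by rewrite exprn_gt0 // ltr0n; lia.
move: H; set B := (\sum_(0 <= n < _) _)%:R => H.
have B0 : 0 <= B by [].
rewrite -(@ler_pM2l _ (J%:R * p%:R ^+ 2)) ?(mulr_gt0 J0R p2) //.
move: H; rewrite !natrM natrX => H; apply: le_trans H.
have : eps ^+ 2 * J%:R ^+ 2 * B * (p%:R ^+ 2) <= eps ^+ 2 * J%:R ^+ 2 * B * (4 * p.-1%:R ^+ 2).
  by rewrite ler_wpM2l // !mulr_ge0 // ?sqr_ge0 // ltW.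
rewrite /t natrM; set P := p%:R; set Q := p.-1%:R; set j := J%:R.
set b := B; move=> h.
have -> : j * P ^+ 2 * (eps ^+ 2 * j * b) = eps ^+ 2 * j ^+ 2 * b * P ^+ 2 by ring.
by have -> : (2 * eps * (Q * j)) ^+ 2 * b = eps ^+ 2 * j ^+ 2 * b * (4 * Q ^+ 2) by ring.
Qed.

(** * A Lipschitz minorant of the fractional part *)

Section Tent.
Variables (R : archiRealFieldType) (M : nat).
Hypothesis M1 : (0 < M)%N.

Definition frac_part (y : R) : R := y - (Num.floor y)%:~R.
(** One branch of the tent function: it starts at the integer [n], rises with slope
[1] and falls with slope [M] to vanish at [n + 1]. *)
Definition tent_at (n : int) (y : R) : R :=
  Num.min (y - n%:~R) (M%:R * (n%:~R + 1 - y)).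
(** A Lipschitz periodic function below the fractional part, with nearly the same mean. *)
Definition tent (y : R) : R := tent_at (Num.floor y) y.

Lemma frac_part_ge0 y : 0 <= frac_part y.
Proof. by rewrite subr_ge0 floor_le. Qed.

Lemma frac_part_lt1 y : frac_part y < 1.
Proof. by have := floorD1_gt y; rewrite /frac_part intrD; lra. Qed.

Lemma tent_frac y : tent y = Num.min (frac_part y) (M%:R * (1 - frac_part y)).
Proof. by rewrite /tent /tent_at /frac_part; congr (Num.min _ (_ * _)); ring. Qed.

Lemma tent_le_frac y : tent y <= frac_part y.
Proof. by rewrite tent_frac ge_min lexx. Qed.

Lemma tent_ge0 y : 0 <= tent y.
Proof.
rewrite tent_frac le_min frac_part_ge0 mulr_ge0 //.
by have := frac_part_lt1 y; lra.
Qed.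

Lemma tent_le1 y : tent y <= 1.
Proof. by apply: le_trans (tent_le_frac y) (ltW (frac_part_lt1 y)). Qed.

Lemma tentDz y (n : int) : tent (y + n%:~R) = tent y.
Proof.
rewrite !tent_frac; have -> // : frac_part (y + n%:~R) = frac_part y.
by rewrite /frac_part floorDrz ?intr_int // intrD intrKfloor; ring.
Qed.

Lemma tentDn y (n : nat) : tent (y + n%:R) = tent y.
Proof. by rewrite pmulrn tentDz. Qed.

(** The tent function is the upper envelope of its branches, hence Lipschitz. *)
Lemma tent_max n y : tent_at n y <= tent y.
Proof.
have [lt|lt|->//] := ltgtP n (Num.floor y).
  apply: le_trans (tent_ge0 y); rewrite /tent_at ge_min; apply/orP; right.
  rewrite mulr_ge0_le0 //; have := floor_le y.
  by move: lt; rewrite -lezD1 -(ler_int R) intrD; lra.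
apply: le_trans (tent_ge0 y); rewrite /tent_at ge_min; apply/orP; left.
by have := floorD1_gt y; move: lt; rewrite -lezD1 -(ler_int R) intrD; lra.
Qed.

Lemma tent_lipschitz y y' : `|tent y - tent y'| <= M%:R * `|y - y'|.
Proof.
have M1R : 1 <= M%:R :> R by rewrite ler1n.
suff H a b : tent a - M%:R * `|a - b| <= tent b.
  by rewrite ler_norml; have := H y y'; have := H y' y; rewrite (distrC y'); lra.
apply: le_trans (tent_max (Num.floor a) b); rewrite /tent /tent_at.
set f := (Num.floor a)%:~R; rewrite le_min.
have d0 := ler_norm (a - b); have d1 := ler_norm (b - a); rewrite distrC in d1.
have dge : 0 <= `|a - b| by [].
have m1 : Num.min (a - f) (M%:R * (f + 1 - a)) <= a - f by rewrite ge_min lexx.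
have m2 : Num.min (a - f) (M%:R * (f + 1 - a)) <= M%:R * (f + 1 - a) by rewrite ge_min lexx orbT.
move: (Num.min _ _) (`|a - b|) m1 m2 d0 d1 dge => m d m1 m2 d0 d1 dge.
by apply/andP; split; nra.
Qed.

Definition grid_sum (s : nat) (tau : R) : R :=
  \sum_(0 <= k < s) tent (tau + k%:R / s%:R).

Lemma grid_sum_lip s tau tau' :
  `|grid_sum s tau - grid_sum s tau'| <= s%:R * (M%:R * `|tau - tau'|).
Proof.
rewrite /grid_sum -sumrB; apply: le_trans (ler_norm_sum _ _ _) _.
rewrite -[X in X%:R * _]subn0 mulr_natl -sumr_const_nat; apply: ler_sum => k _.
apply: le_trans (tent_lipschitz _ _) _.
by rewrite opprD addrACA subrr addr0.
Qed.

Lemma grid_sum_split s T tau : (0 < s)%N -> (0 < T)%N ->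
  grid_sum (T * s) tau = \sum_(0 <= i < T) grid_sum s (tau + i%:R / (T * s)%:R).
Proof.
move=> s0 T0; rewrite /grid_sum big_nat_divn exchange_big /=; apply: eq_bigr => i _.
apply: eq_bigr => k _; congr tent; rewrite natrD !natrM.
have : (s%:R : R) != 0 by rewrite pnatr_eq0 -lt0n.
have : (T%:R : R) != 0 by rewrite pnatr_eq0 -lt0n.
by move=> h1 h2; field; apply/andP.
Qed.

(** Regroup the fine grid into [T] translates of the coarse one, each translated by
less than its mesh. *)
Lemma grid_sum_refine s T tau : (0 < s)%N -> (0 < T)%N ->
  `|grid_sum (T * s) tau - T%:R * grid_sum s tau| <= T%:R * M%:R.
Proof.
move=> s0 T0; rewrite grid_sum_split //.
have -> : T%:R * grid_sum s tau = \sum_(0 <= i < T) grid_sum s tau.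
  by rewrite sumr_const_nat subn0 mulr_natl.
rewrite -sumrB; apply: le_trans (ler_norm_sum _ _ _) _.
rewrite -[X in X%:R * _]subn0 mulr_natl -sumr_const_nat; apply: ler_sum_nat => i /andP[_ iT].
apply: le_trans (grid_sum_lip _ _ _) _.
have sR : (0 < s%:R :> R) by rewrite ltr0n.
have TR : (0 < T%:R :> R) by rewrite ltr0n.
have iR : (i%:R <= T%:R :> R) by rewrite ler_nat ltnW.
have -> : tau + i%:R / (T * s)%:R - tau = i%:R / (T%:R * s%:R) by rewrite natrM; ring.
rewrite ger0_norm ?divr_ge0 ?mulr_ge0 //.
have -> : s%:R * (M%:R * (i%:R / (T%:R * s%:R))) = M%:R * (i%:R / T%:R) :> R.
  by field; rewrite !gt_eqF.
by rewrite ler_piMr // ler_pdivrMr // mul1r.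
Qed.

Lemma grid_sum_shift s tau (k : nat) : (0 < s)%N ->
  grid_sum s (tau + k%:R / s%:R) = grid_sum s tau.
Proof.
move=> s0; have sR : (s%:R : R) != 0 by rewrite pnatr_eq0 -lt0n.
have P a : tent (tau + (a %% s)%:R / s%:R) = tent (tau + a%:R / s%:R).
  rewrite {2}(divn_eq a s) natrD natrM mulrDl mulfK // -(tentDn _ (a %/ s)); congr tent; ring.
rewrite -[RHS](@big_modn_perm _ _ _ 1 s k (fun c => tent (tau + c%:R / s%:R))) ?coprime1n //.
by apply: eq_bigr => c _; rewrite P mul1n natrD; congr tent; ring.
Qed.

(** Compare the grids of [s] and of [T] points with their common refinement: all the
grid means of a Lipschitz periodic function agree up to the mesh. *)
Lemma grid_mean s T tau : (0 < s)%N -> (s <= T)%N ->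
  `|grid_sum s tau - s%:R * (grid_sum T 0 / T%:R)| <= 3 * M%:R.
Proof.
move=> s0 sT; have T0 : (0 < T)%N by apply: leq_trans sT.
have sR : (0 < s%:R :> R) by rewrite ltr0n.
have TR : (0 < T%:R :> R) by rewrite ltr0n.
have sTR : (s%:R <= T%:R :> R) by rewrite ler_nat.
have h1 := grid_sum_refine tau s0 T0.
have h2 := grid_sum_refine tau T0 s0; rewrite mulnC in h2.
(* Shift tau by a multiple of 1/T to bring it into [0, 1/T). *)
have h3 : `|grid_sum T tau - grid_sum T 0| <= M%:R.
  have -> : grid_sum T tau = grid_sum T (frac_part (tau * T%:R) / T%:R).
    have [z E] : exists z : int, tau = frac_part (tau * T%:R) / T%:R + z%:~R / T%:R.
      by exists (Num.floor (tau * T%:R)); rewrite /frac_part -mulrDl subrK mulfK // gt_eqF.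
    rewrite {1}E; case: z {E} => n; first by rewrite -pmulrn grid_sum_shift.
    rewrite -(@grid_sum_shift T _ n.+1) //; congr grid_sum.
    by rewrite NegzE intrN -pmulrn; ring.
  apply: le_trans (grid_sum_lip _ _ _) _; rewrite subr0.
  rewrite normrM (ger0_norm (frac_part_ge0 _)) ger0_norm ?invr_ge0 ?(ltW TR) //.
  have -> : T%:R * (M%:R * (frac_part (tau * T%:R) * T%:R^-1)) =
    M%:R * frac_part (tau * T%:R) by field; rewrite gt_eqF.
  by rewrite ler_piMr // ltW // frac_part_lt1.
rewrite -(ler_pM2l TR) -{1}(ger0_norm (ltW TR)) -normrM.
have -> : T%:R * (grid_sum s tau - s%:R * (grid_sum T 0 / T%:R)) =
  - (grid_sum (T * s) tau - T%:R * grid_sum s tau) + (grid_sum (T * s) tau - s%:R * grid_sum T tau)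
   + s%:R * (grid_sum T tau - grid_sum T 0).
  by field; rewrite gt_eqF.
rewrite mulnC in h2.
apply: le_trans (ler_normD _ _) _; apply: le_trans (lerD (ler_normD _ _) (lexx _)) _.
rewrite normrN normrM (ger0_norm (ltW sR)).
have h4 := ler_wpM2l (ltW sR) h3.
have : s%:R * M%:R <= T%:R * M%:R :> R by rewrite ler_wpM2r.
rewrite [(s * T)%N]mulnC in h2 *; lra.
Qed.

(** On [[0, M / (M + 1)]] the tent function is the identity, and this part already
contributes nearly [1 / 2] to the mean. *)
Lemma grid_mean_ge T' : (0 < T')%N ->
  1 / 2 - 1 / M.+1%:R - 1 / (2 * (M.+1 * T')%:R)
   <= grid_sum (M.+1 * T') 0 / (M.+1 * T')%:R.
Proof.
move=> T0; set T := (M.+1 * T')%N; have TT : (0 < T)%N by rewrite muln_gt0.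
have TR : (0 < T%:R :> R) by rewrite ltr0n.
have H : \sum_(0 <= k < M * T') (k%:R / T%:R : R) <= grid_sum T 0.
  rewrite /grid_sum [leRHS](@big_cat_nat _ _ _ (M * T')) ?leq_mul //=. apply: ler_wpDr.
    by apply: sumr_ge0 => k _; exact: tent_ge0.
  apply: ler_sum_nat => k /andP[_ kM]; rewrite add0r.
  have kT : (k%:R / T%:R : R) < 1.
    by rewrite ltr_pdivrMr // mul1r ltr_nat /T mulSn; lia.
  have k0 : 0 <= (k%:R / T%:R : R) by rewrite divr_ge0 // ltW.
  have f0 : Num.floor (k%:R / T%:R : R) = 0 by apply/eqP; rewrite floor_eq /= k0 add0r.
  rewrite tent_frac /frac_part f0 subr0 le_min lexx /=.
  have : (k%:R : R) * M.+1%:R <= M%:R * T%:R by rewrite -!natrM ler_nat /T; nia.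
  rewrite -natr1 => h; rewrite mulrBr mulr1 lerBrDr mulrA -[X in _ + X]mulr1.
  rewrite [M%:R * k%:R / _]mulrC -[k%:R / _]mul1r. 
  rewrite -subr_ge0 (_ : _ - _ = (M%:R * T%:R - k%:R * (M%:R + 1)) / T%:R); last by field; rewrite gt_eqF.
  by rewrite divr_ge0 ?subr_ge0 // ltW.
rewrite ler_pdivlMr //; apply: le_trans H.
have S m : \sum_(0 <= k < m) (k%:R / T%:R : R) = m%:R * (m%:R - 1) / (2 * T%:R).
  elim: m => [|m IH]; first by rewrite big_geq // !mul0r.
  by rewrite big_nat_recr //= IH -natr1; field; rewrite gt_eqF.
rewrite S ler_pdivlMr ?mulr_gt0 // /T !natrM -[M.+1%:R]natr1.
have : 0 < (T'%:R : R) by rewrite ltr0n.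
have : 1 <= (M%:R : R) by rewrite ler1n.
move: (M%:R) (T'%:R) => m t m1 t0.
have m0 : m + 1 != 0 by rewrite gt_eqF //; lra.
have t1 : t != 0 by rewrite gt_eqF.
rewrite -subr_ge0.
have -> : m * t * (m * t - 1) - (1 / 2 - 1 / (m + 1) - 1 / (2 * ((m + 1) * t))) * ((m + 1) * t) * (2 * ((m + 1) * t))
   = t * t + t.
  by field; rewrite t1 m0.
nra.
Qed.

End Tent.

Section Average.
Variables (R : archiRealFieldType) (M T : nat).
Hypothesis M1 : (0 < M)%N.
Hypothesis T1 : (0 < T)%N.

(** The mean over a fine grid, in place of the integral over a period. *)
Definition tent_mean : R := @grid_sum R M T 0 / T%:R.
Definition ctent (y : R) : R := tent M y - tent_mean.

Lemma tent_mean_itv : 0 <= tent_mean <= 1.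
Proof.
have TR : (0 < T%:R :> R) by rewrite ltr0n.
rewrite /tent_mean divr_ge0 ?sumr_ge0 //=; last by move=> k _; exact: tent_ge0.
rewrite ler_pdivrMr // mul1r -[X in _ <= X%:R]subn0 -sumr_const_nat; apply: ler_sum => k _.
exact: tent_le1.
Qed.

Lemma ctent_norm y : `|ctent y| <= 1.
Proof.
have := tent_mean_itv; have := tent_ge0 M y; have := tent_le1 M y.
by rewrite /ctent ler_norml; lra.
Qed.

Lemma ctent_lipschitz y y' : `|ctent y - ctent y'| <= M%:R * `|y - y'|.
Proof. by rewrite /ctent opprD opprK addrACA addNr addr0; exact: tent_lipschitz. Qed.

(** Over a block of [s] consecutive values the points [c * z] are within [1 / s] of a
permutation of the multiples of [1 / s], whose mean is universal. *)
Lemma ctent_average (S N s r Q : nat) (z tau : R) :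
  (0 < S)%N -> (S < s)%N -> (s <= N)%N -> (s <= T)%N -> coprime r s ->
  `|s%:R * z - r%:R| <= N%:R^-1 ->
  `|\sum_(0 <= c < Q) ctent (tau + c%:R * z)| <= Q%:R * (4 * M%:R / S%:R) + N%:R.
Proof.
move=> S0 Ss sN sT cop hz.
have s0 : (0 < s)%N by lia.
have SR : (0 < S%:R :> R) by rewrite ltr0n.
have sR : (0 < s%:R :> R) by rewrite ltr0n.
have NR : (0 < N%:R :> R) by rewrite ltr0n; lia.
have block a : `|\sum_(0 <= c < s) ctent (a + c%:R * z)| <= 4 * M%:R.
  have E : \sum_(0 <= c < s) ctent (a + c%:R * (r%:R / s%:R)) = grid_sum M s a - s%:R * tent_mean.
    rewrite sumrB sumr_const_nat subn0 -[tent_mean *+ s]mulr_natl; congr (_ - _).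
    have P c : tent M (a + (c %% s)%:R / s%:R) = tent M (a + c%:R / s%:R).
      by rewrite {2}(divn_eq c s) natrD natrM mulrDl mulfK ?gt_eqF // -(tentDn _ _ (c %/ s)); congr tent; ring.
    rewrite /grid_sum -(@big_modn_perm _ _ _ r s 0 (fun c => tent M (a + c%:R / s%:R))) //.
    by apply: eq_bigr => c _; rewrite P add0n natrM; congr tent; ring.
  have h1 : `|\sum_(0 <= c < s) ctent (a + c%:R * (r%:R / s%:R))| <= 3 * M%:R.
    by rewrite E; exact: grid_mean.
  have h2 : `|\sum_(0 <= c < s) ctent (a + c%:R * z) - \sum_(0 <= c < s) ctent (a + c%:R * (r%:R / s%:R))| <= M%:R.
    rewrite -sumrB; apply: le_trans (ler_norm_sum _ _ _) _.
    have -> : M%:R = \sum_(0 <= c < s) (M%:R / s%:R : R).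
      by rewrite sumr_const_nat subn0 -[RHS]mulr_natl mulrC divfK // gt_eqF.
    apply: ler_sum_nat => c /andP[_ cs]; apply: le_trans (ctent_lipschitz _ _) _.
    rewrite ler_wpM2l //.
    have -> : a + c%:R * z - (a + c%:R * (r%:R / s%:R)) = (c%:R / s%:R) * (s%:R * z - r%:R).
      by field; rewrite gt_eqF.
    rewrite normrM ger0_norm ?divr_ge0 ?(ltW sR) //.
    have u1 : (c%:R / s%:R : R) <= 1 by rewrite ler_pdivrMr // mul1r ler_nat ltnW.
    have vw : N%:R^-1 <= s%:R^-1 :> R by rewrite lef_pV2 ?posrE // ler_nat.
    have u0 : 0 <= (c%:R / s%:R : R) by rewrite divr_ge0 ?(ltW sR).
    apply: le_trans (_ : 1 * s%:R^-1 <= _); last by rewrite mul1r.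
    by rewrite ler_pM // (le_trans hz).
  have := ler_normD (\sum_(0 <= c < s) ctent (a + c%:R * z) - \sum_(0 <= c < s) ctent (a + c%:R * (r%:R / s%:R)))
    (\sum_(0 <= c < s) ctent (a + c%:R * (r%:R / s%:R))).
  by rewrite subrK; lra.
have HQ : (Q %/ s * s <= Q)%N by rewrite leq_trunc_div.
rewrite (@big_cat_nat _ _ _ (Q %/ s * s)) //=; apply: le_trans (ler_normD _ _) _.
apply: lerD.
  rewrite mulnC big_nat_divn; apply: le_trans (ler_norm_sum _ _ _) _.
  apply: (@le_trans _ _ (\sum_(0 <= e < Q %/ s) 4 * M%:R)).
    apply: ler_sum => e _; rewrite (eq_bigr (fun c => ctent ((tau + (s * e)%:R * z) + c%:R * z))) //.
    by move=> c _; rewrite natrD; congr ctent; ring.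
  rewrite sumr_const_nat subn0 -[leLHS]mulr_natl.
  rewrite -subr_ge0 (_ : _ - _ = (4 * M%:R / S%:R) * (Q%:R - (Q %/ s)%:R * S%:R)); last by field; rewrite gt_eqF.
  rewrite mulr_ge0 ?divr_ge0 ?mulr_ge0 ?(ltW SR) // subr_ge0 -natrM ler_nat.
  by apply: leq_trans HQ; rewrite leq_mul2l ltnW ?orbT.
apply: le_trans (ler_norm_sum _ _ _) _.
apply: (@le_trans _ _ (\sum_(Q %/ s * s <= c < Q) 1)); first by apply: ler_sum => c _; exact: ctent_norm.
rewrite sumr_const_nat ler_nat; have := ltn_pmod Q s0; have := divn_eq Q s; lia.
Qed.

End Average.

(** Dirichlet's approximation theorem, by the pigeonhole principle. *)
Lemma dirichlet (R : archiRealFieldType) (y : R) (n : nat) : 0 <= y -> (0 < n)%N ->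
  exists s r : nat, [/\ (0 < s)%N, (s <= n)%N & `|s%:R * y - r%:R| < n%:R^-1].
Proof.
move=> y0 n0; have nR : (0 < n%:R :> R) by rewrite ltr0n.
pose f (c : nat) : R := @frac_part R (c%:R * y).
have f0 c : 0 <= n%:R * f c by rewrite mulr_ge0 ?frac_part_ge0 // ltW.
have lt c : (Num.truncn (n%:R * f c) < n)%N.
  by rewrite truncn_lt_nat // -[ltRHS]mulr1 ltr_pM2l // frac_part_lt1.
pose h (c : 'I_n.+1) : 'I_n := Ordinal (lt c).
have /injectivePn[c [c' cc' hcc]] : ~~ injectiveb h.
  by apply/injectiveP => /leq_card; rewrite !card_ord ltnn.
have {hcc} E : Num.truncn (n%:R * f c) = Num.truncn (n%:R * f c') by move: hcc => /(congr1 val).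
have cc'n : (c : nat) != c' by [].
move: (ltn_ord c) (ltn_ord c'); move: (c : nat) (c' : nat) E cc'n => {cc' h lt}a b E ab la lb.
wlog lab : a b E ab la lb / (a < b)%N.
  move=> W; case: (ltngtP a b) => [l|l|e]; first exact: (W a b).
    by apply: (W b a); rewrite // eq_sym.
  by rewrite e eqxx in ab.
have fl : Num.floor (a%:R * y) <= Num.floor (b%:R * y).
  by apply: le_floor; rewrite ler_wpM2r // ler_nat ltnW.
exists (b - a)%N, `|Num.floor (b%:R * y) - Num.floor (a%:R * y)|%N; split; [lia|lia|].
have fg : 0 <= Num.floor (b%:R * y) - Num.floor (a%:R * y) by rewrite subr_ge0.
rewrite natr_absz (ger0_norm fg) intrB natrB 1?ltnW //.
have -> : (b%:R - a%:R) * y - ((Num.floor (b%:R * y))%:~R - (Num.floor (a%:R * y))%:~R) = f b - f a.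
  by rewrite /f /frac_part; ring.
rewrite -(ltr_pM2l nR) divff ?gt_eqF // -{1}(ger0_norm (ltW nR)) -normrM mulrBr.
have /andP[h1 h2] := truncn_itv (f0 a); have /andP[h3 h4] := truncn_itv (f0 b).
rewrite ltr_norml; move: h1 h2 h3 h4; rewrite E -!natr1; lra.
Qed.

(** * Steps near rationals of small denominator are rare *)

Lemma ln_nat_gt0 (R : realType) (m : nat) : (1 < m)%N -> 0 < ln (m%:R : R).
Proof. by move=> m1; rewrite ln_gt0 // ltr1n. Qed.

Lemma lnX_nat (R : realType) (m e : nat) : (0 < m)%N ->
  ln ((m ^ e)%:R : R) = e%:R * ln m%:R.
Proof. by move=> m0; rewrite natrX lnXn ?ltr0n // mulr_natl. Qed.

(** As [W] and [p] are multiplicatively independent, Dirichlet's theorem makes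
[r ln W - s ln p] arbitrarily small without being zero; its multiples then hit the
interval from [ln (1 + lo)] to [ln (1 + hi)]. When it is negative, start from a
power of [W] beyond the interval. *)
Lemma ratio_near_one (R : realType) (W p : nat) (lo hi : R) :
  (1 < W)%N -> (1 < p)%N ->
  (forall a g, (0 < g)%N -> (W ^ a)%N <> (p ^ g)%N) -> 0 < lo -> lo < hi ->
  exists a g, (0 < g)%N /\ 1 + lo < (W ^ a)%:R / (p ^ g)%:R < 1 + hi.
Proof.
move=> W1 p1 ind lo0 lohi.
have W0 : (0 < W)%N by lia.
have p0 : (0 < p)%N by lia.
pose w := ln (W%:R : R); pose q := ln (p%:R : R).
have w0 : 0 < w := ln_nat_gt0 R W1; have q0 : 0 < q := ln_nat_gt0 R p1.
pose A := ln (1 + lo); pose B := ln (1 + hi).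
have A0 : 0 < A by rewrite ln_gt0 //; lra.
have AB : A < B by rewrite ltr_ln ?posrE; lra.
suff [a [g [g0 hA hB]]] : exists a g : nat, [/\ (0 < g)%N, A < a%:R * w - g%:R * q & a%:R * w - g%:R * q < B].
  exists a, g; split=> //.
  have Wa : 0 < ((W ^ a)%:R : R) by rewrite ltr0n expn_gt0 W0.
  have pg : 0 < ((p ^ g)%:R : R) by rewrite ltr0n expn_gt0 p0.
  have E : ln ((W ^ a)%:R / (p ^ g)%:R : R) = a%:R * w - g%:R * q.
    by rewrite ln_div ?posrE // !lnX_nat.
  by rewrite -ltr_ln ?posrE ?divr_gt0 //; [rewrite E hA /= -ltr_ln ?posrE ?divr_gt0 ?E //; lra|lra].
pose n := (Num.truncn (w / q) + Num.truncn (w / (B - A))).+1.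
have nR : 0 < (n%:R : R) by rewrite ltr0n.
have nq : w / n%:R < q.
  rewrite ltr_pdivrMr // mulrC -ltr_pdivrMr //; apply: lt_le_trans (truncnS_gt _) _.
  by rewrite ler_nat /n ltnS leq_addr.
have nAB : w / n%:R < B - A.
  rewrite ltr_pdivrMr // mulrC -ltr_pdivrMr ?subr_gt0 //; apply: lt_le_trans (truncnS_gt _) _.
  by rewrite ler_nat /n ltnS leq_addl.
have [s [r [s0 sn hsr]]] := @dirichlet R (q / w) n (ltW (divr_gt0 q0 w0)) isT.
pose d := r%:R * w - s%:R * q.
have hd : `|d| < w / n%:R.
  have -> : d = - (w * (s%:R * (q / w) - r%:R)) by rewrite /d; field; rewrite gt_eqF.
  by rewrite normrN normrM (gtr0_norm w0) ltr_pM2l.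
have d0 : d != 0.
  apply/eqP => d0; apply: (ind r s s0); apply/eqP.
  rewrite -(eqr_nat R) -(inj_in_eq (@ln_inj R)) ?posrE ?ltr0n ?expn_gt0 ?W0 ?p0 //.
  by rewrite !lnX_nat // -subr_eq0 -/w -/q -/d d0.
have [dpos|dneg] := ltrP 0 d.
  have hdd : d < B - A by rewrite gtr0_norm // in hd; lra.
  pose m := (Num.truncn (A / d)).+1; exists (m * r)%N, (m * s)%N; split; first by rewrite muln_gt0.
    rewrite !natrM -!mulrA -mulrBr -/d -ltr_pdivrMr //; exact: truncnS_gt.
  rewrite !natrM -!mulrA -mulrBr -/d /m -natr1 mulrDl mul1r.
  have /andP[h _] := truncn_itv (ltW (divr_gt0 A0 dpos)).
  by move: h; rewrite ler_pdivlMr //; lra.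
have {}dneg : d < 0 by rewrite lt_neqAle d0.
rewrite ltr0_norm // in hd.
have nd : 0 < - d by rewrite oppr_gt0.
pose e := (Num.truncn (B / w)).+1.
have eB : B < e%:R * w by rewrite -ltr_pdivrMr //; exact: truncnS_gt.
pose m := (Num.truncn ((e%:R * w - B) / - d)).+1.
have Q : (e + m * r)%:R * w - (m * s)%:R * q = e%:R * w - m%:R * - d by rewrite natrD !natrM /d; ring.
exists (e + m * r)%N, (m * s)%N; split; first by rewrite muln_gt0.
  have eB' : 0 < e%:R * w - B by rewrite subr_gt0.
  have /andP[h _] := truncn_itv (ltW (divr_gt0 eB' nd)).
  by move: h; rewrite Q ler_pdivlMr // /m -natr1; lra.
rewrite Q; have := truncnS_gt ((e%:R * w - B) / - d); rewrite -/m ltr_pdivrMr //; lra.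
Qed.

(** Two different rationals with denominators at most [S] are [1 / S ^ 2] apart, so
two reals whose distance lies between [4 / N] and [1 / (2 S ^ 2)] cannot both be
close to such a rational. *)
Lemma near_rationals_apart (R : realType) (S N s r s' r' : nat) (z z' : R) :
  (0 < s <= S)%N -> (0 < s' <= S)%N -> 32 * S%:R ^+ 2 <= (N%:R : R) ->
  `|s%:R * z - r%:R| <= N%:R^-1 -> `|s'%:R * z' - r'%:R| <= N%:R^-1 ->
  4 / N%:R <= z' - z -> (z' - z) * S%:R ^+ 2 <= 1 / 2 -> False.
Proof.
move=> /andP[s0 sS] /andP[s0' sS'] NR hs hs'.
set d := z' - z => dN d2.
have S0 : (0 < S)%N by apply: leq_trans sS.
have SR : 1 <= (S%:R : R) by rewrite ler1n.
have sR : 1 <= (s%:R : R) by rewrite ler1n.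
have sR' : 1 <= (s'%:R : R) by rewrite ler1n.
have hR : (s%:R <= S%:R :> R) by rewrite ler_nat.
have hR' : (s'%:R <= S%:R :> R) by rewrite ler_nat.
have S2 : 1 <= (S%:R ^+ 2 : R) by rewrite exprn_ege1.
have N0 : 0 < (N%:R : R) by clear -NR S2; lra.
set y := N%:R^-1 in hs hs' dN.
have y0 : 0 < y by rewrite invr_gt0.
have iN : y * N%:R = 1 by rewrite mulVf // gt_eqF.
pose e := s%:R * z - r%:R; pose e' := s'%:R * z' - r'%:R.
have num : r'%:R * s%:R - r%:R * s'%:R = s%:R * s'%:R * d - s%:R * e' + s'%:R * e :> R.
  by rewrite /d /e /e'; ring.
have /andP[e1 e2] : - y <= e <= y by rewrite -ler_norml.
have /andP[e1' e2'] : - y <= e' <= y by rewrite -ler_norml.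
have Sy : S%:R * y <= 1 / 32.
  have hh : 32 * S%:R <= (N%:R : R).
    by apply: le_trans NR; rewrite ler_pM2l // expr2 ler_peMl // (le_trans _ SR).
  by have := ler_wpM2l (ltW y0) hh; rewrite iN; clear; lra.
have ss : s%:R * s'%:R <= S%:R ^+ 2 :> R by rewrite expr2 ler_pM.
have d0 : 0 <= d by apply: le_trans dN; rewrite mulr_ge0 // ltW.
have sy : s%:R * y <= S%:R * y by rewrite ler_wpM2r // ltW.
have sy' : s'%:R * y <= S%:R * y by rewrite ler_wpM2r // ltW.
have A3 : s%:R * s'%:R * d <= S%:R ^+ 2 * d by rewrite ler_wpM2r.
have B1 : s%:R * e' <= s%:R * y by rewrite ler_wpM2l.
have B2 : s%:R * - y <= s%:R * e' by rewrite ler_wpM2l.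
have B3 : s'%:R * e <= s'%:R * y by rewrite ler_wpM2l.
have B4 : s'%:R * - y <= s'%:R * e by rewrite ler_wpM2l.
have C1 : s%:R * y <= s%:R * s'%:R * y by rewrite ler_wpM2r ?(ltW y0) // ler_peMr.
have C2 : s'%:R * y <= s%:R * s'%:R * y by rewrite ler_wpM2r ?(ltW y0) // ler_peMl.
have C3 : s%:R * s'%:R * (4 * y) <= s%:R * s'%:R * d by rewrite ler_wpM2l // mulr_ge0.
have C4 : 0 < s%:R * s'%:R * y by rewrite !mulr_gt0 // ltr0n.
have h1 : (r * s' < r' * s)%N.
  by rewrite -(ltr_nat R) !natrM -subr_gt0 num; clear -B1 B4 C1 C2 C3 C4; lra.
have h2 : (r' * s < (r * s').+1)%N.
  by rewrite -(ltr_nat R) -natr1 !natrM -ltrBlDl num; clear -B2 B3 sy sy' A3 d2 Sy; lra.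
by clear -h1 h2; lia.
Qed.

Lemma expr_near_one (R : realType) (x : R) t : 0 <= x -> t%:R * x <= 1 / 2 ->
  1 + t%:R * x <= (1 + x) ^+ t <= 1 + 2 * t%:R * x.
Proof.
move=> x0; elim: t => [|t IH] h; first by rewrite expr0 mulr0 !mul0r addr0 lexx.
have tx : 0 <= t%:R * x by rewrite mulr_ge0.
have /IH/andP[h1 h2] : t%:R * x <= 1 / 2 by apply: le_trans h; rewrite ler_wpM2r // ler_nat.
rewrite exprS -natr1 in h *; set P := (1 + x) ^+ t in h1 h2 *.
by apply/andP; split; nra.
Qed.

Section Rare.
Variables (R : realType) (W p : nat).
Hypothesis W4 : (4 <= W)%N.
Hypothesis p1 : (1 < p)%N.
Hypothesis ind : forall a g, (0 < g)%N -> (W ^ a)%N <> (p ^ g)%N.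

(** The first block of base-[q] digits, [W = q ^ K], whose weight reaches [p ^ j]. *)
Definition block_index (j : nat) : nat := up_log W (p ^ j).
(** The step of [b / p ^ j] when the digit of [b] in base [W] at position
[block_index j] is increased by one. *)
Definition block_ratio (j : nat) : R := (W ^ block_index j)%:R / (p ^ j)%:R.
(** The steps for which [b / p ^ j] does not equidistribute modulo [1] when that digit
varies. *)
Definition near_rational (S N j : nat) : Prop :=
  exists s r : nat, [/\ (0 < s)%N, (s <= S)%N & `|s%:R * block_ratio j - r%:R| <= N%:R^-1].

Let W1 : (1 < W)%N. Proof. by apply: leq_trans W4. Qed.
Let WR : 0 < (W%:R : R). Proof. by rewrite ltr0n (leq_trans _ W4). Qed.
Let pj_gt0 j : (0 < p ^ j)%N. Proof. by rewrite expn_gt0; lia. Qed.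
Let pjR j : 0 < ((p ^ j)%:R : R). Proof. by rewrite ltr0n. Qed.

Lemma block_ratio_ge1 j : 1 <= block_ratio j.
Proof. by rewrite /block_ratio ler_pdivlMr // mul1r ler_nat up_logP. Qed.

Lemma block_ratio_lt j : block_ratio j < W%:R.
Proof.
rewrite /block_ratio ltr_pdivrMr // -natrM ltr_nat.
case: j => [|j]; first by rewrite /block_index expn0 up_log1 expn0 muln1.
have h : (1 < p ^ j.+1)%N by rewrite -(expn0 p) ltn_exp2l.
have := up_log_gtn W1 h; rewrite -/(block_index j.+1).
have : (0 < block_index j.+1)%N by rewrite up_log_gt0 W1.
by case: (block_index j.+1) => // k _ /=; rewrite (expnS W) ltn_mul2l; lia.
Qed.

Definition scale (j : nat) : nat := trunc_log 2 (W ^ block_index j %/ p ^ j).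

Lemma scale_bounds j : 2 ^+ scale j <= block_ratio j < 2 ^+ (scale j).+1.
Proof.
have z1 : (0 < W ^ block_index j %/ p ^ j)%N by rewrite divn_gt0 // up_logP.
have /andP[h1 h2] := trunc_log_bounds (isT : 1 < 2)%N z1.
rewrite -!natrX /block_ratio ler_pdivlMr // ltr_pdivrMr // -!natrM ler_nat ltr_nat.
rewrite -leq_divRL // h1 /=.
by rewrite -ltn_divLR.
Qed.

Lemma scale_unique (z : R) i i' : 2 ^+ i <= z -> z < 2 ^+ i'.+1 -> (i <= i')%N.
Proof.
move=> h1 h2; rewrite -ltnS -(@ltr_eXn2l R 2) ?ltr1n //.
exact: le_lt_trans h2.
Qed.

Definition top_scale := trunc_log 2 W.

Lemma scale_le j : (scale j <= top_scale)%N.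
Proof.
have /andP[h _] := scale_bounds j; apply: (scale_unique h).
apply: lt_trans (block_ratio_lt j) _; rewrite -natrX ltr_nat.
by apply: trunc_log_ltn.
Qed.

(** Where the dyadic scale can be after multiplication by a number between [1] and
[2], in the cyclic interval from [1] to [W]: same, next, or back to zero. *)
Definition scale_rel (i s : nat) : bool :=
  [|| s == i, s == i.+1 | (s == 0%N) && (top_scale <= i.+1)%N].

End Rare.

(** By [ratio_near_one] some [W ^ a / p ^ g] is slightly above one. Passing from [j]
to [j + t g] multiplies the ratio by its power [t], up to a factor [W]: this moves
the ratio away from a rational of small denominator, by too little to reach the
next one. *)
Lemma shift_off_rationals (R : realType) (W p S N n i : nat) :
  (4 <= W)%N -> (1 < p)%N -> (forall a g, (0 < g)%N -> (W ^ a)%N <> (p ^ g)%N) ->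
  (0 < S)%N -> (0 < n)%N -> (32 * S ^ 2 * n < N)%N ->
  exists g : nat, (0 < g)%N /\
   (forall j t, scale W p j = i -> (t <= n)%N -> scale_rel W i (scale W p (j + t * g))) /\
   (forall j t, scale W p j = i -> (0 < t <= n)%N -> scale W p (j + t * g) = i ->
      near_rational R W p S N j -> near_rational R W p S N (j + t * g) -> False).
Proof.
move=> W4 p1 ind S0 n0 hN.
have W1 : (1 < W)%N by apply: leq_trans W4.
have WR : 0 < (W%:R : R) by rewrite ltr0n (leq_trans _ W4).
have pjR j : 0 < ((p ^ j)%:R : R) by rewrite ltr0n expn_gt0 ltnW.
have SR : 1 <= (S%:R : R) by rewrite ler1n.
have nR : 1 <= (n%:R : R) by rewrite ler1n.
have NR : 32 * S%:R ^+ 2 * n%:R < (N%:R : R) by rewrite -natrX -!natrM ltr_nat.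
have N0 : 0 < (N%:R : R) by rewrite ltr0n; lia.
have i2 : 1 <= (2 ^+ i : R) by rewrite exprn_ege1 // ler1n.
(* The multiplier is chosen such that one step exceeds 4 / N at scale 2 ^ i, while n steps stay below 1 / (2 S ^ 2). *)
have D0 : 0 < 8 * S%:R ^+ 2 * n%:R * 2 ^+ i :> R by rewrite !mulr_gt0 ?exprn_gt0 //; lra.
have lo0 : 0 < 4 / (N%:R * 2 ^+ i) :> R by rewrite divr_gt0 // mulr_gt0 //; lra.
have lohi : 4 / (N%:R * 2 ^+ i) < 1 / (8 * S%:R ^+ 2 * n%:R * 2 ^+ i) :> R.
  rewrite -subr_gt0 (_ : _ - _ = (N%:R - 32 * S%:R ^+ 2 * n%:R) / (8 * S%:R ^+ 2 * n%:R * 2 ^+ i * N%:R)).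
    by rewrite divr_gt0 ?subr_gt0 // mulr_gt0.
  by field; rewrite !gt_eqF //; lra.
have [a [g [g0 /andP[hlo hhi]]]] := ratio_near_one W1 p1 ind lo0 lohi.
set lam := (W ^ a)%:R / (p ^ g)%:R in hlo hhi.
pose x := lam - 1.
have x0 : 4 / (N%:R * 2 ^+ i) < x by rewrite /x; lra.
have xhi : x < 1 / (8 * S%:R ^+ 2 * n%:R * 2 ^+ i) by rewrite /x; lra.
have xp : 0 < x by apply: lt_trans x0.
have lamE : lam = 1 + x by rewrite /x; ring.
have xhi' : x * (8 * S%:R ^+ 2 * n%:R * 2 ^+ i) < 1 by rewrite -ltr_pdivlMr.
have x0' : 4 < x * (N%:R * 2 ^+ i) by rewrite -ltr_pdivrMr // mulr_gt0 //; lra.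
have S2 : 1 <= (S%:R ^+ 2 : R) by rewrite exprn_ege1.
have nx : n%:R * x * 2 ^+ i * S%:R ^+ 2 <= 1 / 8.
  by move: xhi'; rewrite (_ : x * _ = 8 * (n%:R * x * 2 ^+ i * S%:R ^+ 2)); [lra|ring].
have nxp : 0 <= n%:R * x by rewrite mulr_ge0 // ltW.
have nx1 : n%:R * x * 2 ^+ i <= 1 / 8.
  apply: le_trans nx; rewrite ler_peMr // mulr_ge0 //; lra.
have nx2 : n%:R * x <= 1 / 8 by apply: le_trans nx1; rewrite ler_peMr.
have pow t : (t <= n)%N -> 1 + t%:R * x <= lam ^+ t <= 1 + 2 * t%:R * x.
  move=> tn; rewrite lamE; apply: expr_near_one; first exact: ltW.
  apply: le_trans (_ : n%:R * x <= _); last by lra.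
  by rewrite ler_wpM2r ?(ltW xp) // ler_nat.
have txn t : (t <= n)%N -> t%:R * x <= n%:R * x by move=> tn; rewrite ler_wpM2r ?(ltW xp) // ler_nat.
(* The shifted ratio and its representative in [1, W) differ by a power of W. *)
have key j t : scale W p j = i -> (t <= n)%N ->
   let u := block_ratio R W p j * lam ^+ t in
   [/\ 2 ^+ i <= u, u < 2 ^+ i.+2, u < 2 * W%:R &
     block_ratio R W p (j + t * g) = u \/ W%:R * block_ratio R W p (j + t * g) <= u].
  move=> ji tn u.
  have /andP[b1 b2] := scale_bounds R W4 p1 j; rewrite ji in b1 b2.
  have b3 := block_ratio_lt R W4 p1 j; have b4 := block_ratio_ge1 R W4 p1 j.
  have /andP[q1 q2] := pow t tn; have tx := txn t tn.
  have tx0 : 0 <= t%:R * x by rewrite mulr_ge0 // ltW.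
  have l1 : 1 <= lam ^+ t by clear -q1 tx0; lra.
  have l2 : lam ^+ t <= 2 by clear -q2 tx nx2; lra.
  have u1 : block_ratio R W p j <= u by rewrite /u ler_peMr // (le_trans _ b4).
  have u2 : u <= 2 * block_ratio R W p j by rewrite /u mulrC ler_wpM2r // (le_trans _ b4).
  split.
  - exact: le_trans u1.
  - by apply: le_lt_trans u2 _; rewrite exprS ltr_pM2l.
  - by apply: le_lt_trans u2 _; rewrite ltr_pM2l.
  have uE : u = (W ^ (block_index W p j + a * t))%:R / (p ^ (j + t * g))%:R.
    rewrite /u /block_ratio /lam expr_div_n -!natrX -!expnM (mulnC g) !expnD !natrM.
    by field; rewrite !gt_eqF.
  set v := block_ratio _ _ _ _; set j' := (j + t * g)%N in v uE *.
  have vE : v = (W ^ block_index W p j')%:R / (p ^ j')%:R by [].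
  have v1 : 1 <= v := block_ratio_ge1 R W4 p1 j'; have vW : v < W%:R := block_ratio_lt R W4 p1 j'.
  have [lt|lt|e] := ltngtP (block_index W p j') (block_index W p j + a * t)%N.
  - right; rewrite vE uE mulrA ler_pM2r ?invr_gt0 // -natrM ler_nat -expnS leq_exp2l //.
  - exfalso; have : W%:R * u <= v.
      by rewrite vE uE mulrA ler_pM2r ?invr_gt0 // -natrM ler_nat -expnS leq_exp2l.
    have : W%:R <= W%:R * u by rewrite ler_peMr // (le_trans _ u1).
    by move=> /le_trans h /h /(lt_le_trans vW); rewrite ltxx.
  - by left; rewrite vE uE e.
exists g; split=> //; split.
  move=> j t ji tn; have [u1 u2 u3] := key j t ji tn.
  have /andP[c1 c2] := scale_bounds R W4 p1 (j + t * g).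
  set s := scale _ _ _ in c1 c2 *; rewrite /scale_rel; case=> E.
    rewrite E in c1 c2; have h1 := scale_unique u1 c2; have h2 := scale_unique c1 u2.
    by clear -h1 h2; lia.
  have v1 := block_ratio_ge1 R W4 p1 (j + t * g).
  have v2 : block_ratio R W p (j + t * g) < 2.
    by rewrite -(ltr_pM2l WR); apply: le_lt_trans E _; rewrite [ltRHS]mulrC.
  have s0 : (s <= 0)%N by apply: (scale_unique c1); rewrite expr1.
  have h1 : (top_scale W <= i.+1)%N.
    apply: (@scale_unique R (W%:R)); last first.
      by apply: le_lt_trans u2; apply: le_trans E; rewrite ler_peMr // ltW.
    by rewrite -natrX ler_nat trunc_logP // (leq_trans _ W4).
  by clear -s0 h1; lia.
move=> j t ji /andP[t0 tn] ji' [s [r [s0 sS hs]]] [s' [r' [s0' sS' hs']]].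
have [u1 u2 u3] := key j t ji tn.
have /andP[b1 b2] := scale_bounds R W4 p1 j; rewrite ji in b1 b2.
have /andP[c1 c2] := scale_bounds R W4 p1 (j + t * g); rewrite ji' in c1 c2.
have b4 := block_ratio_ge1 R W4 p1 j.
case=> [E|E]; last first.
  have W4R : (4 : R) <= W%:R by rewrite (ler_nat R 4).
  have : W%:R * 2 ^+ i <= W%:R * block_ratio R W p (j + t * g) by rewrite ler_wpM2l.
  have h1 : 4 * 2 ^+ i <= W%:R * 2 ^+ i :> R by rewrite ler_wpM2r // ltW // (lt_le_trans _ i2).
  move=> h2; move: u2; rewrite !exprS; clear -E h1 h2; lra.
set z := block_ratio R W p j in b1 b2 b4 hs E; set z' := block_ratio _ _ _ _ in hs' E.
have /andP[q1 q2] := pow t tn; have tx := txn t tn.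
have t1 : 1 <= (t%:R : R) by rewrite ler1n.
pose d := z' - z.
have dE : d = z * (lam ^+ t - 1) by rewrite /d E mulrBr mulr1.
have d1 : 4 / N%:R <= d.
  have h : x <= lam ^+ t - 1.
    by have := ler_peMl (ltW xp) t1; clear -q1; lra.
  rewrite ler_pdivrMr // dE; apply: le_trans (ltW x0') _.
  have -> : x * (N%:R * 2 ^+ i) = 2 ^+ i * x * N%:R by ring.
  by rewrite ler_pM2r // ler_pM // ?(ltW xp) // exprn_ge0.
have d2 : d * S%:R ^+ 2 <= 1 / 2.
  have h : lam ^+ t - 1 <= 2 * (n%:R * x) by clear -q2 tx; lra.
  have h0 : 0 <= lam ^+ t - 1 by have := le_trans (ltW xp) (ler_peMl (ltW xp) t1); clear -q1; lra.
  have h' : d <= (2 * 2 ^+ i) * (2 * (n%:R * x)).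
    by rewrite dE ler_pM // ?(le_trans _ b4) // -exprS ltW.
  have S20 : 0 <= (S%:R ^+ 2 : R) by rewrite exprn_ge0.
  have := ler_wpM2r S20 h'.
  rewrite (_ : 2 * 2 ^+ i * _ * _ = 4 * (n%:R * x * 2 ^+ i * S%:R ^+ 2)); last by ring.
  by clear -nx; lra.
apply: (near_rationals_apart (S := S) (N := N) _ _ _ hs hs' d1 d2); rewrite ?s0 ?s0' //.
apply: le_trans (ltW NR); rewrite ler_peMr // mulr_ge0 // exprn_ge0 // ltW.
Qed.

Local Open Scope nat_scope.

Lemma sum_exclusive_le1 n (P : nat -> bool) :
  (forall i j, i < j -> j < n -> P i -> P j -> False) -> \sum_(0 <= i < n) P i <= 1.
Proof.
elim: n => [|n IH] H; first by rewrite big_geq.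
rewrite big_nat_recr //=; case Pn: (P n); last first.
  by rewrite addn0 IH // => i j ij jn; apply: H => //; exact: leq_trans jn _.
rewrite big_nat_cond big1 // => i /andP[/andP[_ ilt] _].
by case Pi: (P i) => //; case: (H i n ilt (ltnSn n) Pi Pn).
Qed.

Lemma sum_shift_le J X m (B : nat -> bool) : J + m <= X ->
  \sum_(0 <= j < J) B j <= \sum_(0 <= j < X) ((m <= j) && B (j - m)).
Proof.
move=> JX; rewrite [leqRHS](@big_cat_nat _ _ _ m) ?(leq_trans (leq_addl _ _) JX) //=.
rewrite [X in _ <= _ + X](@big_cat_nat _ _ _ (J + m)) ?leq_addl //=.
apply: leq_trans (leq_addl _ _); apply: leq_trans (leq_addr _ _).
rewrite (_ : \sum_(m <= j < J + m) _ = \sum_(0 + m <= j < J + m) ((m <= j) && B (j - m))) //.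
rewrite big_addn addnK; apply/eq_leq/eq_bigr => j _.
by rewrite leq_addl addnK.
Qed.

Lemma sum_eq_const_le X m : \sum_(0 <= i < X) (i == m) <= 1.
Proof.
by apply: sum_exclusive_le1 => i j ij _ /eqP im /eqP jm; move: ij; rewrite im jm ltnn.
Qed.

Section Count.
Variables (R : realType) (W p : nat).
Hypothesis W4 : (4 <= W)%N.
Hypothesis p1 : (1 < p)%N.
Hypothesis ind : forall a g, (0 < g)%N -> (W ^ a)%N <> (p ^ g)%N.

(** A scale is related to itself, to its predecessor and to the two highest scales. *)
Lemma scale_rel_sum s : \sum_(0 <= i < (top_scale W).+1) scale_rel W i s <= 4.
Proof.
apply: (@leq_trans (\sum_(0 <= i < (top_scale W).+1)
   ((i == s) + (i == s.-1) + (i == (top_scale W).-1) + (i == top_scale W)))).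
  rewrite big_nat_cond [leqRHS]big_nat_cond; apply: leq_sum => i /andP[/andP[_ ilt] _].
  rewrite /scale_rel; case: (boolP (s == i)) => [/eqP ->|_] /=; first by rewrite eqxx; lia.
  by case: (boolP (s == i.+1)) => [/eqP -> /=|_]; [rewrite eqxx; lia | lia].
rewrite !big_split /=.
have := sum_eq_const_le (top_scale W).+1 s; have := sum_eq_const_le (top_scale W).+1 s.-1.
have := sum_eq_const_le (top_scale W).+1 (top_scale W).-1.
have := sum_eq_const_le (top_scale W).+1 (top_scale W); lia.
Qed.

(** At each dyadic scale an index near a rational excludes the [n] indices
[j + g], .., [j + n g], so the translates of the set of bad indices are disjoint.
The constant [G] accounts for the end of the range. *)
Lemma count_near_rational S N n : 0 < S -> 0 < n -> 32 * S ^ 2 * n < N ->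
  exists G, forall J,
    n.+1 * \sum_(0 <= j < J) `[< near_rational R W p S N j >] <= 4 * (J + G).
Proof.
move=> S0 n0 hN.
have /choice[g gP] : forall i, exists g : nat, 0 < g /\
   (forall j t, scale W p j = i -> t <= n -> scale_rel W i (scale W p (j + t * g))) /\
   (forall j t, scale W p j = i -> 0 < t <= n -> scale W p (j + t * g) = i ->
      near_rational R W p S N j -> near_rational R W p S N (j + t * g) -> False).
  by move=> i; exact: shift_off_rationals.
pose top := top_scale W.
pose G := n * \sum_(0 <= i < top.+1) g i; exists G => J.
pose X := J + G; pose bad j := `[< near_rational R W p S N j >].
pose B i j := bad j && (scale W p j == i).
have H i : i < top.+1 -> n.+1 * \sum_(0 <= j < J) B i j <=
    \sum_(0 <= j < X) scale_rel W i (scale W p j).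
  move=> it; have [g0 [rel sep]] := gP i.
  have gG t : t <= n -> J + t * g i <= X.
    move=> tn; rewrite leq_add2l leq_mul //.
    by rewrite big_mkord (bigD1 (Ordinal it)) //= leq_addr.
  rewrite -[n.+1]subn0 -sum_nat_const_nat.
  apply: (@leq_trans (\sum_(0 <= t < n.+1) \sum_(0 <= j < X) ((t * g i <= j) && B i (j - t * g i)))).
    rewrite big_nat_cond [leqRHS]big_nat_cond; apply: leq_sum => t /andP[/andP[_ tn] _].
    exact/sum_shift_le/gG.
  rewrite exchange_big /=; apply: leq_sum => j _.
  case: (boolP (scale_rel W i (scale W p j))) => [_|nr].
    apply: sum_exclusive_le1 => t t' tt' tn /andP[tj /andP[/asboolP b1 /eqP s1]]
      /andP[tj' /andP[/asboolP b2 /eqP s2]].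
    have e : j - t * g i = (j - t' * g i) + (t' - t) * g i.
      rewrite mulnBl; have : t * g i <= t' * g i by rewrite leq_mul2r ltnW ?orbT.
      lia.
    by apply: (sep (j - t' * g i) (t' - t)); rewrite -?e //; lia.
  rewrite big_nat_cond big1 // => t /andP[/andP[_ tn] _]; apply/eqP; rewrite eqb0.
  apply: contra nr => /andP[tj /andP[_ /eqP s1]].
  by rewrite -(subnK tj); exact: rel.
have E : \sum_(0 <= j < J) bad j = \sum_(0 <= i < top.+1) \sum_(0 <= j < J) B i j.
  rewrite exchange_big /=; apply: eq_bigr => j _.
  rewrite (@big_cat_nat _ _ _ (scale W p j)) //=; last by rewrite ltnW // ltnS; exact: (scale_le R).
  rewrite big_nat_cond big1 => [|i /andP[/andP[_ h] _]]; last by rewrite /B gtn_eqF ?andbF.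
  rewrite add0n big_ltn ?ltnS; last exact: (scale_le R).
  rewrite /B eqxx andbT big_nat_cond big1 ?addn0 // => i /andP[/andP[h _] _].
  by rewrite ltn_eqF ?andbF.
rewrite E big_distrr /=.
apply: (@leq_trans (\sum_(0 <= i < top.+1) \sum_(0 <= j < X) scale_rel W i (scale W p j))).
  rewrite big_nat_cond [leqRHS]big_nat_cond; apply: leq_sum => i /andP[/andP[_ it] _].
  exact: H.
rewrite exchange_big /=; apply: (@leq_trans (\sum_(0 <= j < X) 4)).
  by apply: leq_sum => j _; exact: scale_rel_sum.
by rewrite sum_nat_const_nat subn0 mulnC.
Qed.

End Count.

Local Open Scope ring_scope.

(** * Expectations over independent blocks of digits *)

Section Expectation.
Variables (R : realFieldType) (W : nat).
Implicit Types (F G : nat -> R) (os : seq (seq nat)).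

(** Expectation of [F (y_0 + W y_1 + W ^ 2 y_2 + ..)] for independent [y_k], uniform
in the successive lists. Lists, rather than intervals, allow blocks of digits of
which only some are free. *)
Fixpoint expect os F : R :=
  if os is o :: os' then
    (size o)%:R^-1 * \sum_(y <- o) expect os' (fun z => F (y + W * z)%N)
  else F 0%N.

Fixpoint outcomes os : seq nat :=
  if os is o :: os' then [seq (y + W * z)%N | y <- o, z <- outcomes os'] else [:: 0%N].

Definition nonempty os := all (fun o : seq nat => (0 < size o)%N) os.

Lemma eq_expect os F G : (forall z, F z = G z) -> expect os F = expect os G.
Proof.
elim: os F G => [|o os IH] F G FG //=; congr (_ * _).
by apply: eq_bigr => y _; apply: IH.
Qed.

Lemma expectZ os a F : expect os (fun z => a * F z) = a * expect os F.
Proof.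
elim: os F => [|o os IH] F //=.
by under eq_bigr do rewrite IH; rewrite -mulr_sumr mulrCA.
Qed.

Lemma expect_sum (I : Type) (s : seq I) os (F : I -> nat -> R) :
  expect os (fun z => \sum_(i <- s) F i z) = \sum_(i <- s) expect os (F i).
Proof.
elim: os F => [|o os IH] F //=.
under eq_bigr do rewrite IH.
by rewrite exchange_big /= mulr_sumr.
Qed.

Lemma ler_expect os F G : (forall z, F z <= G z) -> expect os F <= expect os G.
Proof.
elim: os F G => [|o os IH] F G FG //=; rewrite ler_wpM2l ?invr_ge0 //.
by apply: ler_sum => y _; apply: IH.
Qed.

Lemma expect_const os a : nonempty os -> expect os (fun=> a) = a.
Proof.
elim: os => [|o os IH] //= /andP[ o0 /IH ->].
rewrite big_const_seq count_predT iter_addr_0 -[a *+ _]mulr_natl mulKf // pnatr_eq0 -lt0n //.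
Qed.

Lemma expect_norm os F a : nonempty os -> (forall z, `|F z| <= a) -> `|expect os F| <= a.
Proof.
move=> ne Fa; rewrite ler_norml.
have h z : - a <= F z <= a by rewrite -ler_norml.
rewrite -{1}(expect_const (- a) ne) -{2}(expect_const a ne) !ler_expect // => z;
  by have /andP[] := h z.
Qed.

Lemma expect_cat os os' F :
  expect (os ++ os') F = expect os (fun x => expect os' (fun z => F (x + W ^ size os * z)%N)).
Proof.
elim: os F => [|o os IH] F /=; first by apply: eq_expect => z; rewrite expn0 mul1n.
congr (_ * _); apply: eq_bigr => y _; rewrite IH; apply: eq_expect => x.
by apply: eq_expect => z; congr F; rewrite expnS mulnDr mulnA addnA.
Qed.

Lemma expect_exists os F a : nonempty os -> expect os F <= a ->
  exists2 r, r \in outcomes os & F r <= a.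
Proof.
elim: os F => [|o os IH] F /=; first by exists 0%N; rewrite ?mem_head.
move=> /andP[ o0 ne] h.
have [y yo hy] : exists2 y, y \in o & expect os (fun z => F (y + W * z)%N) <= a.
  apply/hasP; apply/negPn/negP => /hasPn H.
  move: h; apply/negP; rewrite -ltNge ltr_pdivlMl ?ltr0n // mulr_natl.
  suff : \sum_(y <- o) a < \sum_(y <- o) expect os (fun z => F (y + W * z)%N).
    by rewrite big_const_seq count_predT iter_addr_0.
  rewrite big_seq [ltRHS]big_seq; apply: ltr_sum => [|y yo]; last by rewrite ltNge H.
  by case: o o0 {H} => // y o _; rewrite /= mem_head.
have [z zo hz] := IH _ ne hy.
by exists (y + W * z)%N => //; apply/allpairsP; exists (y, z).
Qed.

(** Full runs of length [Q]: the lowest digits of the block are free. *)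
Definition fibered (Q : nat) (o : seq nat) : Prop :=
  exists es : seq nat, size o = (size es * Q)%N /\
    forall F, \sum_(y <- o) F y = \sum_(e <- es) \sum_(0 <= c < Q) F (c + Q * e)%N.

(** Condition on everything but the free digits of block [k]. *)
Lemma expect_fiber Q os k F B : nonempty os -> (k < size os)%N ->
  fibered Q (nth [::] os k) ->
  (forall tau, `|\sum_(0 <= c < Q) F (tau + W ^ k * c)%N| <= B * Q%:R) ->
  `|expect os F| <= B.
Proof.
move=> ne ks [es [so fo]] HB.
have := ne; rewrite -{1 2}(cat_take_drop k os) (drop_nth [::]) // /nonempty all_cat /=.
move=> /and3P[ne1 o0 ne2]; rewrite expect_cat /=.
set o := nth _ _ _ in so fo o0 *; set os2 := drop _ _ in ne2 *.
apply: expect_norm => // x; rewrite size_takel 1?ltnW //.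
rewrite normrM ger0_norm ?invr_ge0 // ler_pdivrMl ?ltr0n //.
rewrite -expect_sum; apply: expect_norm => // z.
rewrite (fo (fun y => F (x + W ^ k * (y + W * z))%N)).
apply: le_trans (ler_norm_sum _ _ _) _.
apply: (@le_trans _ _ (\sum_(e <- es) B * Q%:R)).
  apply: ler_sum => e _.
  rewrite (eq_bigr (fun c => F ((x + W ^ k * (Q * e + W * z)) + W ^ k * c)%N)) //.
  by move=> c _; congr F; ring.
rewrite big_const_seq count_predT iter_addr_0 -[_ *+ size es]mulr_natl so natrM.
by rewrite le_eqVlt; apply/orP; left; apply/eqP; ring.
Qed.

(** Pairs of indices in the same or in adjacent blocks are few and count for one.
When the block of [j'] is higher by two or more, [f j'] hardly depends on the free
digits of the block of [j], over which [f j] averages out. *)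
Lemma second_moment Q os m (js : seq nat) (f : nat -> nat -> R) (kk : nat -> nat) (d1 d2 C : R) :
  nonempty os -> (m <= size os)%N -> (forall k, (k < m)%N -> fibered Q (nth [::] os k)) ->
  (forall j b, `|f j b| <= 1) -> (forall j, j \in js -> (kk j < m)%N) ->
  (forall j tau, j \in js -> `|\sum_(0 <= c < Q) f j (tau + W ^ kk j * c)%N| <= d1 * Q%:R) ->
  (forall j j' tau c, (kk j + 2 <= kk j')%N -> (c < Q)%N ->
      `|f j' (tau + W ^ kk j * c)%N - f j' tau| <= d2) ->
  0 <= d1 -> 0 <= d2 ->
  (forall j, j \in js -> (\sum_(j' <- js) ((kk j' <= (kk j).+1) && (kk j <= (kk j').+1)))%:R <= C) ->
  expect os (fun b => (\sum_(j <- js) f j b) ^+ 2)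
    <= C * (size js)%:R + (d1 + d2) * (size js)%:R ^+ 2.
Proof.
move=> ne ms fib f1 km c1 c2 d10 d20 HC.
have far j j' : j \in js -> (kk j + 2 <= kk j')%N -> `|expect os (fun b => f j b * f j' b)| <= d1 + d2.
  move=> jjs kj; have k_lt := km j jjs.
  apply: (@expect_fiber Q os (kk j)) => //; [exact: leq_trans ms|exact: fib|].
  move=> tau; rewrite (eq_bigr (fun c => f j' tau * f j (tau + W ^ kk j * c)%N +
    f j (tau + W ^ kk j * c)%N * (f j' (tau + W ^ kk j * c)%N - f j' tau))); last by move=> c _; ring.
  rewrite big_split /= -mulr_sumr mulrDl; apply: le_trans (ler_normD _ _) (lerD _ _).
    rewrite normrM -[leRHS]mul1r ler_pM //; exact: c1.
  apply: le_trans (ler_norm_sum _ _ _) _.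
  rewrite mulr_natr -[Q in leRHS]subn0 -sumr_const_nat; apply: ler_sum_nat => c /andP[_ cQ].
  rewrite normrM -[leRHS]mul1r ler_pM //; exact: c2.
rewrite (@eq_expect os _ (fun b => \sum_(j <- js) \sum_(j' <- js) f j b * f j' b)); last first.
  by move=> b; rewrite expr2 mulr_suml; apply: eq_bigr => j _; rewrite mulr_sumr.
rewrite expect_sum.
under eq_bigr do rewrite expect_sum.
apply: (@le_trans _ _ (\sum_(j <- js) (C + (d1 + d2) * (size js)%:R))); last first.
  rewrite big_const_seq count_predT iter_addr_0 -mulr_natl.
  by rewrite le_eqVlt; apply/orP; left; apply/eqP; ring.
rewrite big_seq [leRHS]big_seq; apply: ler_sum => j jjs.
apply: (@le_trans _ _ (\sum_(j' <- js) (((kk j' <= (kk j).+1) && (kk j <= (kk j').+1))%N%:R + (d1 + d2)))).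
  rewrite big_seq [leRHS]big_seq; apply: ler_sum => j' jjs'.
  have d0 : 0 <= d1 + d2 by rewrite addr_ge0.
  case: (boolP (_ && _)) => [_|].
    apply: ler_wpDr => //; apply: le_trans (ler_norm _) _; apply: expect_norm => // b.
    by rewrite normrM mulr_ile1.
  rewrite negb_and -!ltnNge add0r => /orP[h|h]; apply: le_trans (ler_norm _) _.
    by apply: far => //; rewrite addn2.
  rewrite (@eq_expect os _ (fun b => f j' b * f j b)) => [|b]; last by rewrite mulrC.
  by apply: far => //; rewrite addn2.
rewrite big_split /= big_const_seq count_predT iter_addr_0 -[(d1 + d2) *+ _]mulr_natr.
by rewrite lerD2r -natr_sum; exact: HC.
Qed.

End Expectation.

Lemma frac_part_nat (R : archiRealFieldType) (b P : nat) : (0 < P)%N ->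
  frac_part (b%:R / P%:R : R) = (b %% P)%:R / P%:R.
Proof.
move=> P0; have PR : 0 < (P%:R : R) by rewrite ltr0n.
have E : (b%:R / P%:R : R) = (b %/ P)%:R + (b %% P)%:R / P%:R.
  by rewrite {1}(divn_eq b P) natrD natrM mulrDl mulfK ?gt_eqF.
have F : Num.floor (b%:R / P%:R : R) = (b %/ P)%N :> int.
  apply: floor_def; rewrite intrD E -!pmulrn.
  rewrite lerDl divr_ge0 ?(ltW PR) //= ltrD2l ltr_pdivrMr // mul1r ltr_nat ltn_mod //.
by rewrite /frac_part F E -pmulrn addrAC subrr add0r.
Qed.

(** Telescoping: the digit of [b] at position [j] is [p * x_(j+1) - x_j], where [x_j] is
the fractional part of [b / p ^ j]. *)
Lemma digit_sum_frac (R : archiRealFieldType) (p b J : nat) : (1 < p)%N ->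
  p.-1%:R * \sum_(0 <= j < J) frac_part (b%:R / (p ^ j)%:R : R) <= (digit_sum p b)%:R.
Proof.
move=> p1; have p0 : (0 < p)%N by apply: ltnW.
have pj j : (0 < p ^ j)%N by rewrite expn_gt0 p0.
have pR j : ((p ^ j)%:R : R) != 0 by rewrite pnatr_eq0 -lt0n.
have H j : p.-1%:R * \sum_(0 <= i < j.+1) frac_part (b%:R / (p ^ i)%:R : R)
   + (b %% p ^ j)%:R / (p ^ j)%:R = (digit_sum p (b %% p ^ j))%:R.
  elim: j => [|j IH].
    by rewrite big_nat1 frac_part_nat // expn0 modn1 mul0r mulr0 digit_sum0 addr0.
  rewrite big_nat_recr //= mulrDr frac_part_nat //.
  have Ed : digit_sum p (b %% p ^ j.+1) = (digit_sum p (b %% p ^ j) + (b %/ p ^ j) %% p)%N.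
    by rewrite modn_expS addnC mulnC digit_sum_cat ?ltn_mod // [X in (_ + X)%N]digit_sum_small // ltn_mod.
  rewrite Ed natrD -IH -!addrA; congr (_ + _).
  have -> : p.-1%:R * ((b %% p ^ j.+1)%:R / (p ^ j.+1)%:R) + (b %% p ^ j.+1)%:R / (p ^ j.+1)%:R
     = (b %% p ^ j.+1)%:R / (p ^ j)%:R :> R.
    rewrite -{2}[_ / _]mul1r -mulrDl natr1 prednK // expnS natrM.
    by field; rewrite ?natrX ?expf_neq0 ?pnatr_eq0 -?lt0n ?p0 ?pj //.
  by rewrite modn_expS natrD natrM mulrDl mulfK // addrC.
case: J => [|J]; first by rewrite big_geq // mulr0.
apply: (@le_trans _ _ (digit_sum p (b %% p ^ J))%:R).
  by rewrite -H lerDl divr_ge0.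
rewrite ler_nat {2}(divn_eq b (p ^ J)) addnC mulnC digit_sum_cat ?ltn_mod //.
exact: leq_addr.
Qed.


Lemma fibered_iota (R : realFieldType) (Q E : nat) : fibered R Q (iota 0 (Q * E)).
Proof.
exists (iota 0 E); rewrite !size_iota; split=> [|F]; first by rewrite mulnC.
have := @big_nat_divn R 0 +%R Q E F; rewrite /index_iota !subn0 => ->.
by [].
Qed.

Lemma fibered_run (R : realFieldType) (Q e : nat) :
  fibered R Q [seq (c + Q * e)%N | c <- iota 0 Q].
Proof.
exists [:: e]; rewrite size_map size_iota mul1n; split=> // F.
by rewrite big_map big_seq1 /index_iota subn0.
Qed.

Lemma sum_window (P : pred nat) (w J : nat) :
  (forall i j, P i -> P j -> (i <= j)%N -> (j < i + w)%N) -> (\sum_(0 <= j < J) P j <= w)%N.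
Proof.
move=> H; have [[i Pi]|N] := pselect (exists i, P i); last first.
  by rewrite big1 // => j _; case Pj: (P j) => //; case: N; exists j.
have [i0 Pi0 mini] := ex_minnP (ex_intro P i Pi).
apply: (@leq_trans (\sum_(0 <= j < J) ((i0 <= j) && (j < i0 + w)))%N).
  apply: leq_sum => j _; case Pj: (P j) => //; rewrite mini //= H // mini //.
apply: (@leq_trans (\sum_(0 <= j < J + (i0 + w)) ((i0 <= j) && (j < i0 + w)))%N).
  by rewrite [leqRHS](@big_cat_nat _ _ _ J) ?leq_addr //=.
rewrite (@big_cat_nat _ _ _ i0) //=; last by lia.
rewrite big_nat_cond big1 ?add0n; last first.
  by move=> j /andP[/andP[_ h] _]; rewrite leqNgt h.
rewrite (@big_cat_nat _ _ _ (i0 + w)) //=; [|by lia|by lia].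
rewrite [X in (_ + X)%N]big_nat_cond [X in (_ + X)%N]big1 ?addn0; last first.
  by move=> j /andP[/andP[h _] _]; rewrite [(j < _)%N]ltnNge h andbF.
apply: (@leq_trans (\sum_(i0 <= j < i0 + w) 1)%N); first by apply: leq_sum => j _; rewrite leq_b1.
by rewrite sum_nat_const_nat addKn muln1.
Qed.

(** Indices in the same block differ by less than [log_p W], hence by less than [W]. *)
Lemma count_block_index (W p k J : nat) : (1 < W)%N -> (1 < p)%N ->
  (\sum_(0 <= j < J) (block_index W p j == k) <= W)%N.
Proof.
move=> W1 p1; apply: sum_window => i j /eqP ik /eqP jk ij.
rewrite -ltn_subLR //; apply: leq_trans (ltn_expl _ p1) _.
have pi : (0 < p ^ i)%N by rewrite expn_gt0 ltnW.
rewrite -(leq_pmul2r pi) -expnD subnK //.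
apply: leq_trans (up_logP (p ^ j) W1) _; rewrite -/(block_index W p j) jk -ik.
case: i {ij pi} ik => [|i] ik.
  by rewrite /block_index expn0 up_log1 expn0; lia.
have h : (1 < p ^ i.+1)%N by rewrite -(expn0 p) ltn_exp2l.
have := up_log_gtn W1 h; rewrite -/(block_index W p i.+1).
have : (0 < block_index W p i.+1)%N by rewrite up_log_gt0 W1.
by case: (block_index W p i.+1) => // e _ /= he; rewrite (expnS W) leq_mul2l ltnW ?orbT.
Qed.

(** * Typical digit sums of numbers with few free digits *)

Lemma exists_nat_ge (R : realType) (x : R) : exists n : nat, (0 < n)%N /\ x <= n%:R.
Proof. by exists (Num.truncn x).+1; split=> //; apply/ltW/truncnS_gt. Qed.

(** Dirichlet's approximation in lowest terms; its denominator exceeds [S] by hypothesis. *)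
Lemma reduced_approximation (R : realType) (z : R) (S N : nat) : 0 <= z -> (0 < N)%N ->
  ~ (exists s r : nat, [/\ (0 < s)%N, (s <= S)%N & `|s%:R * z - r%:R| <= N%:R^-1]) ->
  exists s r : nat, [/\ (S < s)%N, (s <= N)%N, coprime r s & `|s%:R * z - r%:R| <= N%:R^-1].
Proof.
move=> z0 N0 bad; have [s [r [s0 sN h]]] := dirichlet z0 N0.
pose d := gcdn r s; have d0 : (0 < d)%N by rewrite gcdn_gt0 s0 orbT.
have rE : r = (r %/ d * d)%N by rewrite divnK // dvdn_gcdl.
have sE : s = (s %/ d * d)%N by rewrite divnK // dvdn_gcdr.
set s' := (s %/ d)%N in sE; set r' := (r %/ d)%N in rE.
have s'0 : (0 < s')%N by rewrite lt0n; apply/eqP => e; move: s0; rewrite sE e mul0n.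
have h' : `|s'%:R * z - r'%:R| <= N%:R^-1.
  have sR : (s%:R : R) = s'%:R * d%:R by rewrite -natrM -sE.
  have rR : (r%:R : R) = r'%:R * d%:R by rewrite -natrM -rE.
  apply: ltW; apply: le_lt_trans h; rewrite sR rR.
  have -> : s'%:R * d%:R * z - r'%:R * d%:R = d%:R * (s'%:R * z - r'%:R) by ring.
  by rewrite normrM normr_nat ler_peMl // ler1n.
exists s', r'; split=> //.
- by rewrite ltnNge; apply/negP => le; apply: bad; exists s', r'.
- by apply: leq_trans sN; rewrite /s' leq_div.
- rewrite /coprime -(eqn_pmul2r d0) muln_gcdl -rE -sE mul1n //.
Qed.

(** The digit sum in base [p] is bounded below by a sum of tent functions of
[b / p ^ j], by [digit_sum_frac]. For all but few [j] the step of this number under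
the free digits of its block is not near a rational of small denominator, so that
its tent function is centred by [ctent_average]; then [second_moment] and
Chebyshev's inequality apply. *)
Lemma typical_digit_sum (R : realType) (q : nat) (eps : R) : (1 < q)%N -> 0 < eps -> eps <= 1 ->
  exists K L : nat, [/\ (2 <= K)%N, (L <= K)%N, L%:R <= eps * K%:R &
   forall p : nat, (1 < p)%N ->
   (forall a g, (0 < g)%N -> ((q ^ K) ^ a)%N <> (p ^ g)%N) ->
   exists m0, forall m os, (m0 <= m)%N -> (m <= size os)%N -> nonempty os ->
     (forall k, (k < m)%N -> fibered R (q ^ L) (nth [::] os k)) ->
     expect (q ^ K) os (fun b =>
       (((digit_sum p b)%:R < (1 / 2 - eps) * (p.-1 * trunc_log p ((q ^ K) ^ m.-1))%:R :> R)%R : nat)%:R)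
       <= eps].
Proof.
move=> q1 e0 e1; pose a := eps / 8.
have a0 : 0 < a by rewrite divr_gt0.
pose dl := a ^+ 2 * eps / 6.
have dl0 : 0 < dl by rewrite divr_gt0 // mulr_gt0 // exprn_gt0.
(* The slope M makes the mean of the tent function close to 1 / 2, S the averages small, n the near-rational
   indices rare; L free digits make the block average effective, and K1 further digits separate the blocks. *)
have [M [M0 hM]] := exists_nat_ge (a^-1).
have [S [S0 hS]] := exists_nat_ge (4 * M%:R / dl).
have [n [n0 hn]] := exists_nat_ge (8 / a).
pose N := (32 * S ^ 2 * n).+1; pose T := (M.+1 * N)%N.
have N0 : (0 < N)%N by []. have T0 : (0 < T)%N by [].
have [L [L0 hL]] := exists_nat_ge (N%:R / dl).
have [K1 [K10 hK1]] := exists_nat_ge (M%:R / dl).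
have [K2 [K20 hK2]] := exists_nat_ge (L%:R / eps).
pose K := (L + K1 + K2)%N; exists K, L; split.
- by clear -L0 K10 K20; rewrite /K; lia.
- by clear; rewrite /K; lia.
- rewrite -ler_pdivrMl // mulrC; apply: le_trans hK2 _; rewrite ler_nat /K; clear; lia.
move=> p p1 ind; set W := (q ^ K)%N in ind *; pose Q := (q ^ L)%N.
have q0 : (0 < q)%N by apply: ltnW.
have W4 : (4 <= W)%N.
  apply: (@leq_trans (q ^ 2)%N); first by rewrite (@leq_exp2r 2 q 2).
  by rewrite leq_exp2l //; clear -L0 K10 K20; rewrite /K; lia.
have W1 : (1 < W)%N by apply: leq_trans W4.
have QR : 0 < (Q%:R : R) by rewrite ltr0n expn_gt0 q0.
have WR : 0 < (W%:R : R) by rewrite ltr0n ltnW.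
have natpow x : (x%:R : R) <= (q ^ x)%:R by rewrite ler_nat ltnW // ltn_expl.
have NQ : N%:R <= dl * Q%:R.
  by rewrite -ler_pdivrMl // mulrC; apply: le_trans hL (natpow _).
have MQW : M%:R * Q%:R <= dl * W%:R.
  have -> : (W%:R : R) = Q%:R * (q ^ K1)%:R * (q ^ K2)%:R by rewrite /W /K !expnD !natrM.
  have h1 : M%:R <= dl * (q ^ K1)%:R by rewrite -ler_pdivrMl // mulrC; apply: le_trans hK1 (natpow _).
  have h2 : 1 <= ((q ^ K2)%:R : R) by rewrite ler1n expn_gt0 q0.
  apply: le_trans (ler_wpM2r (ltW QR) h1) _.
  have -> : dl * (Q%:R * (q ^ K1)%:R * (q ^ K2)%:R) = dl * (q ^ K1)%:R * Q%:R * (q ^ K2)%:R by ring.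
  by apply: ler_peMr => //; apply: mulr_ge0 => //; apply: mulr_ge0 => //; exact: ltW.
have [G hG] := count_near_rational R W4 p1 ind S0 n0 (ltnSn _).
have [J1 [J10 hJ1]] := exists_nat_ge (6 * W%:R / (a ^+ 2 * eps)).
pose J2 := (G + J1)%N; exists (p ^ J2).+1 => m os m0m ms ne fib.
set J := trunc_log p (W ^ m.-1).
have p0 : (0 < p)%N by apply: ltnW.
have pR j : 0 < ((p ^ j)%:R : R) by rewrite ltr0n expn_gt0 p0.
have mpos : (0 < m)%N by apply: leq_trans m0m.
have Wm : (p ^ J2 <= W ^ m.-1)%N.
  by apply: leq_trans (ltnW (ltn_expl _ W1)); rewrite -ltnS prednK.
have J2J : (J2 <= J)%N by apply: trunc_log_max.
have JW : (p ^ J <= W ^ m.-1)%N by apply: trunc_logP => //; rewrite expn_gt0 ltnW.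
pose bad j := `[< near_rational R W p S N j >].
pose js := [seq j <- iota 0 J | ~~ bad j].
pose f j (b : nat) : R := ctent M T (b%:R / (p ^ j)%:R).
pose mu := tent_mean R M T.
have JR : 0 < (J%:R : R).
  by rewrite ltr0n; apply: leq_trans J2J; clear -J10; rewrite /J2; lia.
have szle : ((size js)%:R : R) <= J%:R by rewrite ler_nat size_filter (leq_trans (count_size _ _)) ?size_iota.
have szge : (1 - a) * J%:R <= (size js)%:R.
  have hc : (count bad (iota 0 J) + size js = J)%N by rewrite size_filter count_predC size_iota.
  have hb : (n.+1 * count bad (iota 0 J) <= 4 * (J + G))%N.
    have -> : count bad (iota 0 J) = (\sum_(0 <= j < J) bad j)%N.
      by rewrite -sum1_count big_mkcond /index_iota subn0.
    exact: hG.
  have hb' : (n.+1 * count bad (iota 0 J) <= 8 * J)%N.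
    apply: leq_trans hb _; have : (G <= J)%N by apply: leq_trans J2J; rewrite /J2 leq_addr.
    clear; lia.
  have hbR : n%:R * (count bad (iota 0 J))%:R <= 8 * J%:R :> R.
    rewrite -!natrM ler_nat; apply: leq_trans hb'; rewrite leq_mul2r leqnSn orbT //.
  have h8 : 8 <= n%:R * a by rewrite -ler_pdivrMr.
  have cR : ((count bad (iota 0 J))%:R : R) <= a * J%:R.
    have nR : 0 < (n%:R : R) by rewrite ltr0n.
    rewrite -(ler_pM2l nR); apply: le_trans hbR _; rewrite mulrA.
    by rewrite ler_wpM2r // ltW.
  have : (count bad (iota 0 J))%:R + (size js)%:R = J%:R :> R by rewrite -natrD hc.
  by clear -cR; lra.
have mu_ge : 1 / 2 - 2 * a <= mu.
  have h := @grid_mean_ge R M M0 N N0; rewrite -/T in h; apply: le_trans h.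
  have MR : 0 < (M%:R : R) by rewrite ltr0n.
  have h1 : M.+1%:R^-1 <= a.
    rewrite -[a]invrK lef_pV2 ?posrE ?invr_gt0 ?ltr0n //; apply: le_trans hM _.
    by rewrite ler_nat.
  have h2 : (2 * T%:R)^-1 <= (M.+1%:R)^-1 :> R.
    rewrite lef_pV2 ?posrE ?mulr_gt0 ?ltr0n // -natrM ler_nat /T mulnCA leq_pmulr //.
  rewrite !div1r; move: h1 h2; move: (M.+1%:R^-1) ((2 * T%:R)^-1) => x y; clear; lra.
have kkm j : j \in js -> (block_index W p j < m)%N.
  rewrite mem_filter mem_iota add0n => /andP[_ /andP[_ jJ]].
  rewrite -(prednK mpos) ltnS up_log_min //; apply: leq_trans JW.
  by rewrite leq_exp2l // ltnW.
have good j : j \in js -> exists s r : nat, [/\ (S < s)%N, (s <= N)%N, coprime r s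
    & `|s%:R * block_ratio R W p j - r%:R| <= N%:R^-1].
  rewrite mem_filter => /andP[/asboolPn nb _]; apply: reduced_approximation => //.
  exact: le_trans (block_ratio_ge1 R W4 p1 j).
have SM := @second_moment R W (Q) os m js f (block_index W p) (2 * dl) dl (3 * W%:R) ne ms fib.
have {SM} SM : expect W os (fun b => (\sum_(j <- js) f j b) ^+ 2)
    <= 3 * W%:R * (size js)%:R + (2 * dl + dl) * (size js)%:R ^+ 2.
  apply: SM => //.
  - by move=> j b; exact: ctent_norm.
  - move=> j tau jjs; have [s [r [Ss sN cop hz]]] := good j jjs.
    rewrite (eq_bigr (fun c : nat => ctent M T (tau%:R / (p ^ j)%:R + c%:R * block_ratio R W p j))).
      apply: le_trans (@ctent_average R M T M0 T0 S N s r Q _ _ S0 Ss sN _ cop hz) _.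
        by apply: leq_trans sN _; rewrite /T leq_pmull.
      have SR : 0 < (S%:R : R) by rewrite ltr0n.
      have h : 4 * M%:R / S%:R <= dl by rewrite ler_pdivrMr // [leRHS]mulrC -ler_pdivrMr.
      have := ler_wpM2l (ltW QR) h; move: NQ; clear; lra.
    move=> c _; congr ctent; rewrite /block_ratio natrD natrM.
    by field; rewrite gt_eqF.
  - move=> j j' tau c hk cQ; apply: le_trans (@ctent_lipschitz R M T M0 _ _) _.
    have h1 : (W ^ (block_index W p j).+1 < p ^ j')%N.
      have kp : (0 < block_index W p j')%N by apply: leq_trans hk; rewrite addn2.
      have p1' : (1 < p ^ j')%N by move: kp; rewrite up_log_gt0 W1.
      apply: leq_ltn_trans (up_log_gtn W1 p1'); rewrite leq_exp2l //.
      by rewrite -ltnS prednK // -addn2.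
    rewrite natrD mulrDl addrAC subrr add0r natrM ger0_norm ?divr_ge0 ?mulr_ge0 //.
    rewrite mulrA ler_pdivrMr //.
    have h2 : (c%:R : R) <= Q%:R by rewrite ler_nat ltnW.
    have h3 : (W%:R * (W ^ block_index W p j)%:R : R) <= (p ^ j')%:R.
      by rewrite -natrM -expnS ler_nat ltnW.
    set w := (W ^ _)%:R in h3 *.
    have w0 : 0 <= w by [].
    apply: (@le_trans _ _ (dl * (W%:R * w))); last by rewrite ler_wpM2l // ltW.
    rewrite [leRHS]mulrA; apply: le_trans (ler_wpM2r w0 MQW).
    rewrite [w * _]mulrC mulrA ler_wpM2r //.
    by rewrite ler_wpM2l.
  - by rewrite mulr_ge0 // ltW.
  - exact: ltW.
  - move=> j _; rewrite -natrM ler_nat.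
    apply: (@leq_trans (\sum_(0 <= j' < J) ((block_index W p j' == block_index W p j)
       + (block_index W p j' == (block_index W p j).-1) + (block_index W p j' == (block_index W p j).+1)))%N).
      rewrite big_filter /index_iota subn0 [leqRHS](bigID (fun j => ~~ bad j)) /=.
      apply: leq_trans (leq_addr _ _); apply: leq_sum => j' _.
      clear; case: (ltngtP (block_index W p j') (block_index W p j)) => h; case: (boolP (_ && _)) => //; lia.
    rewrite !big_split /=.
    have := count_block_index (block_index W p j) J W1 p1.
    have := count_block_index (block_index W p j).-1 J W1 p1.
    have := count_block_index (block_index W p j).+1 J W1 p1.
    clear; lia.
have aJ : 0 < (a * J%:R) ^+ 2 by rewrite exprn_gt0 // mulr_gt0.
apply: (@le_trans _ _ (expect W os (fun b => ((a * J%:R) ^+ 2)^-1 * (\sum_(j <- js) f j b) ^+ 2))).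
  apply: ler_expect => b; case: ltP => h; last by rewrite mulr_ge0 ?invr_ge0 ?sqr_ge0 // ltW.
  suff hs : \sum_(j <- js) f j b <= - (a * J%:R).
    rewrite mulrC ler_pdivlMr // mul1r -[leRHS]sqrrN lerXn2r ?nnegrE //.
    - by rewrite mulr_ge0 // ltW.
    - by apply: le_trans (_ : a * J%:R <= _); [rewrite mulr_ge0 // ltW | rewrite lerNr].
    - by rewrite lerNr.
  have pp : 0 < (p.-1%:R : R) by rewrite ltr0n -ltnS prednK.
  have := le_lt_trans (@digit_sum_frac R p b J p1) h.
  rewrite natrM mulrCA ltr_pM2l // => h1.
  have h2 : \sum_(j <- js) f j b + (size js)%:R * mu <= \sum_(0 <= j < J) frac_part (b%:R / (p ^ j)%:R : R).
    have -> : \sum_(j <- js) f j b = \sum_(j <- js) tent M (b%:R / (p ^ j)%:R : R) - (size js)%:R * mu.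
      by rewrite /f /ctent sumrB big_const_seq count_predT iter_addr_0 -[_ *+ size js]mulr_natl.
    rewrite subrK big_filter /index_iota subn0 [leRHS](bigID (fun j => ~~ bad j)) /=.
    apply: ler_wpDr; first by apply: sumr_ge0 => j _; exact: frac_part_ge0.
    by apply: ler_sum => j _; exact: tent_le_frac.
  have h3 : (1 / 2 - 2 * a) * ((1 - a) * J%:R) <= (size js)%:R * mu.
    rewrite mulrC ler_pM //; first by rewrite mulr_ge0 // ?subr_ge0 ?(ltW JR) // /a; clear -e1; lra.
    by rewrite /a; clear -e1; lra.
  have eE : eps = 8 * a by rewrite /a; clear; lra.
  rewrite eE in h1; move: (\sum_(j <- js) f j b) h2 => X h2.
  have h4 : (1 / 2 - 2 * a) * ((1 - a) * J%:R) = (1 / 2 - 5 / 2 * a) * J%:R + 2 * a ^+ 2 * J%:R by field.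
  have h5 : 0 <= 2 * a ^+ 2 * J%:R by apply: mulr_ge0; [apply: mulr_ge0; rewrite ?sqr_ge0|exact: ltW].
  have h6 : 0 < a * J%:R by rewrite mulr_gt0.
  move: h1 h2 h3; rewrite h4; clear -h5 h6; nra.
rewrite expectZ ler_pdivrMl //; apply: le_trans SM _.
have hJ : 6 * W%:R <= a ^+ 2 * eps * J%:R.
  have ae : 0 < a ^+ 2 * eps by rewrite mulr_gt0 // exprn_gt0.
  rewrite -ler_pdivrMl // mulrC; apply: le_trans hJ1 _; rewrite ler_nat.
  by apply: leq_trans J2J; rewrite /J2 leq_addl.
have sz0 : 0 <= ((size js)%:R : R) by [].
apply: (@le_trans _ _ (3 * W%:R * J%:R + 3 * dl * J%:R ^+ 2)).
  rewrite (_ : 2 * dl + dl = 3 * dl); last by ring.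
  apply: lerD; first by rewrite ler_wpM2l // mulr_ge0 // ltW.
  apply: ler_wpM2l; first by apply: mulr_ge0 => //; exact: ltW.
  by rewrite lerXn2r ?nnegrE // ltW.
have h := ler_wpM2r (ltW JR) hJ.
rewrite (_ : 3 * dl * J%:R ^+ 2 = a ^+ 2 * eps * J%:R * J%:R / 2); last by rewrite /dl; field.
rewrite (_ : (a * J%:R) ^+ 2 * eps = a ^+ 2 * eps * J%:R * J%:R); last by ring.
move: h; clear; lra.
Qed.

(** * Numbers with saturated lower digits *)

Lemma expect_uniform (R : realFieldType) (W m Z : nat) (F : nat -> R) : (0 < W)%N ->
  expect W (nseq m (iota 0 W) ++ [:: iota 0 Z]) F =
  (W ^ m * Z)%:R^-1 * \sum_(0 <= c < W ^ m * Z) F c.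
Proof.
move=> W0; elim: m F => [|m IH] F /=.
  rewrite size_iota expn0 mul1n /index_iota subn0; congr (_ * _).
  by apply: eq_bigr => y _; rewrite muln0 addn0.
rewrite size_iota; under eq_bigr do rewrite IH.
rewrite -mulr_sumr mulrA -invfM -natrM mulnA -expnS; congr (_ * _).
rewrite expnS -mulnA big_nat_divn exchange_big /=.
by rewrite /index_iota !subn0.
Qed.

Lemma digit_sum_pred q a : (1 < q)%N -> digit_sum q (q ^ a).-1 = (a * q.-1)%N.
Proof.
move=> q1; have q0 : (0 < q)%N by apply: ltnW.
elim: a => [|a IH]; first by rewrite expn0 digit_sum0.
have -> : ((q ^ a.+1).-1 = q.-1 + q ^ 1 * (q ^ a).-1)%N.
  rewrite expn1 expnS; have : (0 < q ^ a)%N by rewrite expn_gt0 q0.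
  by case: (q ^ a)%N => // x _; rewrite mulnS /=; lia.
by rewrite digit_sum_cat ?expn1 ?prednK // digit_sum_small ?prednK // IH mulSn.
Qed.

(** Blocks of [K] digits whose [L] lowest ones are free, the others being [q - 1]. *)
Definition saturated_block (q K L : nat) : seq nat :=
  [seq (c + q ^ L * (q ^ (K - L)).-1)%N | c <- iota 0 (q ^ L)].

Lemma outcomes_saturated q K L m r : (1 < q)%N -> (L <= K)%N ->
  r \in outcomes (q ^ K) (nseq m (saturated_block q K L)) ->
  (r < q ^ (m * K))%N /\ (m * (K - L) * q.-1 <= digit_sum q r)%N.
Proof.
move=> q1 LK; have q0 : (0 < q)%N by apply: ltnW.
elim: m r => [|m IH] r /=; first by rewrite inE => /eqP ->; rewrite digit_sum0.
case/allpairsP => -[y z] /= [/mapP[c]].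
rewrite mem_iota add0n => /andP[_ cQ] -> /IH[zlt zds] ->.
have KE : (q ^ K = q ^ L * q ^ (K - L))%N by rewrite -expnD subnKC.
have ylt : (c + q ^ L * (q ^ (K - L)).-1 < q ^ K)%N.
  rewrite KE; have : (0 < q ^ (K - L))%N by rewrite expn_gt0 q0.
  by case: (q ^ (K - L))%N => // x _ /=; rewrite mulnS ltn_add2r.
split.
  rewrite mulSn expnD.
  apply: (@leq_trans (q ^ K * z.+1)%N); last by rewrite leq_mul2l zlt orbT.
  by rewrite mulnS ltn_add2r.
rewrite digit_sum_cat // [digit_sum q (c + _)]digit_sum_cat // digit_sum_pred //.
by rewrite mulSn mulnDl; apply: leq_add => //; exact: leq_addl.
Qed.

Lemma prime_powers_differ q p K a g : prime q -> prime p -> p != q -> (0 < g)%N ->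
  ((q ^ K) ^ a)%N <> (p ^ g)%N.
Proof.
move=> qp pp pq g0 E; have : (p %| (q ^ K) ^ a)%N by rewrite E -(prednK g0) expnS dvdn_mulr.
rewrite -expnM Euclid_dvdX // => /andP[].
by rewrite dvdn_prime2 // (negbTE pq).
Qed.

Lemma exists_uniform_bound (P0 : nat) (P : nat -> nat -> Prop) :
  (forall p, exists m0, forall m, (m0 <= m)%N -> P p m) ->
  exists m0, forall p m, (p <= P0)%N -> (m0 <= m)%N -> P p m.
Proof.
move=> /choice[f fP]; exists (\max_(p < P0.+1) f p) => p m pP h; apply: fP.
by apply: leq_trans h; apply: (@leq_bigmax _ (fun i : 'I_P0.+1 => f i) (Ordinal (pP : (p < P0.+1)%N))).
Qed.

Lemma trunc_log_ge (R : realType) (p x : nat) : (1 < p)%N -> (0 < x)%N ->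
  ln (x%:R : R) / ln p%:R - 1 <= (trunc_log p x)%:R.
Proof.
move=> p1 x0; have lp := ln_nat_gt0 R p1.
rewrite lerBlDr natr1 ler_pdivrMr // -lnX_nat ?(ltnW p1) //.
by rewrite ler_ln ?posrE ?ltr0n ?expn_gt0 ?(ltnW p1) // ler_nat ltnW // trunc_log_ltn.
Qed.

(** The free digits of the saturated blocks and all the digits put on top are random,
and [typical_digit_sum] applies to the whole number in each base [p]. Averaging
over the free digits and summing over [p <= P0] leaves one choice [r] of them that
is good for all bases at once. *)
Lemma structured_number (R : realType) (q P0 : nat) (eps : R) :
  prime q -> 0 < eps -> eps <= 1 ->
  exists K m0 : nat, (0 < K)%N /\ forall m1 v, (m0 <= m1 * K + v)%N ->
  exists r, [/\ (r < q ^ (m1 * K))%N,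
    (1 - eps) * (q.-1 * (m1 * K))%:R <= (digit_sum q r)%:R &
    forall p, prime p -> (p <= P0)%N -> p != q ->
      (\sum_(0 <= c < q ^ v) ((digit_sum p (r + q ^ (m1 * K) * c))%:R <
         (1 / 2 - eps) * (p.-1%:R * ((m1 * K + v)%:R * ln q%:R / ln p%:R)) :> R)%R)%:R
       <= eps * (q ^ v)%:R].
Proof.
move=> qp e0 e1; have q1 := prime_gt1 qp; have q0 := prime_gt0 qp.
pose e := eps / (4 * P0.+1%:R).
have PR : 1 <= (P0.+1%:R : R) by rewrite ler1n.
have PR0 : 0 < (P0.+1%:R : R) by [].
have ee0 : 0 < e by rewrite divr_gt0 // mulr_gt0.
have ePe : e * P0.+1%:R = eps / 4 by rewrite /e invfM mulrA divfK // gt_eqF.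
have ee1 : e <= eps / 4 by rewrite -ePe ler_peMr // ltW.
have [K [L [K2 LK hL H]]] := typical_digit_sum q1 ee0 (le_trans ee1 (ltac:(lra) : eps / 4 <= 1)).
have K0 : (0 < K)%N by apply: leq_trans K2.
have lq := ln_nat_gt0 R q1.
set W := (q ^ K)%N in H.
have W1 : (1 < W)%N by rewrite -(expn0 q) ltn_exp2l.
(* The threshold m0 is a maximum over the finitely many bases p. *)
pose bad p x (b : nat) : bool := ((digit_sum p b)%:R < x :> R)%R.
have [m0 Hm0] : exists m0, forall p m, (p <= P0)%N -> (m0 <= m)%N ->
   prime p -> p != q -> forall os : seq (seq nat), (m <= size os)%N -> nonempty os ->
     (forall k, (k < m)%N -> fibered R (q ^ L) (nth [::] os k)) -> forall len, (len < m.+1 * K)%N ->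
     expect W os (fun b => (bad p ((1 / 2 - eps) * (p.-1%:R * (len%:R * ln q%:R / ln p%:R))) b)%:R) <= e.
  apply: exists_uniform_bound => p.
  have [[pp pq]|N] := pselect (prime p /\ p != q); last first.
    by exists 0%N => m _ pp pq; case: N.
  have p1 := prime_gt1 pp; have lp := ln_nat_gt0 R p1.
  have [m0 h] := H p p1 (fun a g => @prime_powers_differ q p K a g qp pp pq).
  have [m1 [_ hm1]] := exists_nat_ge ((2 * (K%:R * ln q%:R) + ln p%:R) / (eps * ln q%:R)).
  exists (m0 + m1).+1 => m hm _ _ os ms ne fib len lm.
  have m0m : (m0 <= m)%N by clear -hm; lia.
  apply: le_trans (h m os m0m ms ne fib); apply: ler_expect => b; rewrite ler_nat.
  have [bd|] := boolP (bad _ _ b) => //; rewrite lt0b; apply: lt_le_trans bd _.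
  rewrite natrM mulrCA [leRHS]mulrCA ler_wpM2l //.
  set J := trunc_log p _.
  have JE : ((m.-1 * K)%:R * ln q%:R) / ln p%:R - 1 <= (J%:R : R).
    rewrite -lnX_nat //; apply: le_trans (trunc_log_ge R p1 _) _; last by rewrite /J /W -expnM mulnC.
    by rewrite expn_gt0 q0.
  have lenE : (len%:R : R) <= (m.-1 * K)%:R + 2 * K%:R.
    rewrite -natrM -natrD ler_nat; clear -lm hm; nia.
  have big : 2 * (K%:R * ln q%:R) + ln p%:R <= eps * ln q%:R * (m.-1 * K)%:R :> R.
    have el : 0 < eps * ln (q%:R : R) by rewrite mulr_gt0.
    rewrite -ler_pdivrMl // mulrC; apply: le_trans hm1 _; rewrite ler_nat.
    by clear -hm K0; nia.
  have {}JE : (m.-1 * K)%:R * ln q%:R <= J%:R * ln p%:R + ln p%:R :> R.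
    by have := ler_wpM2r (ltW lp) JE; rewrite mulrBl divfK ?gt_eqF // mul1r; clear; lra.
  rewrite -(ler_pM2r lp).
  have -> : (1 / 2 - eps) * (len%:R * ln q%:R / ln p%:R) * ln p%:R = (1 / 2 - eps) * (len%:R * ln q%:R) :> R.
    by rewrite -mulrA divfK // gt_eqF.
  have eq1 : (1 / 2 - e) * J%:R * ln p%:R = (1 / 2 - e) * (J%:R * ln p%:R) :> R by rewrite mulrA.
  rewrite eq1.
  have c0 : 0 <= 1 / 2 - e by clear -ee1 e1; lra.
  have s1 : (1 / 2 - e) * ((m.-1 * K)%:R * ln q%:R - ln p%:R) <= (1 / 2 - e) * (J%:R * ln p%:R).
    by rewrite ler_wpM2l // lerBlDr.
  apply: le_trans s1.
  have [neg|pos] := lerP (1 / 2 - eps) 0.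
    apply: (@le_trans _ _ 0); first by rewrite mulr_le0_ge0 // mulr_ge0 // ltW.
    rewrite mulr_ge0 //; have : eps * ln q%:R * (m.-1 * K)%:R <= ln q%:R * (m.-1 * K)%:R :> R.
      by rewrite -mulrA ler_piMl // mulr_ge0 // ltW.
    have : 0 <= K%:R * ln q%:R :> R by rewrite mulr_ge0 // ltW.
    by move: big; clear; lra.
  have s2 : (1 / 2 - eps) * (len%:R * ln q%:R) <= (1 / 2 - eps) * (((m.-1 * K)%:R + 2 * K%:R) * ln q%:R).
    by rewrite ler_wpM2l ?(ltW pos) // ler_wpM2r // ltW.
  apply: le_trans s2 _.
  have X0 : 0 <= (m.-1 * K)%:R * ln q%:R :> R by rewrite mulr_ge0 // ltW.
  have Y0 : 0 <= K%:R * ln q%:R :> R by rewrite mulr_ge0 // ltW.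
  have -> : ((m.-1 * K)%:R + 2 * K%:R) * ln q%:R = (m.-1 * K)%:R * ln q%:R + 2 * (K%:R * ln q%:R) :> R by ring.
  move: big; rewrite (_ : eps * ln q%:R * _ = eps * ((m.-1 * K)%:R * ln q%:R)); last by ring.
  move: X0 Y0 (ltW lp); move: ((m.-1 * K)%:R * ln q%:R) (K%:R * ln q%:R) (ln p%:R) => X Y l X0 Y0 l0 big.
  have eX := ler_wpM2r X0 ee1.
  have eY : 0 <= eps * Y by rewrite mulr_ge0 // ltW.
  have el : 0 <= e * l by rewrite mulr_ge0 // ltW.
  by move: eX eY el big X0 Y0 l0; clear; lra.
exists K, (m0.+1 * K)%N; split=> // m1 v hv.
pose m2 := (v %/ K)%N; pose rho := (v %% K)%N; pose m := (m1 + m2)%N.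
have vE : (v = m2 * K + rho)%N by exact: divn_eq.
have rK : (rho < K)%N by rewrite ltn_mod.
have m0m : (m0 <= m)%N.
  by move: hv; rewrite vE /m; clear -rK; nia.
pose top := nseq m2 (iota 0 W) ++ [:: iota 0 (q ^ rho)].
pose low := nseq m1 (saturated_block q K L).
have ne_low : nonempty low.
  by apply/allP => o /nseqP[-> _]; rewrite size_map size_iota expn_gt0 q0.
have ne : nonempty (low ++ top).
  rewrite /nonempty all_cat -/(nonempty low) ne_low /top all_cat /= size_iota expn_gt0 q0 /= andbT.
  by apply/allP => o /nseqP[-> _]; rewrite size_iota ltnW.
have sz : (m <= size (low ++ top))%N.
  by rewrite size_cat size_nseq size_cat size_nseq addnA leq_addr.
have fib k : (k < m)%N -> fibered R (q ^ L) (nth [::] (low ++ top) k).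
  move=> km; rewrite nth_cat size_nseq; case: ltnP => h.
    rewrite nth_nseq h; exact: fibered_run.
  rewrite nth_cat size_nseq; have h2 : (k - m1 < m2)%N by rewrite ltn_subLR.
  rewrite h2 nth_nseq h2 /W -(subnKC LK) expnD; exact: fibered_iota.
have Wv : (W ^ m2 * q ^ rho = q ^ v)%N by rewrite /W -expnM -expnD mulnC -vE.
have Wm : (W ^ m1 = q ^ (m1 * K))%N by rewrite /W -expnM mulnC.
have len_lt : (m1 * K + v < m.+1 * K)%N.
  by rewrite vE /m mulSn mulnDl; clear -rK; lia.
pose thr p : R := (1 / 2 - eps) * (p.-1%:R * ((m1 * K + v)%:R * ln q%:R / ln p%:R)).
pose G p r : R := (q ^ v)%:R^-1 * \sum_(0 <= c < q ^ v) (bad p (thr p) (r + q ^ (m1 * K) * c)%N)%:R.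
have G0 p r : 0 <= G p r by rewrite mulr_ge0 ?invr_ge0 // sumr_ge0.
have EG p : prime p && (p != q) -> (p <= P0)%N -> expect W low (G p) <= e.
  move=> /andP[pp pq] pP; have := Hm0 p m pP m0m pp pq _ sz ne fib _ len_lt.
  apply: le_trans; rewrite expect_cat le_eqVlt; apply/orP; left; apply/eqP.
  apply: eq_expect => r; rewrite /top expect_uniform ?(ltnW W1) // Wv.
  by rewrite size_nseq Wm.
have EH : expect W low (fun r => \sum_(p <- index_iota 0 P0.+1) (if prime p && (p != q) then G p r else 0)) <= eps.
  rewrite expect_sum; apply: (@le_trans _ _ (\sum_(0 <= p < P0.+1) e)).
    apply: ler_sum_nat => p /andP[_ pP]; case: (boolP (prime p && (p != q))) => h; first exact: EG.
    by rewrite expect_const // ltW.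
  rewrite sumr_const_nat subn0 -mulr_natr ePe; clear -e0; lra.
have [r rlow Hr] := expect_exists ne_low EH.
have [rlt rds] := outcomes_saturated q1 LK rlow.
exists r; split=> //.
  apply: le_trans (_ : ((m1 * (K - L) * q.-1)%:R : R) <= _); last by rewrite ler_nat.
  rewrite !natrM natrB //.
  have h : (1 - eps) * K%:R <= K%:R - L%:R :> R.
    have : e * K%:R <= eps * K%:R :> R by rewrite ler_wpM2r //; clear -ee1 e0; lra.
    by move: hL; clear; lra.
  have h2 : 0 <= m1%:R * q.-1%:R :> R by rewrite mulr_ge0.
  have := ler_wpM2l h2 h; clear; lra.
move=> p pp pP pq; rewrite natr_sum -ler_pdivrMr ?ltr0n ?expn_gt0 ?q0 //.
rewrite mulrC; apply: le_trans Hr.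
have pi : p \in index_iota 0 P0.+1 by rewrite mem_index_iota ltnS.
rewrite (bigD1_seq p pi) ?iota_uniq //= ifT ?(introT andP (conj pp pq)) //; apply: ler_wpDr => //.
by apply: sumr_ge0 => p' _; case: ifP.
Qed.

(** * Counting the integers without large excess *)

Lemma g_ge_seq (k n D : nat) (s : seq nat) : size s = k -> (0 < n)%N ->
  all (fun x => (0 < x)%N) s -> (\prod_(x <- s) x`! %| n`!)%N -> sumn s = (n + D)%N ->
  D%:Z <= g k n.
Proof.
move=> sk n0 pos dv sE.
have big (T : Type) (idx : T) (op : Monoid.com_law idx) (F : nat -> T) :
    \big[op/idx]_(i < k) F (nth 0%N s i) = \big[op/idx]_(x <- s) F x.
  by rewrite (big_nth 0%N) sk big_mkord.
have ad : admissible n (fun i : 'I_k => nth 0%N s i).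
  apply/andP; split; last by rewrite (big _ 1%N _ (fun x => x`!)).
  by apply/forallP => i; move/all_nthP: pos => /(_ 0%N i); rewrite sk; apply.
apply: le_trans (g_upper_bound n0 ad).
rewrite (big _ 0%N addn (fun x => x)) -sumnE sE PoszD; lia.
Qed.

(** The tuple [n], [1], .., [1] has sum [n + k - 1]. *)
Lemma g_ge0 (k n : nat) : (0 < k)%N -> (0 < n)%N -> 0 <= g k n.
Proof.
case: k => // k _ n0; apply: le_trans (_ : k%:Z <= _) => //.
apply: (@g_ge_seq k.+1 n k (n :: nseq k 1%N)) => //=.
- by rewrite size_nseq.
- by rewrite n0; apply/allP => x /nseqP[-> _].
- by rewrite big_cons big_nseq [iter _ _ _](_ : _ = 1%N) ?muln1 //; elim: k => //= k ->; rewrite mul1n.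
- by rewrite sumn_nseq mul1n.
Qed.

Lemma low_carriesC p J a b : low_carries p J a b = low_carries p J b a.
Proof. by apply: eq_bigr => j _; rewrite addnC. Qed.

Lemma leq_orb (b c : bool) : ((b || c) <= b + c)%N.
Proof. by case: b; case: c. Qed.

(** The integers [n <= X] without excess [D], counted through the candidates
[ys], [r3 + 3 ^ w * d], [r2 + 2 ^ u * c] of sum [n + D]. In the order of the bound,
either [n < X1], or some digit sum of [n] is large, or a large power of a prime
[p <= y] divides one of [n + 1], .., [n + D]; or else all the pairs [(c, d)]
that represent [n] fail at a prime up to [y], small or middle, or at one above
[y]. *)
Lemma main_count (R : realType) (k X X1 D y P0 u w v v' r2 r3 : nat) (ys : seq nat)
    (LA LB UN : nat -> R) (J : nat -> nat) (e1 : R) :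
  (size ys).+2 = k -> all (fun x => (0 < x)%N) ys -> (0 < X1)%N ->
  (0 < r2 < 2 ^ u)%N -> (0 < r3)%N -> (D <= r2)%N -> (D <= y)%N -> (3 <= y)%N -> (4 <= P0)%N ->
  (sumn ys + (r2 + r3) + 2 ^ u * 3 ^ w <= X1)%N -> (X + D < 3 ^ w * 3 ^ v')%N -> (3 ^ w <= 2 ^ v)%N ->
  0 <= e1 ->
  (forall p, prime p -> (p <= P0)%N ->
     D%:R + UN p <= (\sum_(x <- ys) digit_sum p x)%:R + LA p + LB p) ->
  (forall p, prime p -> (p <= P0)%N ->
     (\sum_(0 <= c < 2 ^ v) ((digit_sum p (r2 + 2 ^ u * c))%:R < LB p)%R)%:R <= e1 * (2 ^ v)%:R) ->
  (forall p, prime p -> (p <= P0)%N ->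
     (\sum_(0 <= d < 3 ^ v') ((digit_sum p (r3 + 3 ^ w * d))%:R < LA p)%R)%:R <= e1 * (3 ^ v')%:R) ->
  (forall p, prime p -> (p <= P0)%N ->
     (\sum_(0 <= n < X.+1) (UN p < (digit_sum p n)%:R)%R)%:R <= e1 * X.+1%:R) ->
  (forall p, prime p -> (P0 < p)%N -> (p <= y)%N ->
     [/\ (p ^ (12 * J p) <= 2 ^ v)%N, (p ^ (12 * J p) <= 3 ^ v')%N,
         (logn p D`! + trunc_log p (y ^ 2) <= J p)%N
       & 4 * y.+1%:R <= e1 * (4 ^ J p)%:R]) ->
  (\sum_(0 <= n < X.+1) ~~ (D%:Z <= g k n)%R)%:R <=
    X1%:R + P0.+1%:R * e1 * X.+1%:R + (y.+1 * (D * (X.+1 %/ y ^ 2).+1))%:R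
    + (2 * P0.+1%:R + 1) * e1 * (2 ^ v * 3 ^ v')%:R
    + (2 ^ v * (D * ((u + v) * (D * (3 ^ v' %/ y).+1))))%:R :> R.
Proof.
move=> kE yspos X10 /andP[r20 r2u] r30 Dr2 Dy y3 P04 hN0 hX hv e10 hsmall hB hA hN hmid.
pose b c := (r2 + 2 ^ u * c)%N; pose a d := (r3 + 3 ^ w * d)%N.
pose N0 := (sumn ys + (r2 + r3))%N.
pose C := (2 ^ v)%N; pose C' := (3 ^ v')%N.
(* The number n + 1 that belongs to the pair (c, 0). *)
pose s c := (N0 + 2 ^ u * c - D).+1.
pose small (c d : nat) := [exists p : 'I_P0.+1, prime p &&
  (((digit_sum p (b c))%:R < LB p)%R || ((digit_sum p (a d))%:R < LA p)%R)].
pose middle (c d : nat) := [exists p : 'I_y.+1, [&& prime p, (P0 < p)%N & (low_carries p (12 * J p) (b c) (a d) < J p)%N]].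
pose large (c d : nat) := [exists r : 'I_D, has (fun p => (y < p)%N && [exists i : 'I_D, (p %| s c + i + 3 ^ w * d)%N]) (primes (b c - r)%N)].
pose badp c d := small c d || middle c d || large c d.
pose typ (n : nat) := [exists p : 'I_P0.+1, prime p && (UN p < (digit_sum p n)%:R)%R].
pose pow (n : nat) := [exists p : 'I_y.+1, (1 < p)%N && [exists i : 'I_D, (p ^ (trunc_log p (y ^ 2)).+1 %| n + i.+1)%N]].
pose badn n := typ n || pow n.
have cop5 q p : prime q -> prime p -> (q < p)%N -> coprime q p.
  by move=> qp pp qlt; rewrite prime_coprime // dvdn_prime2 // neq_ltn qlt.
have step : (\sum_(0 <= n < X.+1) ~~ (D%:Z <= g k n)%R <=
    X1 + \sum_(0 <= n < X.+1) badn n + \sum_(0 <= c < C) \sum_(0 <= d < C') badp c d)%N.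
  apply: (@count_transfer (2 ^ u) (3 ^ w) C C' N0 D) => //.
  - by rewrite coprimeXl // coprimeXr.
  - by rewrite expn_gt0.
  - by rewrite expn_gt0.
  - by move=> n hn; apply: leq_trans hN0 _; apply: leq_trans hn (leq_addr _ _).
  move=> n c d /andP[n1 nX] cC dC rep; rewrite negb_or negb_or -andbA => /and3P[ns nm nl].
  rewrite negb_or => /andP[nt np].
  have n0 : (0 < n)%N by apply: leq_trans n1.
  have bD : (D <= b c)%N by apply: leq_trans Dr2 (leq_addr _ _).
  have sE : (sumn ys + (a d + b c) = n + D)%N by rewrite -rep /N0 /a /b; clear; lia.
  apply: (@g_ge_seq k n D [:: b c, a d & ys]) => //=.
  - by rewrite yspos /b /a !addn_gt0 r20 r30.
  - apply: (@prod_fact_dvdn P0 y D n (a d) (b c) ys J) => //.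
    + move=> p pp pP.
      have h1 : LB p <= (digit_sum p (b c))%:R /\ LA p <= (digit_sum p (a d))%:R.
        move/existsPn: ns => /(_ (Ordinal (pP : (p < P0.+1)%N))) /=.
        by rewrite pp /= negb_or -!leNgt => /andP.
      have h2 : (digit_sum p n)%:R <= UN p.
        by move/existsPn: nt => /(_ (Ordinal (pP : (p < P0.+1)%N))) /=; rewrite pp /= -leNgt.
      rewrite -(ler_nat R) !natrD; have := hsmall p pp pP.
      by move: h1 h2 => [h1 h1'] h2; move: h1 h1' h2; clear; lra.
    + move=> p pp Pp py; have [_ _ h _] := hmid p pp Pp py; split; last split => //.
        rewrite leqNgt low_carriesC; move/existsPn: nm => /(_ (Ordinal (py : (p < y.+1)%N))) /=.
        by rewrite pp Pp.
      move=> i iD; move/existsPn: np => /(_ (Ordinal (py : (p < y.+1)%N))) /=.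
      by rewrite prime_gt1 //= => /existsPn /(_ (Ordinal iD)).
    + move=> p pp yp i iD dv; rewrite leqNgt; apply/negP => lt.
      move: nl => /existsPn /(_ (Ordinal lt)) /= /hasP; apply; exists p.
        rewrite mem_primes pp subn_gt0 (leq_trans lt bD) /=.
        by rewrite {1}(divn_eq (b c) p) addnK dvdn_mull.
      rewrite yp /=; apply/existsP; exists (Ordinal iD) => /=.
      rewrite (_ : s c + i + _ = n + i.+1)%N // /s; move: rep bD; rewrite /N0 /b; clear; lia.
  - by rewrite -sE; clear; lia.
have hsum (f h : nat -> nat) m : (forall i, (f i <= h i)%N) ->
  (\sum_(0 <= i < m) f i <= \sum_(0 <= i < m) h i)%N by move=> H; apply: leq_sum => i _.
have cntn : (\sum_(0 <= n < X.+1) badn n)%:R <= P0.+1%:R * e1 * X.+1%:R + (y.+1 * (D * (X.+1 %/ y ^ 2).+1))%:R :> R.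
  apply: (@le_trans _ _ ((\sum_(0 <= n < X.+1) typ n)%:R + (\sum_(0 <= n < X.+1) pow n)%:R)).
    by rewrite -natrD ler_nat -big_split /=; apply: (hsum _ _ _) => n; exact: leq_orb.
  apply: lerD; last first.
    by rewrite ler_nat; apply: count_prime_powers; apply: leq_trans y3.
  apply: (@le_trans _ _ (\sum_(p < P0.+1) e1 * X.+1%:R)); last first.
    by rewrite sumr_const card_ord -[_ *+ P0.+1]mulr_natl mulrA.
  apply: (@le_trans _ _ (\sum_(p < P0.+1) (\sum_(0 <= n < X.+1) (prime p && (UN p < (digit_sum p n)%:R)%R))%:R)).
    rewrite -natr_sum ler_nat exchange_big /=; apply: (hsum _ _ _) => n; exact: exists_leq_sum.
  apply: ler_sum => p _; case pp: (prime p) => /=; last by rewrite big1 // mulr_ge0.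
  by apply: hN => //; rewrite -ltnS.
have cntp : (\sum_(0 <= c < C) \sum_(0 <= d < C') badp c d)%:R <=
   (2 * P0.+1%:R + 1) * e1 * (C * C')%:R + (C * (D * ((u + v) * (D * (C' %/ y).+1))))%:R :> R.
  apply: (@le_trans _ _ ((\sum_(0 <= c < C) \sum_(0 <= d < C') small c d)%:R +
     (\sum_(0 <= c < C) \sum_(0 <= d < C') middle c d)%:R + (\sum_(0 <= c < C) \sum_(0 <= d < C') large c d)%:R)).
    rewrite -!natrD ler_nat -!big_split /=; apply: (hsum _ _ _) => c; rewrite -!big_split /=; apply: (hsum _ _ _) => d.
    by rewrite /badp; case: (small c d); case: (middle c d); case: (large c d).
  rewrite mulrDl mulrDl mul1r -!addrA; apply: lerD; [|apply: lerD].
  - apply: (@le_trans _ _ (\sum_(p < P0.+1) (2 * e1 * (C * C')%:R))); last first.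
      by rewrite sumr_const card_ord -[_ *+ P0.+1]mulr_natl; rewrite le_eqVlt; apply/orP; left; apply/eqP; ring.
    apply: (@le_trans _ _ (\sum_(p < P0.+1) (\sum_(0 <= c < C) \sum_(0 <= d < C') (prime p &&
        (((digit_sum p (b c))%:R < LB p)%R || ((digit_sum p (a d))%:R < LA p)%R)))%:R)).
      rewrite -natr_sum ler_nat [leqRHS]exchange_big /=; apply: (hsum _ _ _) => c.
      rewrite [leqRHS]exchange_big /=; apply: (hsum _ _ _) => d; exact: exists_leq_sum.
    apply: ler_sum => p _; case pp: (prime p) => /=; last first.
      by rewrite big1 => [|c _]; [rewrite mulr_ge0 // mulr_ge0|rewrite big1].
    have pP : (p <= P0)%N by rewrite -ltnS.
    apply: (@le_trans _ _ ((C' * \sum_(0 <= c < C) ((digit_sum p (b c))%:R < LB p)%R)%:R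
        + (C * \sum_(0 <= d < C') ((digit_sum p (a d))%:R < LA p)%R)%:R)).
      rewrite -natrD ler_nat.
      apply: (@leq_trans (\sum_(0 <= c < C) \sum_(0 <= d < C') (((digit_sum p (b c))%:R < LB p)%R + ((digit_sum p (a d))%:R < LA p)%R))%N).
        by apply: (hsum _ _ _) => c; apply: (hsum _ _ _) => d; exact: leq_orb.
      under eq_bigr do rewrite big_split /= sum_nat_const_nat subn0.
      by rewrite big_split /= sum_nat_const_nat subn0 -big_distrr /=.
    rewrite !natrM.
    have hb := ler_wpM2l (ler0n R C') (hB p pp pP); have ha := ler_wpM2l (ler0n R C) (hA p pp pP).
    by apply: le_trans (lerD hb ha) _; rewrite -/C -/C'; rewrite le_eqVlt; apply/orP; left; apply/eqP; ring.
  - have y10 : 0 < (4 * y.+1%:R : R) by rewrite mulr_gt0.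
    apply: (@le_trans _ _ (\sum_(p < y.+1) (e1 * (C * C')%:R / y.+1%:R))); last first.
      by rewrite sumr_const card_ord -[_ *+ y.+1]mulr_natr divfK // pnatr_eq0.
    apply: (@le_trans _ _ (\sum_(p < y.+1) (\sum_(0 <= c < C) \sum_(0 <= d < C')
        [&& prime p, (P0 < p)%N & (low_carries p (12 * J p) (b c) (a d) < J p)%N])%:R)).
      rewrite -natr_sum ler_nat [leqRHS]exchange_big /=; apply: (hsum _ _ _) => c.
      rewrite [leqRHS]exchange_big /=; apply: (hsum _ _ _) => d; exact: exists_leq_sum.
    apply: ler_sum => p _; case: (boolP (prime p && (P0 < p)%N)) => [/andP[pp Pp]|np]; last first.
      rewrite big1 => [|c _]; first by rewrite !mulr_ge0 ?invr_ge0.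
      by rewrite big1 // => d _; rewrite andbA (negbTE np).
    rewrite pp Pp /=; have [J1 J2 _ J4] := hmid p pp Pp (ltn_ord p : (p <= y)%N).
    have p5 : (5 <= p)%N by apply: leq_trans Pp.
    have cc : (4 ^ J p * \sum_(0 <= c < C) \sum_(0 <= d < C') (low_carries p (12 * J p) (b c) (a d) < J p)%N <= 4 * (C * C'))%N.
      apply: count_few_carries_progression => //.
      - by rewrite coprimeXl // cop5 //; apply: leq_trans p5.
      - by rewrite coprimeXl // cop5 //; apply: leq_trans p5.
    rewrite ler_pdivlMr //.
    have T0 : 0 < ((4 ^ J p)%:R : R) by rewrite ltr0n expn_gt0.
    rewrite -(ler_pM2l T0); move: cc; rewrite -(ler_nat R) natrM.
    set S := (\sum_(0 <= c < C) _)%N; set T := (4 ^ J p)%:R in J4 T0 *.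
    rewrite natrM => cc; rewrite mulrA.
    have := ler_wpM2r (ler0n R y.+1) cc; move=> h; apply: le_trans h _.
    rewrite mulrAC; have := ler_wpM2r (ler0n R (C * C')) J4; move/le_trans; apply.
    by rewrite le_eqVlt; apply/orP; left; apply/eqP; ring.
  - rewrite ler_nat; apply: count_large_primes.
    + by apply: leq_trans y3.
    + by move=> p pp yp; rewrite coprimeXl // cop5 //; apply: leq_ltn_trans yp.
    + move=> c cC; rewrite (leq_trans Dr2 (leq_addr _ _)) /= expnD.
      apply: (@leq_trans (2 ^ u * c.+1)%N); first by rewrite mulnS /b ltn_add2r.
      by rewrite leq_mul2l cC orbT.
have {}step : (\sum_(0 <= n < X.+1) ~~ (D%:Z <= g k n)%R)%:R <=
    X1%:R + (\sum_(0 <= n < X.+1) badn n)%:R + (\sum_(0 <= c < C) \sum_(0 <= d < C') badp c d)%:R :> R.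
  by rewrite -!natrD ler_nat.
apply: le_trans step _; apply: le_trans (lerD (lerD (lexx _) cntn) cntp) _.
by rewrite !addrA.
Qed.

(** * Logarithmic estimates *)

Lemma ln_le_subr1 (R : realType) (x : R) : 0 < x -> ln x <= x - 1.
Proof.
by move=> x0; have := @le_ln1Dx R (x - 1); rewrite subrKC; apply; rewrite ltrBrDl subrr.
Qed.

Lemma ln2_bounds (R : realType) : 1 / 2 <= ln (2 : R) <= 1.
Proof.
have h1 := @ln_le_subr1 R 2 (ltr0n _ 2).
have h2 := @ln_le_subr1 R (2^-1) ltac:(by rewrite invr_gt0 ltr0n).
rewrite lnV ?posrE // in h2; apply/andP; split; lra.
Qed.

Lemma ln_nat_ge_half (R : realType) (m : nat) : (1 < m)%N -> 1 / 2 <= ln (m%:R : R).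
Proof.
move=> m1; have /andP[h _] := ln2_bounds R; apply: le_trans h _.
by rewrite ler_ln ?posrE ?ltr0n ?(ltnW m1) // ler_nat.
Qed.

Lemma ln12E (R : realType) : ln (12 : R) = 2 * ln 2 + ln 3.
Proof.
have -> : (12 : R) = 2 ^+ 2 * 3 by rewrite expr2; lra.
by rewrite lnM ?posrE ?exprn_gt0 // lnXn // mulr2n; ring.
Qed.

Lemma ln_power_le (R : realType) (a b : nat) : (0 < a)%N -> (a <= b)%N -> ln (a%:R : R) <= ln b%:R.
Proof. by move=> a0 ab; rewrite ler_ln ?posrE ?ltr0n ?(leq_trans a0) // ler_nat. Qed.

(** The ratio [((p + 1) / p) ^ 6] is less than [12] when [p >= 5]. *)
Lemma pow6_le_pow12 (R : realType) (p : nat) : (5 <= p)%N -> (p%:R : R) ^+ 6 <= 12 ^+ p.-1.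
Proof.
case: p => // p; rewrite ltnS => p4 /=; rewrite -(subnKC p4); move: (p - 4)%N => m.
elim: m => [|m IH].
  rewrite addn0 (exprM _ 3 2) (exprM _ 2 2) lerXn2r ?nnegrE ?exprn_ge0 //.
  by rewrite !exprS !expr0; lra.
rewrite addnS [leRHS]exprS; apply: le_trans (_ : 12 * (4 + m).+1%:R ^+ 6 <= _); last by rewrite ler_pM2l.
have h : 5 * (4 + m).+2%:R <= 6 * (4 + m).+1%:R :> R.
  by rewrite -!natrM ler_nat; lia.
have h2 : (5 * (4 + m).+2%:R) ^+ 3 <= (6 * (4 + m).+1%:R) ^+ 3 :> R.
  by rewrite lerXn2r ?nnegrE ?mulr_ge0.
rewrite !exprMn in h2; rewrite !(exprM _ 3 2).
have a0 : 0 <= ((4 + m).+2%:R : R) ^+ 3 by rewrite exprn_ge0.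
have b0 : 0 <= ((4 + m).+1%:R : R) ^+ 3 by rewrite exprn_ge0.
move: h2 a0 b0; set a := (4 + m).+2%:R ^+ 3; set b := (4 + m).+1%:R ^+ 3 => h2 a0 b0.
have c5 : (5 : R) ^+ 3 = 125 by rewrite !exprS expr0; lra.
have c6 : (6 : R) ^+ 3 = 216 by rewrite !exprS expr0; lra.
have ab : a <= 2 * b by move: h2; rewrite c5 c6; clear -b0; lra.
by clear -ab a0 b0; nra.
Qed.

(** The digit sum in base [p] of a typical number [m], per unit of [ln m]. *)
Definition half_rate (R : realType) (p : nat) : R := p.-1%:R / (2 * ln p%:R).

(** This is [ln (p ^ 6) <= ln (12 ^ (p - 1))]. It fails for [p = 2] and [p = 3], where
the digit sums must be raised artificially. *)
Lemma half_rate_ge (R : realType) (p : nat) : (5 <= p)%N -> 3 / ln (12 : R) <= half_rate R p.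
Proof.
move=> p5; have p1 : (1 < p)%N by apply: leq_trans p5.
have lp := ln_nat_gt0 R p1; have l12 := ln_nat_gt0 R (isT : (1 < 12)%N).
have : ln ((p%:R : R) ^+ 6) <= ln ((12 : R) ^+ p.-1).
  by rewrite ler_ln ?posrE ?exprn_gt0 ?ltr0n ?(ltnW p1) // pow6_le_pow12.
rewrite !lnXn ?ltr0n ?(ltnW p1) // -[_ *+ 6]mulr_natl -[_ *+ p.-1]mulr_natl => h.
rewrite /half_rate ler_pdivlMr ?mulr_gt0 // mulrAC ler_pdivrMr //.
by move: h; clear; lra.
Qed.

Lemma half_rate_ge0 (R : realType) (p : nat) : (1 < p)%N -> 0 <= half_rate R p.
Proof. by move=> p1; rewrite divr_ge0 // mulr_ge0 // ltW // ln_nat_gt0. Qed.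

Lemma pow_le_expR (R : realType) (a C : R) (n : nat) : 0 < a -> 0 <= C ->
  exists x0 : R, 0 < x0 /\ forall x, x0 <= x -> C * x ^+ n <= expR (a * x).
Proof.
move=> a0 C0; pose F : R := (n.+1)`!%:R.
have F0 : 0 < F by rewrite ltr0n fact_gt0.
exists (C * F / a ^+ n.+1 + 1); split.
  by rewrite ltr_wpDl // divr_ge0 ?mulr_ge0 ?exprn_ge0 // ltW.
move=> x hx; have an : 0 < a ^+ n.+1 by rewrite exprn_gt0.
have x0 : 0 <= x.
  by apply: le_trans hx; rewrite addr_ge0 // divr_ge0 ?mulr_ge0 // ltW.
have h := @expR_ge1Dxn R (a * x) n (mulr_ge0 (ltW a0) x0).
apply: le_trans h; rewrite exprMn -/F.
have : C * F <= a ^+ n.+1 * x.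
  by rewrite -ler_pdivrMl // mulrC; apply: le_trans hx; rewrite lerDl.
have xn : 0 <= x ^+ n by rewrite exprn_ge0.
move=> h2; apply: ler_wpDl => //; rewrite ler_pdivlMr // (exprS x) [leRHS]mulrA [leLHS]mulrAC.
by apply: ler_wpM2r.
Qed.

Lemma ln_sq_le (R : realType) (a C : R) : 0 < a -> 0 <= C ->
  exists x0 : R, 1 <= x0 /\ forall x, x0 <= x -> C * (1 + ln x) ^+ 2 <= a * x.
Proof.
move=> a0 C0; have Ca : 0 <= 4 * C / a by rewrite divr_ge0 ?mulr_ge0 // ltW.
have [s0 [s00 hs]] := @pow_le_expR R 1 (4 * C / a) 2 ltr01 Ca.
exists (expR (s0 + 1)); split.
  by rewrite -[leLHS]expR0 ler_expR addr_ge0 // ltW.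
move=> x hx; have x0 : 0 < x by apply: lt_le_trans hx; exact: expR_gt0.
have ls : s0 + 1 <= ln x by rewrite -[leLHS]expRK ler_ln ?posrE ?expR_gt0.
have := hs (ln x) (le_trans _ ls); rewrite lerDl ler01 => /(_ isT).
rewrite mul1r lnK ?posrE // mulrAC ler_pdivrMr // [x * a]mulrC; apply: le_trans.
have : (1 + ln x) ^+ 2 <= 4 * ln x ^+ 2.
  have l1 : 1 <= ln x by apply: le_trans ls; rewrite lerDr ltW.
  rewrite (_ : 4 * ln x ^+ 2 = (2 * ln x) ^+ 2); last by ring.
  by rewrite lerXn2r ?nnegrE; move: l1; clear; lra.
by move/(ler_wpM2l C0)/le_trans; apply; rewrite mulrCA mulrA.
Qed.

Lemma digit_sum2_expn n : (2 ^ digit_sum 2 n <= n.+1)%N.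
Proof.
elim/ltn_ind: n => -[|n] IH; first by rewrite digit_sum0.
rewrite digit_sum_rec //; have := IH (n.+1 %/ 2)%N (ltn_Pdiv (isT : (1 < 2)%N) (ltn0Sn n)).
have := divn_eq n.+1 2; have : (n.+1 %% 2 < 2)%N by rewrite ltn_mod.
rewrite expnD; move: (n.+1 %/ 2)%N (n.+1 %% 2)%N => q [|[|r]] // _.
  by rewrite expn0 mul1n; lia.
by rewrite expn1; lia.
Qed.

(** * Typical digit sums in every small base *)

Lemma half_rateM (R : realType) (p : nat) : (1 < p)%N -> 2 * half_rate R p * ln p%:R = p.-1%:R.
Proof.
move=> p1; have lp := ln_nat_gt0 R p1; rewrite /half_rate; field.
exact: lt0r_neq0.
Qed.

Lemma leq_sum_bool (m : nat) (P Q : nat -> bool) : (forall c, P c -> Q c) ->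
  (\sum_(0 <= c < m) P c <= \sum_(0 <= c < m) Q c)%N.
Proof. by move=> h; apply: leq_sum => c _; case: (P c) (h c) => // ->. Qed.

Lemma atypical_low (R : realType) (q v : nat) (eps : R) : (1 < q)%N -> 0 < eps ->
  (0 < v)%N -> 1 <= eps ^+ 3 * v%:R ->
  (\sum_(0 <= c < q ^ v) ((digit_sum q c)%:R < (1 / 2 - eps) * (q.-1 * v)%:R :> R)%R)%:R
    <= eps * (q ^ v)%:R.
Proof.
move=> q1 e0 v0 ev; have h := count_atypical_digit_sum q1 e0 v0.
set n1 := (\sum_(0 <= n < _) _)%N in h.
have n1le : (\sum_(0 <= c < q ^ v) ((digit_sum q c)%:R < (1 / 2 - eps) * (q.-1 * v)%:R :> R)%R <= n1)%N.
  apply: leq_sum_bool => c hc; rewrite lter_normr; apply/orP; right.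
  by rewrite [in ltRHS]natrM; move: hc; clear; lra.
have {n1le} : (\sum_(0 <= c < q ^ v) ((digit_sum q c)%:R < (1 / 2 - eps) * (q.-1 * v)%:R :> R)%R)%:R <= n1%:R :> R by rewrite ler_nat.
move/le_trans; apply; rewrite -[leLHS]mul1r.
apply: le_trans (_ : (eps ^+ 3 * v%:R) * n1%:R <= _); first by apply: ler_wpM2r.
rewrite exprS -!mulrA; apply: ler_wpM2l; first exact: ltW.
by move: h; rewrite expr2 !mulrA.
Qed.

(** Most of the numbers [r + q ^ u * c] have, in each prime base [p <= P0], at least
nearly the digit sum of a random number of their size; in base [q] the digits of
[r] count twice, being nearly all equal to [q - 1]. *)
Definition rich_residue (R : realType) (P0 q u v : nat) (eps : R) (r : nat) : Prop :=
  [/\ (r < q ^ u)%N, (1 - eps) * (q.-1 * u)%:R <= (digit_sum q r)%:R &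
    forall p, prime p -> (p <= P0)%N ->
      (\sum_(0 <= c < q ^ v) ((digit_sum p (r + q ^ u * c))%:R <
         half_rate R p * (1 - 2 * eps)
           * ((u + v)%:R * ln q%:R + (p == q)%:R * (u%:R * ln q%:R)) :> R)%R)%:R
       <= eps * (q ^ v)%:R].

(** In bases other than [q] this is [structured_number]. In base [q] the digit sums of
[r] and of [c] add up, and that of [c] is typical. *)
Lemma rich_residue_exists (R : realType) (q P0 : nat) (eps : R) :
  prime q -> 0 < eps -> eps <= 1 / 2 ->
  exists K m0 : nat, (0 < K)%N /\ forall m1 v, (m0 <= m1 * K)%N ->
  (v == 0%N) || (m0 <= v)%N -> exists r, rich_residue P0 q (m1 * K) v eps r.
Proof.
move=> qp e0 e1; have q1 := prime_gt1 qp.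
have [K [m0 [K0 H]]] := @structured_number R q P0 eps qp e0 ltac:(clear -e1 ; lra).
have [N [N0 hN]] := exists_nat_ge (eps ^- 3).
exists K, (maxn m0 N); split => // m1 v; rewrite geq_max => /andP[h0 hv0] hv.
have [r [ru rs rp]] := H m1 v (leq_trans h0 (leq_addr _ _)).
exists r; split => // p pp pP.
have p1 := prime_gt1 pp; have lp := ln_nat_gt0 R p1.
have hq := half_rateM R p1.
have [E|pq] := eqVneq p q; last first.
  apply: le_trans (rp p pp pP pq); rewrite ler_nat; apply: leq_sum_bool => c.
  move/lt_le_trans; apply; rewrite mul0r addr0.
  rewrite -hq.
  rewrite le_eqVlt; apply/orP; left; apply/eqP; field; exact: lt0r_neq0.
subst p; set u := (m1 * K)%N in ru rs *.
have E : half_rate R q * (1 - 2 * eps) * ((u + v)%:R * ln q%:R + true%:R * (u%:R * ln q%:R))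
   = (1 - 2 * eps) * (q.-1 * u)%:R + (1 / 2 - eps) * (q.-1 * v)%:R :> R.
  by rewrite natrD !(natrM _ q.-1) -hq [true%:R](_ : _ = 1) //; field.
have below c : ((digit_sum q (r + q ^ u * c))%:R <
         half_rate R q * (1 - 2 * eps) * ((u + v)%:R * ln q%:R + true%:R * (u%:R * ln q%:R)))%R ->
   ((digit_sum q c)%:R < (1 / 2 - eps) * (q.-1 * v)%:R :> R)%R.
  rewrite E digit_sum_cat // natrD.
  have : 0 <= eps * (q.-1 * u)%:R by apply: mulr_ge0 => //; exact: ltW.
  by move: rs; clear; lra.
apply: le_trans (_ : (\sum_(0 <= c < q ^ v) ((digit_sum q c)%:R < (1 / 2 - eps) * (q.-1 * v)%:R :> R)%R)%:R <= _).
  by rewrite ler_nat; apply: leq_sum_bool.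
have [v0|v0] := posnP v.
  rewrite v0 expn0 big_nat1 muln0 mulr0 ltrn0 /=; apply: mulr_ge0 => //; exact: ltW.
apply: atypical_low => //; move: hv; rewrite eqn0Ngt v0 /= geq_max => /andP[_ Nv].
have : eps ^- 3 <= v%:R by apply: le_trans hN _; rewrite ler_nat.
by move/(ler_wpM2l (ltW (exprn_gt0 3 e0))); rewrite mulfV // lt0r_neq0 // exprn_gt0.
Qed.

(** Chebyshev's inequality up to the power of [p] that follows [X], which exceeds [X]
by a factor [p] at most. *)
Lemma typical_upper (R : realType) (P0 : nat) (eps e1 : R) : 0 < eps -> 0 < e1 ->
  exists X0 : nat, forall X p, (X0 <= X)%N -> prime p -> (p <= P0)%N ->
  (\sum_(0 <= n < X.+1)
     (half_rate R p * (1 + 2 * eps) * (ln X%:R + ln p%:R) < (digit_sum p n)%:R :> R)%R)%:R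
   <= e1 * X.+1%:R.
Proof.
move=> e0 e10; have [N [N0 hN]] := exists_nat_ge (P0%:R / (eps ^+ 2 * e1)).
exists (P0.+1 ^ N)%N => X p hX pp pP; have p1 := prime_gt1 pp; have p0 := prime_gt0 pp.
have X0 : (0 < X)%N by apply: leq_trans hX; rewrite expn_gt0.
have lp := ln_nat_gt0 R p1; have hq := half_rateM R p1.
pose T := (trunc_log p X).+1.
have XT : (X < p ^ T)%N by apply: trunc_log_ltn.
have TX : (p ^ T <= p * X)%N by rewrite expnS leq_mul2l trunc_logP // orbT.
have NT : (N <= T)%N.
  apply/leqW; rewrite -(trunc_expnK N p1); apply: leq_trunc_log.
  by apply: leq_trans hX; rewrite leq_exp2r ?leqW.
have h := count_atypical_digit_sum p1 e0 (isT : (0 < T)%N).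
set n1 := (\sum_(0 <= n < _) _)%N in h.
have lT : T%:R * ln p%:R <= ln X%:R + ln p%:R :> R.
  rewrite -lnX_nat // -lnM ?posrE ?ltr0n // -natrM ler_ln ?posrE ?ltr0n ?muln_gt0 ?expn_gt0 ?p0 ?X0 //.
  by rewrite ler_nat mulnC.
have hr := half_rate_ge0 R p1.
have n1le : (\sum_(0 <= n < X.+1)
     (half_rate R p * (1 + 2 * eps) * (ln X%:R + ln p%:R) < (digit_sum p n)%:R :> R)%R <= n1)%N.
  rewrite /n1 [leqRHS](@big_cat_nat _ _ _ X.+1) //=; apply: leq_trans (leq_addr _ _).
  apply: leq_sum_bool => c hc; rewrite lter_normr; apply/orP; left.
  have : half_rate R p * (1 + 2 * eps) * (T%:R * ln p%:R) < (digit_sum p c)%:R.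
    apply: le_lt_trans hc; apply: ler_wpM2l => //; apply: mulr_ge0 => //.
    by move: e0; clear; lra.
  rewrite !natrM -hq; clear; nra.
have {n1le} : (\sum_(0 <= n < X.+1)
     (half_rate R p * (1 + 2 * eps) * (ln X%:R + ln p%:R) < (digit_sum p n)%:R :> R)%R)%:R <= n1%:R :> R by rewrite ler_nat.
move/le_trans; apply.
have hT : P0%:R <= eps ^+ 2 * T%:R * e1.
  move: hN; rewrite ler_pdivrMr ?mulr_gt0 ?exprn_gt0 // => hN; apply: le_trans hN _.
  rewrite [leRHS]mulrAC [leRHS]mulrC; apply: ler_wpM2r; last by rewrite ler_nat.
  by apply: mulr_ge0; [rewrite exprn_ge0 // ltW|exact: ltW].
have P00 : 0 < P0%:R :> R by rewrite ltr0n (leq_trans p0).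
rewrite -(ler_pM2l P00).
apply: le_trans (_ : eps ^+ 2 * T%:R * e1 * n1%:R <= _); first by apply: ler_wpM2r.
rewrite mulrAC; apply: le_trans (_ : (p * X)%:R * e1 <= _).
  apply: ler_wpM2r; first exact: ltW.
  by apply: le_trans h _; rewrite ler_nat.
rewrite mulrCA [_ * e1]mulrC; apply: ler_wpM2l; first exact: ltW.
by rewrite -natrM ler_nat leq_mul.
Qed.

Lemma rich_residue_alone (R : realType) (P0 q u : nat) (eps : R) (r p : nat) : eps < 1 ->
  rich_residue P0 q u 0 eps r -> prime p -> (p <= P0)%N ->
  half_rate R p * (1 - 2 * eps) * ((1 + (p == q)%:R) * (u%:R * ln q%:R)) <= (digit_sum p r)%:R.
Proof.
move=> e1 [_ _ h] pp pP; have := h p pp pP.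
rewrite expn0 big_nat1 muln0 !addn0 mulr1 [(1 + _) * _]mulrDl mul1r; case: ltP => // _.
by rewrite leNgt e1.
Qed.

Lemma rich_residue_gt0 (R : realType) (P0 q u v : nat) (eps : R) (r : nat) : eps < 1 -> (1 < q)%N ->
  (0 < u)%N -> rich_residue P0 q u v eps r -> (0 < r)%N.
Proof.
move=> e1 q1 u0 [_ h _]; case: r h => // h; move: h; rewrite digit_sum0 leNgt.
by rewrite mulr_gt0 ?subr_gt0 // ltr0n muln_gt0 u0 -ltnS (prednK (ltnW q1)) q1.
Qed.

(** * The digit-sum budget *)

Lemma truncn_multiple (R : realType) (a x : R) : 0 < a -> 0 <= x ->
  exists m : nat, m%:R * a <= x /\ x - a < m%:R * a.
Proof.
move=> a0 x0; exists (Num.truncn (x / a)).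
have /andP[h1 h2] := truncn_itv (divr_ge0 x0 (ltW a0)).
rewrite ler_pdivlMr // in h1; rewrite ltr_pdivrMr // -natr1 mulrDl mul1r in h2.
by split => //; rewrite ltrBlDr.
Qed.

Lemma third_bound (R : realType) : 0 <= 3 / ln (12 : R) <= 2.
Proof.
have l12 := ln_nat_gt0 R (isT : (1 < 12)%N).
rewrite divr_ge0 ?(ltW l12) // ler_pdivrMr // ln12E.
have /andP[l2 _] := ln2_bounds R; have l3 := @ln_nat_ge_half R 3 isT.
by apply/andP; split => //; move: l2 l3; clear; lra.
Qed.


(** The digit-sum budget divided by [half_rate]. The indicators [i2] and [i3] tell
whether the base is [2] or [3]; [A + al'] and [B + (1 - al')] are the lengths of
the saturated parts in these bases, in units of [L], up to errors in [e] and [c]. *)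
Lemma bracket_bound (R : realType) (k A B : nat) (al be al' e d L c i2 i3 lp y2 y3 ul wl pl ql : R) :
  k = (A + B).+2 -> 0 < e -> e <= 1 / 40 -> 0 < d -> d <= e -> 0 < L -> 0 <= c ->
  2 * k%:R * c <= e * L -> 0 <= al -> 0 <= be -> al + be = 1 -> 0 <= al' -> al' <= 1 ->
  (k%:R - 1) * al = A%:R + al' ->
  [\/ i2 = 0 /\ i3 = 0, i2 = 1 /\ i3 = 0 | i2 = 0 /\ i3 = 1] ->
  0 <= lp -> lp <= e * L ->
  (1 - e) * L - c <= y2 -> (1 - e) * L - c <= y3 ->
  ((1 - 3 * e) * al' + e) * L - c <= ul -> ((1 - 3 * e) * (1 - al') + e) * L - c <= wl ->
  (1 - e) * L - 2 * c <= pl -> L <= ql ->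
  (k%:R - 1) * L * (1 + i2 * al + i3 * be) - 10 * k%:R * e * L <=
  (1 - 2 * d) * (A%:R * ((1 + i2) * y2) + B%:R * ((1 + i3) * y3) + (ql + i3 * wl) + (pl + i2 * ul))
   - (1 + 2 * d) * (L + lp).
Proof.
move=> kAB e0 e1 d0 de L0 c0 hc al0 be0 albe al'0 al'1 alE hi lp0 lpL hy2 hy3 hu hw hp hq.
have kE : k%:R = A%:R + B%:R + 2 :> R by rewrite kAB -addn2 !natrD.
have A0 : 0 <= A%:R :> R by [].
have B0 : 0 <= B%:R :> R by [].
have i20 : 0 <= i2 by case: hi => [][-> _].
have i30 : 0 <= i3 by case: hi => [][_ ->].
have eL : 0 <= e * L by apply: mulr_ge0; exact: ltW.
have eL' : 0 <= (1 - al') * (e * L) by apply: mulr_ge0 => //; move: al'1; clear; lra.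
have eL2 : 0 <= al' * (e * L) by apply: mulr_ge0.
have AeL := mulr_ge0 A0 eL; have BeL := mulr_ge0 B0 eL.
have Ac := mulr_ge0 A0 c0; have Bc := mulr_ge0 B0 c0.
have alL : (k%:R - 1) * al * L = (A%:R + al') * L by rewrite alE.
have beE : be = 1 - al by move: albe; clear; lra.
pose S0 := (k%:R - 1) * L * (1 + i2 * al + i3 * be) + L - 3 * k%:R * e * L.
have hS : S0 <= A%:R * ((1 + i2) * y2) + B%:R * ((1 + i3) * y3) + (ql + i3 * wl) + (pl + i2 * ul).
  have h1 : A%:R * ((1 + i2) * ((1 - e) * L - c)) <= A%:R * ((1 + i2) * y2).
    by apply: ler_wpM2l => //; apply: ler_wpM2l => //; clear -i20; lra.
  have h2 : B%:R * ((1 + i3) * ((1 - e) * L - c)) <= B%:R * ((1 + i3) * y3).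
    by apply: ler_wpM2l => //; apply: ler_wpM2l => //; clear -i30; lra.
  have h3 := ler_wpM2l i30 hw; have h4 := ler_wpM2l i20 hu.
  apply: le_trans (lerD (lerD (lerD h1 h2) (lerD hq h3)) (lerD hp h4)).
  rewrite /S0 beE; rewrite kE in alL hc *.
  by case: hi => [][-> ->]; move: alL hc AeL BeL eL eL' eL2 Ac Bc c0; clear; lra.
have S0u : S0 <= 2 * k%:R * L.
  have k1 : 0 <= (k%:R - 1) * L by apply: mulr_ge0; [rewrite kE; move: A0 B0; clear; lra|exact: ltW].
  have al1 : (k%:R - 1) * L * al <= (k%:R - 1) * L by rewrite ler_piMr // -albe lerDl.
  have al2 := mulr_ge0 k1 al0.
  rewrite /S0 beE; rewrite kE in al1 al2 k1 *.
  by case: hi => [][-> ->]; move: al1 al2 k1 AeL BeL eL L0; clear; lra.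
have Spos : 0 <= 1 - 2 * d by clear -de e1; lra.
have h := ler_wpM2l Spos hS.
apply: le_trans (lerB h (lexx _)).
have h2 : d * S0 <= e * (2 * k%:R * L).
  apply: le_trans (_ : d * (2 * k%:R * L) <= _); first by apply: ler_wpM2l => //; exact: ltW.
  by apply: ler_wpM2r => //; apply: mulr_ge0; [apply: mulr_ge0|exact: ltW].
have dL : d * L <= e * L by apply: ler_wpM2r => //; exact: ltW.
have dlp : d * lp <= lp by apply: ler_piMl => //; move: de e1; clear; lra.
have keL : (k%:R - 2) * (e * L) = A%:R * (e * L) + B%:R * (e * L) by rewrite kE; ring.
pose Q := (k%:R - 1) * L * (1 + i2 * al + i3 * be).
have -> : (1 - 2 * d) * S0 = S0 - 2 * (d * S0) by ring.
have -> : (1 + 2 * d) * (L + lp) = L + lp + 2 * (d * L) + 2 * (d * lp) by ring.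
have SE : S0 = Q + L - 3 * (k%:R * (e * L)) by rewrite /S0 /Q; ring.
rewrite -/Q; have -> : Q - 10 * k%:R * e * L = Q - 10 * (k%:R * (e * L)) by ring.
move: h2 dL dlp keL AeL BeL lpL eL; rewrite SE; clear; lra.
Qed.

(** The shares solve [(1 + al) / (2 ln 2) = (1 + be) / ln 3] and [al + be = 1]; the common
value is [t = 3 / ln 12]. *)
Lemma log_shares (R : realType) (t al : R) : t = 3 / ln 12 -> al = 2 * t * ln 2 - 1 ->
  [/\ 0 <= al, 0 < 1 - al & 1 - al = t * ln 3 - 1].
Proof.
move=> tE alE; have l12 := ln_nat_gt0 R (isT : (1 < 12)%N).
have l2 := ln_nat_gt0 R (isT : (1 < 2)%N); have l3 := ln_nat_gt0 R (isT : (1 < 3)%N).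
have l23 : ln (2 : R) < ln 3 by rewrite ltr_ln ?posrE ?ltr_nat.
have l34 : ln (3 : R) <= 2 * ln 2.
  have -> : 2 * ln 2 = ln (4%:R : R) by rewrite (_ : 4 = 2 ^ 2)%N // lnX_nat.
  exact: ln_power_le.
have tl : t * ln 12 = 3 by rewrite tE mulfVK // lt0r_neq0.
have tl' : 2 * (t * ln 2) + t * ln 3 = 3 by rewrite -[RHS]tl ln12E; ring.
have t0 : 0 < t by rewrite tE divr_gt0.
have h1 := ler_wpM2l (ltW t0) l34; have h2 : t * ln 2 < t * ln 3 by rewrite ltr_pM2l.
have h3 : 0 < t * ln 2 by apply: mulr_gt0.
by rewrite alE; split; move: tl' h1 h2 h3; clear; lra.
Qed.

(** Compare the digit sums of the [k] numbers with those of [n], which count for one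
unit of [L], and with [D]. The remaining [k - 1] units are worth exactly [t] each
for [p = 2] and [p = 3], thanks to the saturated digits, and at least [t] without
them for [p >= 5]. *)
Lemma digit_budget (R : realType) (p k A B : nat) (t al al' e d L c D y2 y3 ul wl pl ql : R) :
  prime p -> t = 3 / ln 12 -> al = 2 * t * ln 2 - 1 ->
  k = (A + B).+2 -> 0 < e -> e <= 1 / 40 -> 0 < d -> d <= e -> 0 < L -> 0 <= c ->
  2 * k%:R * c <= e * L -> 0 <= al' -> al' <= 1 ->
  (k%:R - 1) * al = A%:R + al' -> ln p%:R <= e * L ->
  (1 - e) * L - c <= y2 -> (1 - e) * L - c <= y3 ->
  ((1 - 3 * e) * al' + e) * L - c <= ul -> ((1 - 3 * e) * (1 - al') + e) * L - c <= wl ->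
  (1 - e) * L - 2 * c <= pl -> L <= ql ->
  D <= (k%:R - 1) * t * L - 20 * k%:R * e * L ->
  D + half_rate R p * (1 + 2 * d) * (L + ln p%:R) <=
  half_rate R p * (1 - 2 * d) *
   (A%:R * ((1 + (p == 2%N)%:R) * y2) + B%:R * ((1 + (p == 3%N)%:R) * y3)
     + (ql + (p == 3%N)%:R * wl) + (pl + (p == 2%N)%:R * ul)).
Proof.
move=> pp tE alE kAB e0 e1 d0 de L0 c0 hc al'0 al'1 kalE hlp hy2 hy3 hu hw hp hq hD.
have p1 := prime_gt1 pp; have lp := ln_nat_gt0 R p1.
have [al0 be0 beE] := log_shares tE alE.
have hi : [\/ (p == 2%N)%:R = 0 :> R /\ (p == 3%N)%:R = 0 :> R,
    (p == 2%N)%:R = 1 :> R /\ (p == 3%N)%:R = 0 :> R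
  | (p == 2%N)%:R = 0 :> R /\ (p == 3%N)%:R = 1 :> R].
  have [->|p2] := eqVneq p 2%N; first by constructor 2.
  by have [_|p3] := eqVneq p 3%N; [constructor 3|constructor 1].
have := bracket_bound kAB e0 e1 d0 de L0 c0 hc al0 (ltW be0) (subrKC _ _) al'0 al'1 kalE hi (ltW lp)
  hlp hy2 hy3 hu hw hp hq.
set S := (X in (1 - 2 * d) * X - _) => hS.
have h0 := half_rate_ge0 R p1.
have := ler_wpM2l h0 hS; rewrite [X in _ <= X](_ : _ = half_rate R p * (1 - 2 * d) * S
  - half_rate R p * (1 + 2 * d) * (L + ln p%:R)); last by ring.
rewrite lerBrDr; apply: le_trans.
rewrite lerD2r; apply: le_trans hD _.
have k2 : 2 <= k%:R :> R by rewrite kAB ler_nat.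
have keL : 0 <= k%:R * e * L by apply: mulr_ge0; [apply: mulr_ge0 => //|]; exact: ltW.
have [p2|p2] := eqVneq p 2%N.
  have h2 : half_rate R p * ln 2 = 1 / 2.
    by have := half_rateM R p1; rewrite p2 /=; clear; lra.
  have hle : half_rate R p <= 2.
    have /andP[l2 _] := ln2_bounds R; move: (ler_wpM2l h0 l2); rewrite h2; clear; lra.
  have E : half_rate R p * (1 + al) = t.
    by rewrite alE (_ : 1 + _ = 2 * t * ln 2); [rewrite mulrCA h2; field|ring].
  rewrite -E (_ : (p == 3%N) = false) ?mul1r ?mul0r; last by rewrite p2.
  move: (ler_wpM2l keL hle); clear; lra.
have [p3|p3] := eqVneq p 3%N.
  have h3 : half_rate R p * ln 3 = 1.
    by have := half_rateM R p1; rewrite p3 /=; clear; lra.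
  have hle : half_rate R p <= 2.
    have l3 := @ln_nat_ge_half R 3 isT; move: (ler_wpM2l h0 l3); rewrite h3; clear; lra.
  have E : half_rate R p * (1 + (1 - al)) = t.
    by rewrite beE (_ : 1 + _ = t * ln 3); [rewrite mulrCA h3 mulr1|ring].
  rewrite -E mul1r mul0r; move: (ler_wpM2l keL hle); clear; lra.
rewrite !mul0r !addr0 !mulr1.
have p5 : (5 <= p)%N.
  by case: p pp p2 p3 {p1 lp hlp hi hS h0 S} => [|[|[|[|[|p]]]]].
have ht := @half_rate_ge R p p5; rewrite -tE in ht.
have /andP[t0 t2] : 0 <= t <= 2 by rewrite tE; exact: third_bound.
have b0 : 0 <= (k%:R - 1) * L - 10 * k%:R * e * L.
  rewrite -mulrBl; apply: mulr_ge0; last exact: ltW.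
  move: (ler_wpM2l (ler0n R k) e1) k2; clear; lra.
have := ler_wpM2r b0 ht; have := ler_wpM2r keL t2.
rewrite -!mulrA; clear; lra.
Qed.

(** * Middle primes and error terms *)

Lemma trunc_log_le (R : realType) (p x : nat) : (1 < p)%N -> (0 < x)%N ->
  (trunc_log p x)%:R * ln p%:R <= ln x%:R :> R.
Proof.
move=> p1 x0; rewrite -lnX_nat ?(ltnW p1) // ler_ln ?posrE ?ltr0n ?expn_gt0 ?(ltnW p1) //.
by rewrite ler_nat trunc_logP.
Qed.

(** By Legendre's formula the exponent is at most [D / (p - 1)], and [p] is large. *)
Lemma logn_fact_small (R : realType) (k p D : nat) (e L : R) : prime p -> 0 < L ->
  48 * k%:R * ln p%:R <= e * p.-1%:R -> D%:R <= 2 * k%:R * L ->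
  24 * ((logn p D`!)%:R * ln p%:R) <= e * L.
Proof.
move=> pp L0 hp hD; have p1 := prime_gt1 pp; have lp := ln_nat_gt0 R p1.
have pm : 0 < p.-1%:R :> R by rewrite ltr0n -ltnS (prednK (ltnW p1)).
have hl : p.-1%:R * (logn p D`!)%:R <= D%:R :> R.
  by rewrite -natrM ler_nat -[leqRHS](logn_fact_legendre D pp) leq_addr.
rewrite -(ler_pM2l pm).
have h1 := ler_wpM2r (ltW lp) (le_trans hl hD); have h2 := ler_wpM2r (ltW L0) hp.
move: h1 h2; move: (logn p D`!)%:R (ln _) => a b; clear; nra.
Qed.

(** There are about [ln Z / ln p] low digits in base [p], one twelfth of which is the
number [J] of carries. This exceeds the exponent of [p] in [D!] since [p] is large,
and the exponent allowed by [y ^ 2] since [ln y] is much smaller than [L]. *)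
Lemma middle_prime (R : realType) (k p D y Z : nat) (e e1 L c : R) :
  prime p -> (p <= y)%N -> (3 <= y)%N -> (0 < Z)%N -> 0 < L -> 0 < e1 ->
  48 * k%:R * ln p%:R <= e * p.-1%:R -> D%:R <= 2 * k%:R * L ->
  e * L - c <= ln Z%:R -> 36 * ln y%:R + c <= e * L / 2 ->
  12 * (ln y%:R * (ln y%:R + ln (8 / e1) + 1)) + c <= e * L ->
  let J := (trunc_log p Z %/ 12)%N in
  [/\ (p ^ (12 * J) <= Z)%N, (logn p D`! + trunc_log p (y ^ 2) <= J)%N
    & 4 * y.+1%:R <= e1 * (4 ^ J)%:R].
Proof.
move=> pp py y3 Z0 L0 e10 hp hD hZ hA hB J.
have p1 := prime_gt1 pp; have lp := ln_nat_gt0 R p1; have y1 : (1 < y)%N by apply: leq_trans y3.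
have y0 := ltnW y1; have ly := ln_nat_gt0 R y1.
have lpy : ln p%:R <= ln y%:R :> R by apply: ln_power_le => //; exact: ltnW.
have JT : (12 * J <= trunc_log p Z)%N by rewrite mulnC leq_trunc_div.
have TJ : (trunc_log p Z <= 12 * J + 11)%N.
  by rewrite [leqLHS](divn_eq _ 12) -/J mulnC leq_add2l -ltnS ltn_mod.
have hJ : e * L - c - 12 * ln p%:R <= 12 * (J%:R * ln p%:R).
  have := trunc_log_ge R p1 Z0; rewrite lerBlDr ler_pdivrMr // => h.
  have : (trunc_log p Z)%:R + 1 <= 12 * J%:R + 12 :> R.
    by rewrite natr1 -natrM -natrD ler_nat; move: TJ; clear; lia.
  move/(ler_wpM2r (ltW lp)); move: h hZ; clear; lra.
have hv := logn_fact_small pp L0 hp hD.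
have ht := @trunc_log_le R p (y ^ 2) p1 ltac:(by rewrite expn_gt0 y0).
rewrite lnX_nat // in ht.
split.
- apply: leq_trans (trunc_logP p1 Z0); rewrite leq_exp2l //.
- rewrite -(ler_nat R) natrD -(ler_pM2r lp) mulrDl.
  move: hJ hv ht hA lpy ly; clear; lra.
have Jy : ln y%:R + ln (8 / e1) <= J%:R.
  rewrite -(ler_pM2r ly).
  have : J%:R * ln p%:R <= J%:R * ln y%:R :> R by apply: ler_wpM2l.
  move: hJ hB lpy; clear; lra.
have : ln (8 / e1 * y%:R) <= ln (4 ^ J)%:R.
  rewrite lnX_nat // lnM ?posrE ?divr_gt0 ?ltr0n // addrC; apply: le_trans Jy _.
  have : 1 <= ln (4%:R : R).
    have -> : ln (4%:R : R) = 2 * ln 2 by rewrite (_ : 4 = 2 ^ 2)%N // lnX_nat.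
    have /andP[l2 _] := ln2_bounds R; move: l2; clear; lra.
  by move/(ler_wpM2l (ler0n R J)); rewrite mulr1.
rewrite ler_ln ?posrE ?mulr_gt0 ?divr_gt0 ?invr_gt0 ?ltr0n ?expn_gt0 //.
rewrite mulrAC ler_pdivrMr // [leRHS]mulrC; apply: le_trans.
by rewrite -!natrM ler_nat; clear -y0; lia.
Qed.

(** The integers [n] near a multiple of a large prime power: their share of [X] is
[O(D / y)], where [D = O(L)] and [y] is of the order of [L ^ 4]. *)
Lemma prime_power_error (R : realType) (X D y k : nat) (L eps : R) : (0 < X)%N -> (0 < y)%N -> 1 <= L ->
  0 < eps -> D%:R <= 2 * k%:R * L -> L ^+ 4 <= 16 * y%:R -> y%:R <= 16 * L ^+ 4 ->
  128 * k%:R <= eps / 10 * L -> 64 * k%:R * L ^+ 5 <= eps / 10 * X%:R ->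
  (y.+1 * (D * (X.+1 %/ y ^ 2).+1))%:R <= eps / 5 * X%:R :> R.
Proof.
move=> X0 y0 L1 e0 hD hyl hyu h1 h2.
have y0r : 0 < y%:R :> R by rewrite ltr0n.
have L0 : 0 < L by apply: lt_le_trans L1.
have e10 : 0 < eps / 10 by rewrite divr_gt0.
have hdiv : (X.+1 %/ y ^ 2)%:R * y%:R ^+ 2 <= 2 * X%:R :> R.
  rewrite -natrX -!natrM ler_nat; apply: leq_trans (leq_trunc_div _ _) _; clear -X0; lia.
have hy1 : y.+1%:R <= 2 * y%:R :> R by rewrite -natrM ler_nat; clear -y0; lia.
set Q := (X.+1 %/ y ^ 2)%N in hdiv *.
have X0r : 0 < X%:R :> R by rewrite ltr0n.
have D0 : 0 <= D%:R :> R by [].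
rewrite !natrM -[Q.+1%:R]natr1.
apply: le_trans (_ : 2 * y%:R * (D%:R * (Q%:R + 1)) <= _).
  by apply: ler_wpM2r => //; apply: mulr_ge0 => //; rewrite natr1.
have t2 : 2 * y%:R * D%:R <= eps / 10 * X%:R.
  have a1 : y%:R * D%:R <= 16 * L ^+ 4 * (2 * k%:R * L).
    apply: ler_pM => //.
  have a2 : 16 * L ^+ 4 * (2 * k%:R * L) = 32 * (k%:R * L ^+ 5) by rewrite !exprS; ring.
  by move: a1 h2; rewrite a2; clear; lra.
have t1 : 2 * (y%:R * (D%:R * Q%:R)) <= eps / 10 * X%:R.
  rewrite -(ler_pM2l y0r).
  have a1 := ler_wpM2l D0 hdiv.
  have a2 : 2 * D%:R * X%:R <= 2 * (2 * k%:R * L) * X%:R.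
    by apply: ler_wpM2r => //; apply: ler_wpM2l.
  have a3 : 128 * k%:R * (L * X%:R) <= eps / 10 * L ^+ 4 * X%:R.
    rewrite mulrA; apply: ler_wpM2r => //; apply: le_trans (_ : eps / 10 * L * L <= _).
      by apply: ler_wpM2r => //; exact: ltW.
    rewrite -mulrA; apply: ler_wpM2l; first exact: ltW.
    by rewrite -expr2; apply: ler_weXn2l.
  have a4 : eps / 10 * L ^+ 4 * X%:R <= eps / 10 * (16 * y%:R) * X%:R.
    by apply: ler_wpM2r => //; apply: ler_wpM2l => //; exact: ltW.
  rewrite expr2 in a1; move: a1 a2 a3 a4; clear; lra.
move: t1 t2; clear; lra.
Qed.

(** The pairs that fail at a large prime: their share is [O(D ^ 2 (u + v) / y)], hence
[O(1 / L)]. *)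
Lemma large_prime_error (R : realType) (X D y k u v v' : nat) (L eps : R) : (0 < X)%N -> (0 < y)%N -> 1 <= L ->
  0 < eps -> D%:R <= 2 * k%:R * L -> L ^+ 4 <= 16 * y%:R -> (y <= 3 ^ v')%N ->
  (u + v)%:R <= 5 * L -> (2 ^ v * 3 ^ v' <= 12 * X)%N -> 30 * (4 * k%:R) ^+ 2 <= eps / 10 / 16 * L ->
  (2 ^ v * (D * ((u + v) * (D * (3 ^ v' %/ y).+1))))%:R <= eps / 10 * X%:R :> R.
Proof.
move=> X0 y0 L1 e0 hD hyl yv huv hX h1.
have y0r : 0 < y%:R :> R by rewrite ltr0n.
have L0 : 0 < L by apply: lt_le_trans L1.
have a1 : (y * (2 ^ v * (3 ^ v' %/ y).+1))%:R <= 24 * X%:R :> R.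
  rewrite -natrM ler_nat; apply: leq_trans (_ : 2 * (2 ^ v * 3 ^ v') <= _)%N; last first.
    by move: hX; move: (2 ^ v * 3 ^ v')%N => m; clear; lia.
  have := leq_trunc_div (3 ^ v') y; set Q := (3 ^ v' %/ y)%N => h.
  rewrite mulnCA [leqRHS]mulnCA leq_mul2l mulnS mulnC mul2n -addnn; apply/orP; right.
  by rewrite addnC leq_add.
rewrite -(ler_pM2l y0r) -natrM.
rewrite (_ : (y * (2 ^ v * (D * ((u + v) * (D * (3 ^ v' %/ y).+1)))))%N =
  (y * (2 ^ v * (3 ^ v' %/ y).+1) * ((u + v) * D ^ 2))%N); last first.
  by move: (3 ^ v' %/ y).+1 (2 ^ v)%N (u + v)%N => *; ring.
rewrite natrM.
have a2 : ((u + v) * D ^ 2)%:R <= 5 * L * (2 * k%:R * L) ^+ 2.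
  rewrite natrM natrX; apply: ler_pM; rewrite ?exprn_ge0 //.
  by rewrite lerXn2r ?nnegrE // (le_trans _ hD).
apply: le_trans (_ : 24 * X%:R * (5 * L * (2 * k%:R * L) ^+ 2) <= _).
  by apply: ler_pM.
have a3 : 24 * X%:R * (5 * L * (2 * k%:R * L) ^+ 2) = 30 * (4 * k%:R) ^+ 2 * (X%:R * L ^+ 3) by ring.
have a4 : eps / 10 / 16 * L ^+ 4 * X%:R <= eps / 10 / 16 * (16 * y%:R) * X%:R.
  by apply: ler_wpM2r => //; apply: ler_wpM2l => //; apply: ltW; rewrite !divr_gt0.
have a5 : 30 * (4 * k%:R) ^+ 2 * (X%:R * L ^+ 3) <= eps / 10 / 16 * L * (X%:R * L ^+ 3).
  by apply: ler_wpM2r => //; apply: mulr_ge0 => //; rewrite exprn_ge0 // ltW.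
have a6 : eps / 10 / 16 * L * (X%:R * L ^+ 3) = eps / 10 / 16 * L ^+ 4 * X%:R by ring.
rewrite a3; rewrite a6 in a5; move: a4 a5; clear; lra.
Qed.

(** Take the fourth power of the binary length of [X]. *)
Lemma middle_cutoff (R : realType) (X : nat) : (0 < X)%N -> 2 <= ln (X%:R : R) ->
  exists y : nat, [/\ ln X%:R ^+ 4 <= 16 * y%:R :> R, y%:R <= 16 * ln X%:R ^+ 4 :> R &
    ln y%:R <= 4 * (1 + ln (ln X%:R)) :> R].
Proof.
move=> X0 L2; set L := ln _ in L2 *; pose l := trunc_log 2 X; exists (l ^ 4)%N.
have /andP[a b] := ln2_bounds R.
have ll : l%:R * ln 2%:R <= L by apply: trunc_log_le.
have lg : L / ln 2%:R - 1 <= l%:R by apply: trunc_log_ge.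
have l2 : l%:R <= 2 * L.
  by move: (ler_wpM2l (ler0n R l) a) ll; clear; lra.
have L2l : L <= 2 * l%:R.
  have : L <= L / ln 2%:R.
    rewrite ler_pdivlMr ?ln_nat_gt0 //; apply: ler_piMr => //; move: L2; clear; lra.
  by move: lg L2; clear; lra.
have L0 : 0 < L by move: L2; clear; lra.
have l0 : (0 < l)%N by rewrite -(ltr0n R); move: L2l L0; clear; lra.
split.
- rewrite natrX (_ : 16 = 2 ^+ 4); last by rewrite !exprS expr0; ring.
  by rewrite -exprMn lerXn2r ?nnegrE ?mulr_ge0 //; exact: ltW.
- rewrite natrX (_ : 16 = 2 ^+ 4); last by rewrite !exprS expr0; ring.
  by rewrite -exprMn lerXn2r ?nnegrE ?mulr_ge0 //; exact: ltW.
rewrite lnX_nat //; apply: ler_wpM2l => //.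
apply: le_trans (_ : ln (2 * L) <= _); first by rewrite ler_ln ?posrE ?ltr0n // mulr_gt0.
by rewrite lnM ?posrE // lerD2r.
Qed.

(** The lengths of the free parts in bases [2] and [3]: long enough to represent all
[n <= X], short enough to leave [O(X)] pairs. *)
Lemma complementary_lengths (X w : nat) : (0 < X)%N -> (3 ^ w <= X)%N -> exists v v' : nat,
  [/\ (3 ^ w <= 2 ^ v)%N, (2 ^ v <= 2 * 3 ^ w)%N, (2 * X <= 3 ^ w * 3 ^ v')%N &
      (2 ^ v * 3 ^ v' <= 12 * X)%N].
Proof.
move=> X0 wX; pose v := up_log 2 (3 ^ w); pose z := up_log 3 (2 * X).
have up p m : (1 < p)%N -> (0 < m)%N -> (m <= p ^ up_log p m <= p * m)%N.
  move=> p1 m0; rewrite up_logP //=; have [m1|m1] := leqP m 1.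
    have -> : m = 1%N by lia.
    by rewrite up_log1 expn0 muln1 ltnW.
  have := up_log_bounds p1 m1; move/andP=> [h _].
  have u0 : (0 < up_log p m)%N by rewrite up_log_gt0 p1.
  by rewrite -(prednK u0) expnS leq_mul2l ltnW ?orbT.
have w0 : (0 < 3 ^ w)%N by rewrite expn_gt0.
have /andP[v1 v2] := up 2 _ isT w0.
have /andP[z1 z2] := up 3 (2 * X)%N isT ltac:(by rewrite muln_gt0).
have wz : (w <= z)%N by rewrite -(leq_exp2l _ _ (isT : (1 < 3)%N)); apply: leq_trans z1; lia.
exists v, (z - w)%N; rewrite -expnD subnKC //; split => //.
apply: leq_trans (_ : 2 * 3 ^ w * 3 ^ (z - w) <= _)%N; first by rewrite leq_mul2r v2 orbT.
rewrite -mulnA -expnD subnKC //; apply: leq_trans (_ : 2 * (3 * (2 * X)) <= _)%N; last by lia.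
by rewrite leq_mul2l z2.
Qed.

(** The conditions on [L = ln X] under which all error terms are small, for fixed
values of the other parameters. *)
Record large_scale (R : realType) (k P0 : nat) (eps e e1 c m L : R) : Prop := LargeScale {
  scale_ge : 32 * k%:R <= L;
  scale_const : 8 * (k%:R * c + m + ln P0%:R) <= e * L;
  scale_exp : 3 * k%:R * L <= expR (e / 4 * L);
  scale_first : 10 * (k%:R + 1) / eps <= expR (e * L);
  scale_ln : 48 * (5 + ln (8 / e1)) * (1 + ln L) ^+ 2 <= e / 4 * L;
  scale_lin1 : 128 * k%:R <= eps / 10 * L;
  scale_lin2 : 30 * (4 * k%:R) ^+ 2 <= eps / 10 / 16 * L;
  scale_pow5 : 64 * k%:R * L ^+ 5 <= eps / 10 * expR L;
  scale_pow4 : 16 * L ^+ 4 <= expR (e * L) }.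

Lemma ev_linear (R : realType) (a C : R) : 0 < a -> exists L0 : R, forall L, L0 <= L -> C <= a * L.
Proof. by move=> a0; exists (C / a) => L; rewrite ler_pdivrMr // mulrC. Qed.

Lemma large_scale_eventually (R : realType) (k P0 : nat) (eps e e1 c m : R) :
  0 < eps -> 0 < e -> 0 < e1 -> e1 <= 1 -> exists L0 : R, forall L, L0 <= L ->
  large_scale k P0 eps e e1 c m L.
Proof.
move=> eps0 e0 e10 e11.
have k0 : 0 <= k%:R :> R by [].
have [L1 h1] := @ev_linear R 1 (32 * k%:R) ltr01.
have [L2 h2] := @ev_linear R e (8 * (k%:R * c + m + ln P0%:R)) e0.
have [L3 [_ h3]] := @pow_le_expR R (e / 4) (3 * k%:R) 1 ltac:(by rewrite divr_gt0) ltac:(by rewrite mulr_ge0).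
have [L4 [_ h4]] := @pow_le_expR R e (10 * (k%:R + 1) / eps) 0 e0
  ltac:(by rewrite divr_ge0 ?(ltW eps0) // mulr_ge0 // addr_ge0).
have C1 : 0 <= ln (8 / e1) by rewrite ln_ge0 // ler_pdivlMr // mul1r (le_trans e11) // ler1n.
have [L5 [_ h5]] := @ln_sq_le R (e / 4) (48 * (5 + ln (8 / e1))) ltac:(by rewrite divr_gt0)
  ltac:(by rewrite mulr_ge0 // addr_ge0).
have eps10 : 0 < eps / 10 by rewrite divr_gt0.
have [L6 h6] := @ev_linear R (eps / 10) (128 * k%:R) eps10.
have [L7 h7] := @ev_linear R (eps / 10 / 16) (30 * (4 * k%:R) ^+ 2) ltac:(by rewrite divr_gt0).
have [L8 [_ h8]] := @pow_le_expR R 1 (64 * k%:R / (eps / 10)) 5 ltr01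
  (divr_ge0 (mulr_ge0 (ler0n R 64) k0) (ltW eps10)).
have [L9 [_ h9]] := @pow_le_expR R e 16 4 e0 ltac:(by []).
exists (`|L1| + `|L2| + `|L3| + `|L4| + `|L5| + `|L6| + `|L7| + `|L8| + `|L9|) => L hL.
have n1 := ler_norm L1; have n2 := ler_norm L2; have n3 := ler_norm L3; have n4 := ler_norm L4.
have n5 := ler_norm L5; have n6 := ler_norm L6; have n7 := ler_norm L7; have n8 := ler_norm L8.
have n9 := ler_norm L9.
have p1 := normr_ge0 L1; have p2 := normr_ge0 L2; have p3 := normr_ge0 L3; have p4 := normr_ge0 L4.
have p5 := normr_ge0 L5; have p6 := normr_ge0 L6; have p7 := normr_ge0 L7; have p8 := normr_ge0 L8.
have p9 := normr_ge0 L9.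
have [l1 l2 l3 l4] : [/\ L1 <= L, L2 <= L, L3 <= L & L4 <= L].
  by move: hL n1 n2 n3 n4 p1 p2 p3 p4 p5 p6 p7 p8 p9; clear; split; lra.
have [l5 l6 l7 l8] : [/\ L5 <= L, L6 <= L, L7 <= L & L8 <= L].
  by move: hL n5 n6 n7 n8 p1 p2 p3 p4 p5 p6 p7 p8 p9; clear; split; lra.
have l9 : L9 <= L by move: hL n9 p1 p2 p3 p4 p5 p6 p7 p8; clear; lra.
split.
- by rewrite -[L]mul1r h1.
- exact: h2.
- exact: h3.
- by have := h4 L l4; rewrite expr0 mulr1.
- exact: h5.
- exact: h6.
- exact: h7.
- by have := h8 L l8; rewrite mul1r mulrAC ler_pdivrMr // mulrC [expR L * (eps / 10)]mulrC.
- exact: h9.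
Qed.

(** * Most integers have a large excess *)

Lemma block_length (R : realType) (q K : nat) (x c : R) : (1 < q)%N -> (0 < K)%N -> 0 <= x ->
  K%:R * ln q%:R <= c -> exists m1 : nat,
  (m1 * K)%:R * ln q%:R <= x /\ x - c <= (m1 * K)%:R * ln q%:R.
Proof.
move=> q1 K0 x0 hc; have a0 : 0 < K%:R * ln (q%:R : R) by rewrite mulr_gt0 ?ltr0n ?ln_nat_gt0.
have [m1 [h1 h2]] := truncn_multiple a0 x0; exists m1; rewrite natrM -mulrA; split=> //.
by move: h2 hc; clear; lra.
Qed.

Lemma expn_le_expR (R : realType) (q n : nat) (x : R) : (0 < q)%N ->
  n%:R * ln q%:R <= x -> (q ^ n)%:R <= expR x.
Proof.
by move=> q0 h; rewrite -[leLHS]lnK ?posrE ?ltr0n ?expn_gt0 ?q0 // ler_expR lnX_nat.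
Qed.

Lemma expR_le_expn (R : realType) (q n : nat) (x : R) : (0 < q)%N ->
  x <= n%:R * ln q%:R -> expR x <= (q ^ n)%:R.
Proof.
by move=> q0 h; rewrite -[leRHS]lnK ?posrE ?ltr0n ?expn_gt0 ?q0 // ler_expR lnX_nat.
Qed.

(** The choice of the lengths. In units of [L = ln X], [y2] and [y3] have [1 - e]
saturated binary and ternary digits, while the two numbers of the pair have [al2]
and [be2]. The moduli then have product [X ^ (1 - e)] at most, which makes the early
[n] negligible, and in both numbers a length [e] at least remains free for the
middle primes. *)
Lemma g_ge_most_at (R : realType) (k A B P0 K2 K3 m X : nat) (eps e e1 d c t al al' : R) :
  t = 3 / ln 12 -> al = 2 * t * ln 2 - 1 -> k = (A + B).+2 ->
  0 < eps -> eps <= 1 -> e = eps / (100 * k%:R) -> (4 <= P0)%N -> e1 = eps / (100 * P0.+1%:R) ->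
  0 < d -> d <= e -> d <= e1 -> 0 <= al' -> al' <= 1 -> (k%:R - 1) * al = A%:R + al' ->
  (forall p, prime p -> (P0 < p)%N -> 48 * k%:R * ln p%:R <= e * p.-1%:R) ->
  (0 < K2)%N -> (0 < K3)%N -> c = K2%:R * ln 2%:R + K3%:R * ln 3%:R ->
  (forall m1 v, (m <= m1 * K2)%N -> (v == 0%N) || (m <= v)%N ->
     exists r, rich_residue P0 2 (m1 * K2) v d r) ->
  (forall m1 v, (m <= m1 * K3)%N -> (v == 0%N) || (m <= v)%N ->
     exists r, rich_residue P0 3 (m1 * K3) v d r) ->
  (0 < X)%N ->
  (forall p, prime p -> (p <= P0)%N -> (\sum_(0 <= n < X.+1)
     (half_rate R p * (1 + 2 * d) * (ln X%:R + ln p%:R) < (digit_sum p n)%:R :> R)%R)%:R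
     <= e1 * X.+1%:R) ->
  large_scale k P0 eps e e1 c m%:R (ln X%:R) ->
  exists D : nat, (k%:R - 1) * t * ln X%:R - 20 * k%:R * e * ln X%:R - 1 <= D%:R /\
   (\sum_(0 <= n < X.+1) ~~ (D%:Z <= g k n)%R)%:R <= eps * X%:R.
Proof.
move=> tE alE kAB eps0 eps1 eE P4 e1E d0 de de1 al'0 al'1 kal hP K20 K30 cE s2 s3 X0 hN sc.
have [s_ge s_const s_exp s_first s_ln s_lin1 s_lin2 s_pow5 s_pow4] := sc; clear sc.
have expL : expR (ln X%:R) = X%:R :> R by rewrite lnK // posrE ltr0n.
set L := ln X%:R in s_ge s_const s_exp s_first s_ln s_lin1 s_lin2 s_pow5 s_pow4 hN expL *.
have k2 : 2 <= k%:R :> R by rewrite kAB ler_nat.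
have k0 : 0 < k%:R :> R by apply: lt_le_trans k2.
have e0 : 0 < e by rewrite eE divr_gt0 // mulr_gt0.
have eke : 100 * k%:R * e = eps by rewrite eE mulrC mulfVK // mulf_neq0 ?lt0r_neq0.
have e40 : e <= 1 / 200.
  have : 200 * e <= 100 * k%:R * e by apply: ler_wpM2r; [exact: ltW|move: k2; clear; lra].
  by rewrite eke; move: eps1; clear; lra.
have e10 : 0 < e1 by rewrite e1E divr_gt0 // mulr_gt0.
have eP : 100 * P0.+1%:R * e1 = eps by rewrite e1E mulrC mulfVK // mulf_neq0 ?lt0r_neq0.
have L64 : 64 <= L by move: s_ge k2; clear; lra.
have L0 : 0 < L by move: L64; clear; lra.
have L1 : 1 <= L by move: L64; clear; lra.
have eL0 : 0 < e * L by apply: mulr_gt0.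
have l2 := ln_nat_gt0 R (isT : (1 < 2)%N); have l3 := ln_nat_gt0 R (isT : (1 < 3)%N).
have /andP[l2lo l2hi] := ln2_bounds R.
have l3hi : ln (3%:R : R) <= 2.
  by have := @ln_le_subr1 R 3%:R ltac:(by rewrite ltr0n); clear; lra.
have l3lo : 1 / 2 <= ln (3%:R : R) by apply: ln_nat_ge_half.
have K2c : K2%:R * ln 2%:R <= c by rewrite cE lerDl mulr_ge0 // ltW.
have K3c : K3%:R * ln 3%:R <= c by rewrite cE lerDr mulr_ge0 // ltW.
have c0 : 0 < c by apply: lt_le_trans K2c; rewrite mulr_gt0 // ltr0n.
have lP0 : 0 <= ln P0%:R :> R by rewrite ln_ge0 // ler1n (leq_trans _ P4).
have m0 : 0 <= m%:R :> R by [].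
have kc0 : 0 <= k%:R * c by apply: mulr_ge0; exact: ltW.
have kceL : 2 * k%:R * c <= e * L by move: s_const m0 lP0 kc0; clear; lra.
have ceL : 4 * c <= e * L / 4.
  have : 2 * c <= k%:R * c by apply: ler_wpM2r => //; exact: ltW.
  by move: s_const m0 lP0; clear; lra.
have meL : 4 * m%:R <= e * L / 2 by move: s_const kc0 lP0; clear; lra.
have PeL : ln P0%:R <= e * L by move: s_const kc0 m0 lP0; clear; lra.
have al''0 : 0 <= (1 - 3 * e) * al' by apply: mulr_ge0 => //; move: e40; clear; lra.
have be''0 : 0 <= (1 - 3 * e) * (1 - al').
  by apply: mulr_ge0; [move: e40; clear; lra|rewrite subr_ge0].
set al2 := (1 - 3 * e) * al' + e.
set be2 := (1 - 3 * e) * (1 - al') + e.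
(* Multiplying by 1 - 3 e and adding e keeps both fractions and both free parts above e. *)
have sum2 : al2 + be2 = 1 - e by rewrite /al2 /be2; ring.
have al2e : e <= al2 by rewrite lerDr.
have be2e : e <= be2 by rewrite lerDr.
have al2L : e * L <= al2 * L by apply: ler_wpM2r => //; exact: ltW.
have be2L : e * L <= be2 * L by apply: ler_wpM2r => //; exact: ltW.
have sum2L : al2 * L + be2 * L = (1 - e) * L by rewrite -mulrDl sum2.
have [m1 [u_hi u_lo]] := @block_length R 2 K2 (al2 * L) c isT K20 (le_trans (ltW eL0) al2L) K2c.
have [m1' [w_hi w_lo]] := @block_length R 3 K3 (be2 * L) c isT K30 (le_trans (ltW eL0) be2L) K3c.
have L1e : e * L <= (1 - e) * L by move: sum2L al2L be2L eL0; clear; lra.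
have [M2 [U2_hi U2_lo]] := @block_length R 2 K2 ((1 - e) * L) c isT K20 (le_trans (ltW eL0) L1e) K2c.
have [M3 [U3_hi U3_lo]] := @block_length R 3 K3 ((1 - e) * L) c isT K30 (le_trans (ltW eL0) L1e) K3c.
have scale2 n : e * L - c <= n%:R * ln 2%:R -> (m <= n)%N /\ (0 < n)%N.
  move=> h; have : n%:R * ln 2%:R <= n%:R :> R by apply: ler_piMr.
  move=> h2; split; last by rewrite -(ltr0n R); move: h h2 ceL c0 eL0; clear; lra.
  by rewrite -(ler_nat R); move: h h2 ceL c0 meL m0 eL0; clear; lra.
have scale3 n : e * L - c <= n%:R * ln 3%:R -> (m <= n)%N /\ (0 < n)%N.
  move=> h; have : n%:R * ln 3%:R <= n%:R * 2 :> R by apply: ler_wpM2l.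
  move=> h2; split; last by rewrite -(ltr0n R); move: h h2 ceL c0 eL0; clear; lra.
  by rewrite -(ler_nat R); move: h h2 ceL c0 meL m0 eL0; clear; lra.
set u := (m1 * K2)%N in u_hi u_lo *; set w := (m1' * K3)%N in w_hi w_lo *.
set U2 := (M2 * K2)%N in U2_hi U2_lo *; set U3 := (M3 * K3)%N in U3_hi U3_lo *.
have [mu u0] := scale2 u ltac:(move: u_lo al2L; clear; lra).
have [mw w0] := scale3 w ltac:(move: w_lo be2L; clear; lra).
have [mU2 U20] := scale2 U2 ltac:(move: U2_lo L1e; clear; lra).
have [mU3 U30] := scale3 U3 ltac:(move: U3_lo L1e; clear; lra).
have wX : (3 ^ w <= X)%N.
  rewrite -(ler_nat R) -expL; apply: expn_le_expR => //.
  by move: w_hi sum2L al2L eL0; clear; lra.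
have [v [v' [wv vw Xz pairs]]] := complementary_lengths X0 wX.
have v_lo : w%:R * ln 3%:R <= v%:R * ln 2%:R :> R.
  by rewrite -!lnX_nat //; apply: ln_power_le => //; rewrite expn_gt0.
have v_hi : v%:R * ln 2%:R <= ln 2%:R + w%:R * ln 3%:R :> R.
  rewrite -!lnX_nat // -lnM ?posrE ?ltr0n ?expn_gt0 // -natrM.
  by apply: ln_power_le => //; rewrite expn_gt0.
have z_lo : L <= w%:R * ln 3%:R + v'%:R * ln 3%:R.
  rewrite -!lnX_nat // -lnM ?posrE ?ltr0n ?expn_gt0 // -natrM.
  by apply: ln_power_le => //; apply: leq_trans Xz; rewrite leq_pmull.
have v'_lo : e * L <= v'%:R * ln 3%:R.
  by move: z_lo w_hi sum2L al2L eL0; clear; lra.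
have [mv v0] := scale2 v ltac:(move: v_lo w_lo be2L; clear; lra).
have [mv' v'0] := scale3 v' ltac:(move: v'_lo c0; clear; lra).
have [r2 R2] := s2 m1 v mu ltac:(by rewrite mv orbT).
have [r3 R3] := s3 m1' v' mw ltac:(by rewrite mv' orbT).
have [y2 Y2] := s2 M2 0%N mU2 isT.
have [y3 Y3] := s3 M3 0%N mU3 isT.
have d1 : d < 1 by move: de e40; clear; lra.
have r20 := rich_residue_gt0 (q := 2) d1 isT u0 R2; have r30 := rich_residue_gt0 (q := 3) d1 isT w0 R3.
have y20 := rich_residue_gt0 (q := 2) d1 isT U20 Y2; have y30 := rich_residue_gt0 (q := 3) d1 isT U30 Y3.
have /andP[t0 t2] : 0 <= t <= 2 by rewrite tE; exact: third_bound.
have t34 : 3 / 4 <= t.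
  have l12 := ln_nat_gt0 R (isT : (1 < 12)%N).
  by rewrite tE ler_pdivlMr // ln12E; move: l2hi l3hi; clear; lra.
pose x := (k%:R - 1) * t * L - 20 * k%:R * e * L.
have kL0 : 0 < k%:R * L by apply: mulr_gt0.
have xE : x = (k%:R - 1) * t * L - eps / 5 * L by rewrite /x -eke; field.
have x0 : 0 <= x.
  rewrite xE -mulrBl; apply: mulr_ge0; last exact: ltW.
  have : 1 * (3 / 4) <= (k%:R - 1) * t by apply: ler_pM => //; move: k2; clear; lra.
  by move: eps1; clear; lra.
have x_hi : x <= 2 * k%:R * L.
  have : (k%:R - 1) * t * L <= k%:R * 2 * L.
    apply: ler_wpM2r; first exact: ltW.
    by apply: ler_pM => //; move: k2; clear; lra.
  have : 0 <= eps * L by apply: mulr_ge0; exact: ltW.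
  by rewrite xE; clear; lra.
have [D [Dx xD]] := truncn_multiple ltr01 x0; rewrite mulr1 in Dx xD.
have D_hi : D%:R <= 2 * k%:R * L by apply: le_trans x_hi.
exists D; split; first by move: xD; rewrite -/x; clear; lra.
have L2 : 2 <= L by move: L64; clear; lra.
have [y [y_lo y_hi y_ln]] := middle_cutoff X0 L2.
rewrite -/L in y_lo y_hi y_ln.
have k1 : 1 <= k%:R :> R by move: k2; clear; lra.
have yD' : 4 * k%:R * L <= y%:R.
  have h1 : L ^+ 4 = L * L * (L * L) by rewrite !exprS expr0; ring.
  have h2 : 64 * k%:R * L <= L * L * (L * L).
    apply: ler_pM => //; rewrite ?mulr_ge0 ?(ltW L0) //.
      apply: le_trans (_ : 2 * L <= _); first by move: s_ge; clear; lra.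
      by apply: ler_wpM2r; [exact: ltW|move: L64; clear; lra].
    by apply: ler_peMl => //; exact: ltW.
  by move: y_lo h2; rewrite h1; clear; lra.
have yD : (D <= y)%N by rewrite -(ler_nat R); move: D_hi yD' kL0; clear; lra.
have y3' : (3 <= y)%N.
  rewrite -(ler_nat R); apply: le_trans yD'; rewrite -mulrA.
  have : 1 * 1 <= k%:R * L by apply: ler_pM.
  by clear; lra.
have y0 : (0 < y)%N by apply: leq_trans y3'.
have Dexp : D.+1%:R <= expR (e / 4 * L).
  apply: le_trans s_exp; rewrite -natr1.
  have : 1 * 1 <= k%:R * L by apply: ler_pM.
  by move: D_hi; clear; lra.
have e4L : e / 4 * L <= e * L / 4 by rewrite le_eqVlt; apply/orP; left; apply/eqP; ring.
have DX : (D < X)%N.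
  rewrite -(ler_nat R) -expL; apply: le_trans Dexp _; rewrite ler_expR.
  by apply: ler_piMl; [exact: ltW|move: e40; clear; lra].
have Dr2 : (D <= r2)%N.
  case: R2 => _ h _; rewrite -ltnS -(ler_nat R); apply: le_trans Dexp _.
  apply: le_trans (_ : (2 ^ digit_sum 2 r2)%:R <= _); last by rewrite ler_nat digit_sum2_expn.
  apply: expR_le_expn => //; rewrite mul1n -/u in h.
  have h1 := ler_wpM2r (ltW l2) h.
  have h2 : 1 / 2 * (u%:R * ln 2%:R) <= (1 - d) * (u%:R * ln 2%:R).
    by apply: ler_wpM2r; [rewrite mulr_ge0 // ltW|move: de e40; clear; lra].
  move: h1 h2 u_lo al2L ceL c0 e4L eL0; clear; lra.
have yv' : (y <= 3 ^ v')%N.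
  rewrite -(ler_nat R); apply: le_trans y_hi _; apply: le_trans s_pow4 _.
  by apply: expR_le_expn.
pose LB p := half_rate R p * (1 - 2 * d) * ((u + v)%:R * ln 2%:R + (p == 2%N)%:R * (u%:R * ln 2%:R)).
pose LA p := half_rate R p * (1 - 2 * d) * ((w + v')%:R * ln 3%:R + (p == 3%N)%:R * (w%:R * ln 3%:R)).
pose UN p := half_rate R p * (1 + 2 * d) * (L + ln p%:R).
pose Z := minn (3 ^ w) (3 ^ v').
have Z0 : (0 < Z)%N by rewrite leq_min !expn_gt0.
have lnZ : e * L - c <= ln Z%:R.
  rewrite /Z; case: leqP => _; rewrite lnX_nat //.
    by move: w_lo be2L; clear; lra.
  by move: v'_lo c0; clear; lra.
pose J p := (trunc_log p Z %/ 12)%N.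
pose X1 := (sumn (nseq A y2 ++ nseq B y3) + (r2 + r3) + 2 ^ u * 3 ^ w)%N.
have lnL0 : 0 <= ln L by apply: ln_ge0.
have C10 : 0 <= ln (8 / e1).
  have e11 : e1 <= 1.
    have : 1 * e1 <= 100 * P0.+1%:R * e1.
      by apply: ler_wpM2r; [exact: ltW|rewrite -natrM ler1n muln_gt0].
    by rewrite eP; move: eps1; clear; lra.
  by rewrite ln_ge0 // ler_pdivlMr // mul1r (le_trans e11) // ler1n.
have budget p : prime p -> (p <= P0)%N ->
   D%:R + UN p <= (\sum_(z <- nseq A y2 ++ nseq B y3) digit_sum p z)%:R + LA p + LB p.
  move=> pp pP; rewrite big_cat !big_nseq !iter_addn !addn0 natrD !natrM.
  have b2 := rich_residue_alone d1 Y2 pp pP; have b3 := rich_residue_alone d1 Y3 pp pP.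
  rewrite -/U2 in b2; rewrite -/U3 in b3.
  have lpL : ln p%:R <= e * L by apply: le_trans PeL; apply: ln_power_le => //; exact: prime_gt0.
  have hpl : (1 - e) * L - 2 * c <= (u + v)%:R * ln 2%:R.
    by rewrite natrD; move: u_lo v_lo w_lo sum2L; clear; lra.
  have hql : L <= (w + v')%:R * ln 3%:R by rewrite natrD mulrDl.
  have := digit_budget pp tE alE kAB e0 (le_trans e40 _) d0 de L0 (ltW c0) kceL al'0 al'1 kal lpL
    U2_lo U3_lo u_lo w_lo hpl hql Dx.
  have -> : 1 / 200 <= 1 / 40 :> R by clear; lra.
  move=> /(_ isT) h; apply: le_trans h _; rewrite /LA /LB.
  have := ler_wpM2r (ler0n R A) b2; have := ler_wpM2r (ler0n R B) b3.
  set H := half_rate R p * (1 - 2 * d); clear.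
  move: ((1 + _) * (U2%:R * _)) ((1 + _) * (U3%:R * _)) ((w + v')%:R * _ + _) ((u + v)%:R * _ + _).
  by move=> *; lra.
have early : X1%:R <= eps / 10 * X%:R.
  pose E := expR ((1 - e) * L).
  have E0 : 0 < E by apply: expR_gt0.
  have XE : expR (e * L) * E = X%:R by rewrite -expRD -expL; congr expR; ring.
  have hy2 : y2%:R <= E.
    case: Y2 => h _ _; apply: le_trans (_ : (2 ^ U2)%:R <= _); first by rewrite ler_nat ltnW.
    exact: expn_le_expR.
  have hy3 : y3%:R <= E.
    case: Y3 => h _ _; apply: le_trans (_ : (3 ^ U3)%:R <= _); first by rewrite ler_nat ltnW.
    exact: expn_le_expR.
  have hr2 : r2%:R <= E.
    case: R2 => h _ _; apply: le_trans (_ : (2 ^ u)%:R <= _); first by rewrite ler_nat ltnW.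
    by apply: expn_le_expR => //; move: u_hi sum2L be2L eL0; clear; lra.
  have hr3 : r3%:R <= E.
    case: R3 => h _ _; apply: le_trans (_ : (3 ^ w)%:R <= _); first by rewrite ler_nat ltnW.
    by apply: expn_le_expR => //; move: w_hi sum2L al2L eL0; clear; lra.
  have hprod : (2 ^ u)%:R * (3 ^ w)%:R <= E.
    apply: le_trans (_ : expR (al2 * L) * expR (be2 * L) <= _).
      by apply: ler_pM => //; exact: expn_le_expR.
    by rewrite -expRD sum2L.
  have X1E : X1%:R <= (k%:R + 1) * E.
    have kE : k%:R = A%:R + B%:R + 2 :> R by rewrite kAB -addn2 !natrD.
    rewrite /X1 sumn_cat !sumn_nseq !natrD !natrM kE.
    have := ler_wpM2r (ler0n R A) hy2; have := ler_wpM2r (ler0n R B) hy3.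
    by move: hr2 hr3 hprod; move: (A%:R) (B%:R) => a b; clear; lra.
  move: s_first; rewrite ler_pdivrMr // => s_first.
  have := ler_wpM2r (ltW E0) s_first; rewrite [expR _ * eps * E]mulrAC XE.
  by move: X1E; clear; lra.
have Xr0 : 0 < X%:R :> R by rewrite ltr0n.
have wide := prime_power_error X0 y0 L1 eps0 D_hi y_lo y_hi s_lin1 ltac:(by rewrite -expL).
have uv : (u + v)%:R <= 5 * L.
  have h1 : (u + v)%:R * (1 / 2) <= (u + v)%:R * ln 2%:R :> R by apply: ler_wpM2l.
  rewrite natrD in h1 *.
  by move: h1 u_hi v_hi w_hi sum2L eL0 l2hi L64; clear; lra.
have far := large_prime_error X0 y0 L1 eps0 D_hi y_lo yv' uv pairs s_lin2.
apply: le_trans (@main_count R k X X1 D y P0 u w v v' r2 r3 (nseq A y2 ++ nseq B y3) LA LB UN J e1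
  _ _ _ _ _ _ _ _ _ _ _ _ _ _ _ _ _ _) _ => //.
- by rewrite size_cat !size_nseq -kAB.
- by rewrite all_cat !all_nseq y20 y30 !orbT.
- by rewrite addn_gt0 addnA addn_gt0 r30 !orbT.
- by rewrite r20; case: R2.
- by apply: leq_trans Xz; rewrite mul2n -addnn ltn_add2l.
- exact: ltW.
- move=> p pp pP; case: R2 => _ _ h; apply: le_trans (h p pp pP) _.
  exact: ler_wpM2r.
- move=> p pp pP; case: R3 => _ _ h; apply: le_trans (h p pp pP) _.
  exact: ler_wpM2r.
- move=> p pp Pp py.
  have g1 : 1 <= 1 + ln L by rewrite lerDl.
  have ly0 : 0 <= ln y%:R :> R by rewrite ln_ge0 // ler1n.
  have gg : 1 + ln L <= (1 + ln L) ^+ 2 by rewrite expr2; apply: ler_peMr => //; apply: addr_ge0.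
  have Cg : 0 <= ln (8 / e1) * (1 + ln L) ^+ 2 by apply: mulr_ge0 => //; apply: exprn_ge0; exact: addr_ge0.
  have hA : 36 * ln y%:R + c <= e * L / 2.
    by move: s_ln y_ln g1 gg Cg ceL c0 eL0; clear; lra.
  have hB : 12 * (ln y%:R * (ln y%:R + ln (8 / e1) + 1)) + c <= e * L.
    have : ln y%:R * (ln y%:R + ln (8 / e1) + 1) <=
      4 * (1 + ln L) * (4 * (1 + ln L) + ln (8 / e1) * (1 + ln L) + (1 + ln L)).
      apply: ler_pM => //; first by rewrite !addr_ge0.
      by rewrite !lerD // ler_peMr.
    by move: s_ln ceL c0 eL0; rewrite expr2; clear; lra.
  have [h1 h2 h3] := middle_prime pp py y3' Z0 L0 e10 (hP p pp Pp) D_hi lnZ hA hB.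
  split => //.
    by apply: leq_trans h1 _; apply: leq_trans wv; rewrite geq_minl.
  by apply: leq_trans h1 _; rewrite geq_minr.
have T2 : P0.+1%:R * e1 * X.+1%:R <= eps / 50 * X%:R.
  have hX : X.+1%:R <= 2 * X%:R :> R by rewrite -natrM ler_nat mul2n -addnn -addn1 leq_add2l.
  have PE : P0.+1%:R * e1 = eps / 100 by rewrite -eP; field.
  by rewrite PE; have := ler_wpM2l (ltW eps0) hX; clear; lra.
have T4 : (2 * P0.+1%:R + 1) * e1 * (2 ^ v * 3 ^ v')%:R <= 9 * eps / 25 * X%:R.
  have hp : (2 ^ v * 3 ^ v')%:R <= 12 * X%:R :> R by rewrite -natrM ler_nat.
  apply: le_trans (_ : 3 * P0.+1%:R * e1 * (12 * X%:R) <= _).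
    apply: ler_pM => //; first by apply: mulr_ge0; [|exact: ltW]; rewrite addr_ge0 // mulr_ge0.
    apply: ler_wpM2r; first exact: ltW.
    by have : 1 <= P0.+1%:R :> R; [rewrite ler1n|clear; lra].
  by rewrite -eP le_eqVlt; apply/orP; left; apply/eqP; field.
have eX : 0 <= eps * X%:R by apply: mulr_ge0; exact: ltW.
by move: early wide far T2 T4 eX; clear; lra.
Qed.

Lemma ln_small_primes (R : realType) (k : nat) (e : R) : 0 < e -> exists P0 : nat,
  (4 <= P0)%N /\ forall p : nat, (P0 < p)%N -> 48 * k%:R * ln p%:R <= e * p.-1%:R.
Proof.
move=> e0; have [x0 [_ h]] := @ln_sq_le R (e / 2) (48 * k%:R) ltac:(by rewrite divr_gt0) ltac:(by rewrite mulr_ge0).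
have [N [N0 hN]] := exists_nat_ge x0; exists (maxn 4 N); split; first exact: leq_maxl.
move=> p; rewrite gtn_max => /andP[p4 pN].
have p1 : (1 < p)%N by apply: leq_trans p4.
have lp := ln_nat_gt0 R p1.
have := h p%:R (le_trans hN _); rewrite ler_nat (ltnW pN) => /(_ isT).
have h1 : ln p%:R <= (1 + ln p%:R) ^+ 2 :> R by move: lp; rewrite expr2; clear; nra.
have h2 := ler_wpM2l (ltac:(by rewrite mulr_ge0) : 0 <= 48 * k%:R :> R) h1.
have hp : p%:R <= 2 * p.-1%:R :> R by rewrite -natrM ler_nat; move: p1; clear; lia.
have := ler_wpM2l (ltW e0) hp.
by move: h2; clear; lra.
Qed.

(** The [k - 2] fixed numbers absorb the integral part of the binary share
[(k - 1) al] and of the ternary one, the pair absorbs the fractional parts. *)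
Lemma g_ge_most (R : realType) (k : nat) (eps : R) : (2 <= k)%N -> 0 < eps -> eps <= 1 ->
  exists X0 : nat, forall X, (X0 <= X)%N -> (0 < X)%N -> exists D : nat,
    (k%:R - 1) * (3 / ln 12) * ln X%:R - eps * ln X%:R - 1 <= D%:R /\
    (\sum_(0 <= n < X.+1) ~~ (D%:Z <= g k n)%R)%:R <= eps * X%:R.
Proof.
move=> k2 eps0 eps1; pose t : R := 3 / ln 12; pose al := 2 * t * ln 2 - 1.
have [al0 be0 _] := @log_shares R t al erefl erefl.
have kr2 : 2 <= k%:R :> R by rewrite ler_nat.
have kr0 : 0 < k%:R :> R by apply: lt_le_trans kr2.
have kr1 : 0 < k%:R - 1 :> R by move: kr2; clear; lra.
have kal0 : 0 <= (k%:R - 1) * al by apply: mulr_ge0 => //; exact: ltW.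
pose A := Num.truncn ((k%:R - 1) * al).
have /andP[Alo Ahi] := truncn_itv kal0; rewrite -/A in Alo Ahi.
have Ak : (A.+2 <= k)%N.
  have : A%:R < (k.-1)%:R :> R.
    apply: le_lt_trans Alo _; rewrite -subn1 natrB ?(ltnW k2) //.
    by rewrite gtr_pMr //; move: be0; clear; lra.
  by rewrite ltr_nat; move: k2; clear; lia.
pose B := (k - A.+2)%N; have kAB : k = (A + B).+2 by rewrite /B; move: Ak; clear; lia.
pose al' := (k%:R - 1) * al - A%:R.
have al'0 : 0 <= al' by rewrite subr_ge0.
have al'1 : al' <= 1 by rewrite lerBlDl natr1 ltW.
pose e := eps / (100 * k%:R).
have e0 : 0 < e by rewrite divr_gt0 // mulr_gt0.
have [P0 [P4 hP]] := @ln_small_primes R k e e0.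
pose e1 := eps / (100 * P0.+1%:R).
have e10 : 0 < e1 by rewrite divr_gt0 // mulr_gt0.
have e11 : e1 <= 1.
  rewrite ler_pdivrMr ?mulr_gt0 // mul1r; apply: le_trans eps1 _.
  by rewrite -natrM ler1n muln_gt0.
have e2 : e <= 1 / 2.
  rewrite ler_pdivrMr ?mulr_gt0 //; apply: le_trans eps1 _; move: kr2; clear; lra.
pose d := Num.min e e1.
have d0 : 0 < d by rewrite lt_min e0 e10.
have de : d <= e by rewrite ge_min lexx.
have de1 : d <= e1 by rewrite ge_min lexx orbT.
have [K2 [m2 [K20 s2]]] := @rich_residue_exists R 2 P0 d isT d0 (le_trans de e2).
have [K3 [m3 [K30 s3]]] := @rich_residue_exists R 3 P0 d isT d0 (le_trans de e2).
have [X2 hN] := @typical_upper R P0 d e1 d0 e10.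
pose c : R := K2%:R * ln 2%:R + K3%:R * ln 3%:R.
have [L0 sc] := @large_scale_eventually R k P0 eps e e1 c (maxn m2 m3)%:R eps0 e0 e10 e11.
have [N [N0 NL]] := exists_nat_ge (expR L0).
exists (maxn X2 N) => X; rewrite geq_max => /andP[X2X NX] X0.
have L0X : L0 <= ln X%:R.
  rewrite -(expRK L0) ler_ln ?posrE ?expR_gt0 ?ltr0n //; apply: le_trans NL _.
  by rewrite ler_nat.
have [||D [D1 D2]] := g_ge_most_at (erefl t) (erefl al) kAB eps0 eps1 (erefl e) P4 (erefl e1) d0 de de1
  al'0 al'1 (esym (subrKC _ _)) (fun p _ => hP p) K20 K30 (erefl c) _ _ X0 (fun p => hN X p X2X) (sc _ L0X).
- move=> m1 v; rewrite !geq_max => /andP[h _] h2; apply: s2 => //.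
  by case/orP: h2 => [->//|/andP[->]]; rewrite orbT.
- move=> m1 v; rewrite !geq_max => /andP[_ h] h2; apply: s3 => //.
  by case/orP: h2 => [->//|/andP[_ ->]]; rewrite orbT.
exists D; split => //; apply: le_trans D1; rewrite lerD2r lerD2l lerN2; apply: ler_wpM2r.
  by apply: ln_ge0; rewrite ler1n.
have -> : 20 * k%:R * e = eps / 5 by rewrite /e; field; exact: lt0r_neq0.
by move: eps0; clear; lra.
Qed.

(** * No integer has a larger excess than its binary carries allow *)

Lemma digit_sum2_sum_carries (l : nat) (s : seq nat) : (sumn s < 2 ^ l)%N ->
  (\sum_(x <- s) digit_sum 2 x <= digit_sum 2 (sumn s) + (size s).-1 * l)%N.
Proof.
elim: s => [|a [|b s] IH] h; first by rewrite big_nil.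
  by rewrite big_cons big_nil /= !addn0.
rewrite big_cons; have h2 : (sumn (b :: s) < 2 ^ l)%N by apply: leq_ltn_trans h; rewrite [leqRHS]/= leq_addl.
have := IH h2; have := @digit_sum2_carries l a (sumn (b :: s)) false; rewrite !addn0 => /(_ h).
rewrite [size _]/= [size _]/= -[(size s).+2.-1]/(size s).+1 -[(size s).+1.-1]/(size s) mulSn.
rewrite -[sumn (a :: _)]/(a + sumn (b :: s))%N; clear; lia.
Qed.

(** Legendre's formula at [p = 2] gives [digit_sum 2 n + D] as a lower bound for the sum
of the digit sums; carries give an upper one. *)
Lemma excess_carries (s : seq nat) (n D l : nat) : (\prod_(x <- s) x`! %| n`!)%N ->
  sumn s = (n + D)%N -> (n + D < 2 ^ l)%N -> (D <= digit_sum 2 D + (size s).-1 * l)%N.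
Proof.
move=> dv sE nl.
have h1 : (\sum_(x <- s) logn 2 x`! <= logn 2 n`!)%N.
  by rewrite -logn_prod_fact; apply: dvdn_leq_log => //; exact: fact_gt0.
have h2 : (\sum_(x <- s) logn 2 x`! + \sum_(x <- s) digit_sum 2 x = n + D)%N.
  rewrite -sE -big_split sumnE; apply: eq_bigr => x _.
  by have := logn_fact_legendre x (isT : prime 2); rewrite mul1n.
have h3 := logn_fact_legendre n (isT : prime 2); rewrite mul1n in h3.
have h4 := @digit_sum2_sum_carries l s; rewrite sE in h4; have {}h4 := h4 nl.
have := @digit_sumD 2 n D isT.
move: h1 h2 h3 h4; clear; lia.
Qed.

Lemma ln_le_linear (R : realType) (a : R) : 0 < a -> exists C : R, 0 <= C /\
  forall x, 0 < x -> ln x <= a * x + C.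
Proof.
move=> a0; exists `|ln a|; split => // x x0.
have := @ln_le_subr1 R (a * x) (mulr_gt0 a0 x0); rewrite lnM ?posrE //.
by have := ler_norm (- ln a); rewrite normrN; clear; lra.
Qed.

(** The excess [D] is at most [k - 1] binary lengths of [n + D], up to [O(ln D)], which
is absorbed by the factor [1 - a] and the constant. *)
Lemma g_upper (R : realType) (k : nat) (a : R) : (0 < k)%N -> 0 < a -> exists C : R, 0 <= C /\
  forall n, (0 < n)%N -> (1 - a) * (g k n)%:~R <= (k%:R - 1) / ln 2 * ln n%:R + C.
Proof.
move=> k0 a0; have l2 := ln_nat_gt0 R (isT : (1 < 2)%N).
have kr0 : 0 < k%:R :> R by rewrite ltr0n.
have [C [C0 hC]] := @ln_le_linear R (a * ln 2 / k%:R) ltac:(by rewrite divr_gt0 // mulr_gt0).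
exists (k%:R / ln 2 * C + a + k%:R); split.
  by rewrite addr_ge0 // addr_ge0 ?(ltW a0) // mulr_ge0 // divr_ge0 // ltW.
move=> n n0; have gn := g_ge0 k0 n0; have [b [/andP[_ adv] gE]] := @g_attained k n n0.
pose s := [seq b i | i <- enum 'I_k].
have sS : (\sum_(i < k) b i)%N = sumn s by rewrite sumnE big_map big_enum.
have sP : (\prod_(x <- s) x`! %| n`!)%N by rewrite big_map big_enum.
have sk : size s = k by rewrite size_map size_enum_ord.
have nS : (n <= sumn s)%N by move: gn; rewrite gE sS subr_ge0 lez_nat.
pose D := (sumn s - n)%N; have SD : sumn s = (n + D)%N by rewrite subnKC.
have -> : (g k n)%:~R = D%:R :> R.
  by rewrite gE sS SD PoszD addrAC subrr add0r.
have nD0 : (0 < n + D)%N by rewrite addn_gt0 n0.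
have h := excess_carries sP SD (trunc_log_ltn (n + D) (isT : (1 < 2)%N)); rewrite sk in h.
have h1 : (digit_sum 2 D)%:R * ln 2%:R <= ln D.+1%:R :> R.
  by rewrite -lnX_nat //; apply: ln_power_le; rewrite ?expn_gt0 // digit_sum2_expn.
have h2 : (trunc_log 2 (n + D))%:R * ln 2%:R <= ln n%:R + ln D.+1%:R :> R.
  apply: le_trans (trunc_log_le R (isT : (1 < 2)%N) nD0) _.
  rewrite -lnM ?posrE ?ltr0n // -natrM; apply: ln_power_le => //.
  by rewrite mulnS leq_add2l leq_pmull.
have h3 := hC D.+1%:R ltac:(by rewrite ltr0n).
have h4 : D%:R * ln 2 <= k%:R * ln D.+1%:R + (k%:R - 1) * ln n%:R + k%:R * ln 2 :> R.
  have hk : k%:R = k.-1%:R + 1 :> R by rewrite natr1 prednK.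
  move: h; rewrite -(ler_nat R) natrD natrM -natr1 => /(ler_wpM2r (ltW l2)).
  have := ler_wpM2l (ler0n R k.-1) h2; rewrite hk.
  by move: h1 l2; move: (k.-1)%:R => q; clear; lra.
have h5 := ler_wpM2l (ltW kr0) h3.
have E : k%:R * (a * ln 2 / k%:R * D.+1%:R + C) = a * ln 2 * (D%:R + 1) + k%:R * C.
  by rewrite -natr1; field; exact: lt0r_neq0.
rewrite -(ler_pM2r l2).
have -> : ((k%:R - 1) / ln 2 * ln n%:R + (k%:R / ln 2 * C + a + k%:R)) * ln 2
  = (k%:R - 1) * ln n%:R + k%:R * C + a * ln 2 + k%:R * ln 2 :> R.
  by field; exact: lt0r_neq0.
by move: h4 h5; rewrite E; clear; lra.
Qed.

(** * Averages *)

Lemma limf_einf_ge (R : realType) (f : R -> R) (c : R) :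
  (forall eta, 0 < eta -> exists x0, forall x, x0 <= x -> c - eta <= f x) ->
  (c%:E <= limf_einf (fun x => (f x)%:E) (pinfty_nbhs R))%E.
Proof.
move=> h; rewrite limf_einfE; apply/lee_subgt0Pr => eta eta0.
have [x0 hx] := h eta eta0.
apply: (@le_trans _ _ (ereal_inf ((fun x => (f x)%:E) @` [set x | x0 < x]%classic))); last first.
  by apply: ereal_sup_ubound; exists [set x | x0 < x]%classic => //; exists x0; split => //; exact: num_real.
apply: le_ereal_inf_tmp => _ [x /= xx0 <-]; rewrite -EFinB lee_fin; apply: hx; exact: ltW.
Qed.

Lemma limf_esup_le (R : realType) (f : R -> R) (c : R) :
  (forall eta, 0 < eta -> exists x0, forall x, x0 <= x -> f x <= c + eta) ->
  (limf_esup (fun x => (f x)%:E) (pinfty_nbhs R) <= c%:E)%E.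
Proof.
move=> h; rewrite limf_esupE; apply/lee_addgt0Pr => eta eta0.
have [x0 hx] := h eta eta0.
apply: (@le_trans _ _ (ereal_sup ((fun x => (f x)%:E) @` [set x | x0 < x]%classic))).
  by apply: ereal_inf_lbound; exists [set x | x0 < x]%classic => //; exists x0; split => //; exact: num_real.
apply: ge_ereal_sup => _ [x /= xx0 <-]; rewrite -EFinD lee_fin; apply: hx; exact: ltW.
Qed.

Lemma limf_einf_le_esup (R : realType) (f : R -> \bar R) :
  (limf_einf f (pinfty_nbhs R) <= limf_esup f (pinfty_nbhs R))%E.
Proof.
rewrite limf_einfE limf_esupE; apply: ge_ereal_sup => _ [V [M [_ MV]] <-].
apply: le_ereal_inf_tmp => _ [W [N [_ NW]] <-].
pose x := `|M| + `|N| + 1.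
have Mx : M < x by rewrite /x; have := ler_norm M; have := normr_ge0 N; clear; lra.
have Nx : N < x by rewrite /x; have := ler_norm N; have := normr_ge0 M; clear; lra.
apply: (@le_trans _ _ (f x)).
  by apply: ereal_inf_lbound; exists x => //; exact: MV.
by apply: ereal_sup_ubound; exists x => //; exact: NW.
Qed.

(** The exceptional [n] contribute nonnegative terms. *)
Lemma sum_g_ge (R : realType) (k N D : nat) : (0 < k)%N ->
  D%:R * (N%:R - (\sum_(0 <= n < N.+1) ~~ (D%:Z <= g k n)%R)%:R) <=
  \sum_(1 <= n < N.+1) (g k n)%:~R :> R.
Proof.
move=> k0; have h : D%:R * \sum_(1 <= n < N.+1) (1 - (~~ (D%:Z <= g k n)%R)%:R) <=
  \sum_(1 <= n < N.+1) (g k n)%:~R :> R.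
  rewrite mulr_sumr big_nat_cond [leRHS]big_nat_cond; apply: ler_sum => n /andP[/andP[n0 _] _].
  case: (boolP (D%:Z <= g k n)%R) => hD /=; last first.
    by rewrite subrr mulr0 ler0z g_ge0.
  by rewrite subr0 mulr1 -[D%:R]/(D%:Z%:~R) ler_int.
apply: le_trans h; apply: ler_wpM2l => //.
rewrite sumrB big_const_nat subSS subn0 iter_addr addr0 lerD2l lerN2.
rewrite -natr_sum ler_nat (@big_ltn _ _ _ 0) //; exact: leq_addl.
Qed.

Lemma truncn_ln (R : realType) (x : R) : 2 <= x ->
  [/\ (0 < Num.truncn x)%N, x - 1 <= (Num.truncn x)%:R, (Num.truncn x)%:R <= x &
      ln x - 1 <= ln (Num.truncn x)%:R].
Proof.
move=> x2; have x0 : 0 <= x by apply: le_trans x2.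
have /andP[h1 h2] := truncn_itv x0; rewrite -natr1 in h2.
have h3 : x - 1 <= (Num.truncn x)%:R by move: h2; clear; lra.
have N0 : (0 < Num.truncn x)%N by rewrite -(ltr0n R); move: h3 x2; clear; lra.
split => //; have xp : 0 < x by apply: lt_le_trans x2.
have : ln x <= ln (2 * (Num.truncn x)%:R).
  by rewrite ler_ln ?posrE ?mulr_gt0 ?ltr0n //; move: h3 x2; clear; lra.
rewrite lnM ?posrE ?ltr0n //; have /andP[_] := ln2_bounds R; clear; lra.
Qed.

Lemma ln_eventually (R : realType) (a C : R) : 0 < a ->
  exists x0 : R, forall x, x0 <= x -> [/\ 2 <= x, 1 <= ln x & C <= a * ln x].
Proof.
move=> a0; exists (expR (`|C / a| + 2)) => x hx.
have x0 : 0 < x by apply: lt_le_trans hx; exact: expR_gt0.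
have lx : `|C / a| + 2 <= ln x by rewrite -[leLHS]expRK ler_ln ?posrE ?expR_gt0.
have n0 := normr_ge0 (C / a); have n1 := ler_norm (C / a).
split.
- apply: le_trans hx; apply: le_trans (expR_ge1Dx _); move: n0; clear; lra.
- by move: n0 lx; clear; lra.
by rewrite mulrC -ler_pdivrMr //; move: n0 n1 lx; clear; lra.
Qed.

Lemma normalized_sum_lower (R : realType) (k : nat) (eta : R) : (2 <= k)%N -> 0 < eta ->
  exists x0 : R, forall x, x0 <= x -> 3 * (k%:R - 1) / ln 12 - eta <= normalized_sum k x.
Proof.
move=> k2 eta0; pose c : R := (k%:R - 1) * (3 / ln 12).
have -> : 3 * (k%:R - 1) / ln 12 = c by rewrite /c mulrA [3 * _]mulrC.
have k1 : 0 <= k%:R - 1 :> R by rewrite subr_ge0 ler1n ltnW.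
have c0 : 0 <= c by apply: mulr_ge0 => //; have /andP[] := third_bound R.
pose eps := Num.min (1 / 4) (eta / (4 * (c + 1))).
have eps0 : 0 < eps by rewrite lt_min !divr_gt0 // mulr_gt0 // ltr_wpDl.
have eps4 : eps <= 1 / 4 by rewrite ge_min lexx.
have epsc : 4 * (c + 1) * eps <= eta.
  have : eps <= eta / (4 * (c + 1)) by rewrite ge_min lexx orbT.
  by rewrite ler_pdivlMr ?mulr_gt0 ?ltr_wpDl // mulrC.
have [X0 h] := @g_ge_most R k eps k2 eps0 ltac:(move: eps4; clear; lra).
have [N0 [_ hN0]] := exists_nat_ge (X0%:R + 1 + eps^-1 : R).
have [x1 hx1] := @ln_eventually R eps (c + 1) eps0.
exists (Num.max N0%:R x1) => x; rewrite ge_max => /andP[hxN hxx].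
have [x2 lx1 lxc] := hx1 x hxx.
have [N_gt0 N_lo N_hi lnN] := truncn_ln x2.
have xX : X0%:R + 1 + eps^-1 <= x by apply: le_trans hxN.
have ei0 : 0 < eps^-1 by rewrite invr_gt0.
have XN : (X0 <= Num.truncn x)%N.
  by rewrite -(ler_nat R); move: xX N_lo ei0; clear; lra.
have [D [D1 D2]] := h _ XN N_gt0.
have S := @sum_g_ge R k (Num.truncn x) D (ltnW k2).
rewrite /normalized_sum.
set N : R := (Num.truncn x)%:R in N_lo N_hi lnN D1 D2 S *.
set T := \sum_(1 <= n < _) _ in S *.
have xp : 0 < x by apply: lt_le_trans x2.
have lxp : 0 < ln x by apply: lt_le_trans lx1.
rewrite mulrC ler_pdivlMr ?mulr_gt0 //.
apply: le_trans S.
have Nx : (1 - eps) * x <= N.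
  have : eps * eps^-1 <= eps * x.
    by apply: ler_wpM2l; [exact: ltW|move: xX (ler0n R X0); clear; lra].
  by rewrite divff ?lt0r_neq0 //; move: N_lo; clear; lra.
have N0' : 0 <= N by [].
have bad : (1 - eps) * ((1 - eps) * x) <= N - (\sum_(0 <= n < (Num.truncn x).+1) ~~ (D%:Z <= g k n)%R)%:R.
  apply: le_trans (_ : (1 - eps) * N <= _); last by move: D2; clear; lra.
  by apply: ler_wpM2l => //; move: eps4; clear; lra.
have lnN0 : 0 <= ln N by apply: ln_ge0; rewrite ler1n.
have Dlow : (c - 2 * eps) * ln x <= D%:R.
  rewrite -/c in D1; apply: le_trans D1.
  have lnx : ln N <= ln x by rewrite ler_ln ?posrE ?ltr0n.
  have h1 := ler_wpM2l c0 lnN; have h2 := ler_wpM2l (ltW eps0) lnx.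
  by move: h1 h2 lxc; clear; lra.
have sq : (1 - 2 * eps) * x <= (1 - eps) * ((1 - eps) * x).
  by rewrite mulrA; apply: ler_wpM2r; [exact: ltW|clear; nra].
have eps2 : 0 <= 1 - 2 * eps by move: eps4; clear; lra.
have ce : 0 <= c * eps by apply: mulr_ge0 => //; exact: ltW.
have [neg|pos] := lerP (c - eta) 0.
  apply: le_trans (_ : 0 <= _); first by apply: mulr_le0_ge0 => //; apply: mulr_ge0; exact: ltW.
  apply: mulr_ge0 => //; apply: le_trans bad; apply: le_trans sq.
  by apply: mulr_ge0 => //; exact: ltW.
apply: le_trans (_ : (c - 2 * eps) * ln x * ((1 - 2 * eps) * x) <= _); last first.
  apply: ler_pM => //; last exact: le_trans sq bad.
    by apply: mulr_ge0; [move: pos epsc ce eps0; clear; lra|exact: ltW].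
  by apply: mulr_ge0 => //; exact: ltW.
rewrite [leRHS](_ : _ = (c - 2 * eps) * (1 - 2 * eps) * (x * ln x)); last by ring.
apply: ler_wpM2r; first by apply: mulr_ge0; exact: ltW.
by move: epsc ce eps0 (mulr_ge0 (ltW eps0) (ltW eps0)); clear; lra.
Qed.

Lemma normalized_sum_upper (R : realType) (k : nat) (eta : R) : (2 <= k)%N -> 0 < eta ->
  exists x0 : R, forall x, x0 <= x -> normalized_sum k x <= (k%:R - 1) / ln 2 + eta.
Proof.
move=> k2 eta0; pose c : R := (k%:R - 1) / ln 2.
have k1 : 0 <= k%:R - 1 :> R by rewrite subr_ge0 ler1n ltnW.
have l2 := ln_nat_gt0 R (isT : (1 < 2)%N).
have c0 : 0 <= c by apply: divr_ge0 => //; exact: ltW.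
pose a := eta / (2 * (c + eta)).
have ce0 : 0 < c + eta by rewrite ltr_wpDl.
have a0 : 0 < a by rewrite divr_gt0 // mulr_gt0.
have aE : a * (c + eta) = eta / 2 by rewrite /a; field; exact: lt0r_neq0.
have a1 : a < 1.
  by rewrite ltr_pdivrMr ?mulr_gt0 // mul1r; move: c0 eta0; clear; lra.
have [C [C0 hC]] := @g_upper R k a (ltnW k2) a0.
have [x1 hx1] := @ln_eventually R (eta / 2) C ltac:(by rewrite divr_gt0).
exists x1 => x hx; have [x2 lx1 lxC] := hx1 x hx.
have [N_gt0 N_lo N_hi lnN] := truncn_ln x2.
have xp : 0 < x by apply: lt_le_trans x2.
have lxp : 0 < ln x by apply: lt_le_trans lx1.
rewrite /normalized_sum -/c mulrC ler_pdivrMr ?mulr_gt0 // -(ler_pM2l (_ : 0 < 1 - a)) ?subr_gt0 //.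
rewrite mulr_sumr; apply: le_trans (_ : \sum_(1 <= n < (Num.truncn x).+1) (c * ln x + C) <= _).
  rewrite big_nat_cond [leRHS]big_nat_cond; apply: ler_sum => n /andP[/andP[n0 nN] _].
  apply: le_trans (hC n n0) _; rewrite lerD2r -/c; apply: ler_wpM2l => //.
  rewrite ler_ln ?posrE ?ltr0n //; apply: le_trans N_hi.
  by rewrite ler_nat -ltnS.
rewrite big_const_nat subSS subn0 iter_addr addr0 -[_ *+ _]mulr_natr.
have cC : 0 <= c * ln x + C by rewrite addr_ge0 // mulr_ge0 // ltW.
apply: le_trans (ler_wpM2l cC N_hi) _.
rewrite (_ : (1 - a) * ((c + eta) * (x * ln x)) = (c + eta / 2) * ln x * x); last first.
  by rewrite (_ : c + eta / 2 = (c + eta) - a * (c + eta)); [ring|rewrite aE; field].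
apply: ler_wpM2r; first exact: ltW.
by move: lxC; clear; lra.
Qed.

Theorem corollary1p3 (R : realType) (k : nat) (hk : (2 <= k)%N) :
  ((3 * (k%:R - 1) / ln 12)%:E
     <= limf_einf (fun x : R => (normalized_sum k x)%:E) (pinfty_nbhs R))%E
  /\ (limf_einf (fun x : R => (normalized_sum k x)%:E) (pinfty_nbhs R)
     <= limf_esup (fun x : R => (normalized_sum k x)%:E) (pinfty_nbhs R))%E
  /\ (limf_esup (fun x : R => (normalized_sum k x)%:E) (pinfty_nbhs R)
     <= ((k%:R - 1) / ln 2)%:E)%E.
Proof.
split; first by apply: limf_einf_ge => eta; exact: normalized_sum_lower.
split; first exact: limf_einf_le_esup.
by apply: limf_esup_le => eta; exact: normalized_sum_upper.
Qed.
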